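(* Let $(M_i,\phi_i,\xi_i,\eta_i,g_i)$, $i=1,2$, be compact trans-Sasakian manifolds of real dimension $3$, and let $M=M_1\times M_2$, of complex dimension $3$, be equipped with the product metric $g=g_1+g_2$ and the complex structure $J=\phi_1-\eta_2\otimes\xi_1+\phi_2+\eta_1\otimes\xi_2$. Then $(M,J,g)$ is astheno-Kähler in each of the following cases, where $\alpha_1,\alpha_2$ denote nonzero real constants: (a) $M_1$ is $\alpha_1$-Sasakian and $M_2$ is $\alpha_2$-Sasakian; (b) $M_1$ is $\alpha_1$-Sasakian and $M_2$ is cosymplectic; (c) $M_1$ is cosymplectic and $M_2$ is $\alpha_2$-Sasakian; (d) $M_1$ and $M_2$ are both cosymplectic.
   Context: An almost contact metric manifold is an odd-dimensional Riemannian manifold $(N^{2n+1},g)$ with a $(1,1)$-tensor field $\phi$, a vector field $\xi$ and a 1-form $\eta$ such that $\eta(\xi)=1$, $\phi^2X=-X+\eta(X)\xi$ and $g(\phi X,\phi Y)=g(X,Y)-\eta(X)\eta(Y)$ for all vector fields $X,Y$. With $\nabla$ the Levi-Civita connection of $g$, the manifold is trans-Sasakian of type $(\alpha,\beta)$, where $\alpha,\beta$ are smooth functions on $N$, if $$(\nabla_X\phi)Y=\alpha\,(g(X,Y)\xi-\eta(Y)X)+\beta\,(g(\phi X,Y)\xi-\eta(Y)\phi X)$$ for all vector fields $X,Y$; it is trans-Sasakian if this holds for some $\alpha,\beta$. It is $\alpha$-Sasakian if $\beta=0$ and $\alpha$ is a nonzero real constant, and cosymplectic if $\alpha=\beta=0$,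 i.e. $\nabla\phi=0$. On the product $M=M_1\times M_2$ the tensors $\phi_i,\xi_i,\eta_i,g_i$ are extended in the obvious way to $M$, so that $J$ acts as $J X=\phi_1X_1-\eta_2(X_2)\xi_1+\phi_2X_2+\eta_1(X_1)\xi_2$ for $X=X_1+X_2$ with $X_i$ tangent to $M_i$. Since trans-Sasakian structures are normal, $J$ is an integrable complex structure (Morimoto's complex structure), and $g=g_1+g_2$ is a Hermitian metric on $(M,J)$. A Hermitian manifold $(M,J,g)$ of complex dimension $m$, with Kähler form $\Omega(X,Y)=g(JX,Y)$, is called astheno-Kähler if $\partial\bar\partial\,\Omega^{m-2}=0$; for $m=3$ this means $\partial\bar\partial\,\Omega=0$. *)

(* Defs.v *)
From HB Require Import structures.
From mathcomp Require Import all_boot all_order all_algebra.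
From mathcomp Require Import all_classical all_reals all_analysis.
From mathcomp Require Import complex.
Import Order.TTheory GRing.Theory Num.Theory.
Import numFieldNormedType.Exports.

Set Implicit Arguments.
Unset Strict Implicit.
Unset Printing Implicit Defensive.

Local Open Scope classical_set_scope.
Local Open Scope ring_scope.

(* f is C^k on U; U is open wherever this is used. *)
Fixpoint Ck (R : numFieldType) (V W : normedModType R) (k : nat)
    (U : set V) (f : V -> W) : Prop :=
  if k is k'.+1 then
    (forall x, U x -> differentiable f x) /\ (forall v, Ck k' U ('D_v f))
  else forall x, U x -> {for x, continuous f}.

Definition Cinfty (R : numFieldType) (V W : normedModType R)
    (U : set V) (f : V -> W) : Prop := forall k, Ck k U f.

Section SmoothLemmas.
Variable R : realType.

Lemma near_eq_differentiable (V W : normedModType R) (f g : V -> W) (x : V) :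
  (\near x, f x = g x) -> differentiable f x -> differentiable g x.
Proof.
move=> fg df.
have fxgx : f x = g x by exact: nbhs_singleton fg.
have [dfc /eqaddoP dfe] := (diff_locallyP x f).1 df.
have ge : g \o shift x = cst (g x) + 'd f x +o_ (0 : V) id.
  apply/eqaddoP => e e0; have := dfe _ e0; apply: filter_app.
  have : \forall h \near (0 : V), f (h + x) = g (h + x).
    by move: fg; rewrite (near_shift 0 x) /=; apply: filter_app; near=> h; rewrite /= subr0.
  apply: filter_app; near=> h => fgh; rewrite /= -[(_ + _ : V -> W) h]/(_ + _).
  by rewrite ![(_ + _ : _ -> _) _]/(_ + _) ![(- _ : _ -> _) _]/(- _) /= fgh
    ![(_ + _ : _ -> _) _]/(_ + _) /cst fxgx.
have dE : 'd g x = 'd f x :> (V -> W) by exact: diff_unique.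
by apply/diff_locallyP; rewrite dE.
Unshelve. all: by end_near. Qed.

Lemma Ck_eq k (V W : normedModType R) (U : set V) (f g : V -> W) :
  open U -> (forall x, U x -> f x = g x) -> Ck k U f -> Ck k U g.
Proof.
move=> oU; elim: k f g => [|k IHk] f g fg.
  move=> /= fc x Ux.
  have fgx : \near x, f x = g x by near=> y; apply: fg; near: y; exact: open_nbhs_nbhs.
  suff : g y @[y --> x] --> f x by rewrite fg.
  by apply: cvg_trans (fc x Ux); apply: near_eq_cvg; exact: fgx.
move=> /= [fd fD].
have fgx x : U x -> \near x, f x = g x.
  by move=> Ux; near=> y; apply: fg; near: y; exact: open_nbhs_nbhs.
split=> [x Ux|v]; first exact: near_eq_differentiable (fgx x Ux) (fd x Ux).
by apply: IHk (fD v) => x Ux; apply: near_eq_derive; exact: fgx.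
Unshelve. all: by end_near. Qed.

Lemma Ck_sub k (V W : normedModType R) (U U' : set V) (f : V -> W) :
  U' `<=` U -> Ck k U f -> Ck k U' f.
Proof.
move=> sU; elim: k f => [|k IHk] f /=; first by move=> fc x /sU; exact: fc.
by move=> [fd fD]; split=> [x /sU|v]; [exact: fd|exact: IHk].
Qed.

Lemma Ck_comp_linear k (V V' W : normedModType R) (U : set V')
    (L : {linear V -> V'}) (f : V' -> W) :
  continuous L -> Ck k U f -> Ck k (L @^-1` U) (f \o L).
Proof.
move=> cL; elim: k f => [|k IHk] f /=.
  by move=> fc x Ux; apply: continuous_comp; [exact: cL|exact: fc].
move=> [fd fD]; split=> [x Ux|v].
  by apply: differentiable_comp; [exact: linear_differentiable|exact: fd].
suff -> : 'D_v (f \o L) = 'D_(L v) f \o L by exact: IHk.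
apply/funext => x; have LE h : L (h *: v + x) = h *: L v + L x by rewrite linearD linearZ_LR.
rewrite /derive; congr (lim _); set F := (F in F @ _); set G := (F in _ = F @ _).
suff -> : F = G by [].
by apply/funext => h; rewrite /F /G /= LE.
Qed.

Lemma continuous_row_mx (V : topologicalType) n1 n2 (f : V -> 'rV[R]_n1)
    (g : V -> 'rV[R]_n2) (x : V) :
  {for x, continuous f} -> {for x, continuous g} ->
  {for x, continuous (fun y => row_mx (f y) (g y))}.
Proof.
move=> fc gc; apply/cvg_ballP => e e0.
have /cvg_ballP/(_ e e0) fe := fc; have /cvg_ballP/(_ e e0) ge := gc.
near=> y; split=> // i j; rewrite -[j]splitK.
have [_ fy] : ball (f x) e (f y) by near: y.
have [_ gy] : ball (g x) e (g y) by near: y.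
by case: (fintype.split j) => k /=; rewrite ?row_mxEl ?row_mxEr; [exact: fy|exact: gy].
Unshelve. all: by end_near. Qed.

Lemma Ck_linear_comp k (V W W' : normedModType R) (U : set V)
    (L : {linear W -> W'}) (f : V -> W) :
  open U -> continuous L -> Ck k U f -> Ck k U (L \o f).
Proof.
move=> oU cL; elim: k f => [|k IHk] f /=.
  by move=> fc x Ux; apply: continuous_comp; [exact: fc|exact: cL].
have dL y : differentiable L y by exact: linear_differentiable.
move=> [fd fD]; split=> [x Ux|v].
  by apply: differentiable_comp; [exact: fd|exact: dL].
apply: (@Ck_eq _ _ _ _ (L \o 'D_v f)) => // [x Ux|]; last exact: IHk.
have fdx := fd x Ux.
have dLfx := differentiable_comp fdx (dL (f x)).
have dE := diff_comp fdx (dL (f x)).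
have LE := diff_lin (f x) cL.
by rewrite (deriveE _ dLfx) dE LE /= (deriveE _ fdx).
Qed.

Lemma CkD k (V W : normedModType R) (U : set V) (f g : V -> W) :
  open U -> Ck k U f -> Ck k U g -> Ck k U (f + g).
Proof.
move=> oU; elim: k f g => [|k IHk] f g /=.
  by move=> fc gc x Ux; apply: continuousD; [exact: fc|exact: gc].
move=> [fd fD] [gd gD]; split=> [x Ux|v].
  by apply: differentiableD; [exact: fd|exact: gd].
apply: (@Ck_eq _ _ _ _ ('D_v f + 'D_v g)) => // [x Ux|]; last exact: IHk.
by rewrite deriveD//; apply: diff_derivable; [exact: fd|exact: gd].
Qed.

Lemma Ck_row_mx k (V : normedModType R) n1 n2 (U : set V) (f : V -> 'rV[R]_n1)
    (g : V -> 'rV[R]_n2) :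
  open U -> Ck k U f -> Ck k U g -> Ck k U (fun y => row_mx (f y) (g y)).
Proof.
move=> oU fk gk.
have il : linear (fun u : 'rV[R]_n1 => row_mx u (0 : 'rV[R]_n2)).
  by move=> a u v; rewrite scale_row_mx add_row_mx scaler0 addr0.
have ir : linear (fun u : 'rV[R]_n2 => row_mx (0 : 'rV[R]_n1) u).
  by move=> a u v; rewrite scale_row_mx add_row_mx scaler0 addr0.
pose L1 : {linear 'rV[R]_n1 -> 'rV[R]_(n1 + n2)} :=
  HB.pack (fun u : 'rV[R]_n1 => row_mx u (0 : 'rV[R]_n2))
    (GRing.isLinear.Build _ _ _ _ _ il).
pose L2 : {linear 'rV[R]_n2 -> 'rV[R]_(n1 + n2)} :=
  HB.pack (fun u : 'rV[R]_n2 => row_mx (0 : 'rV[R]_n1) u)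
    (GRing.isLinear.Build _ _ _ _ _ ir).
have cL1 : continuous L1.
  by move=> u; apply: (@continuous_row_mx _ _ _ idfun (cst 0) u);
    [exact: cvg_id|exact: cst_continuous].
have cL2 : continuous L2.
  by move=> u; apply: (@continuous_row_mx _ _ _ (cst 0) idfun u);
    [exact: cst_continuous|exact: cvg_id].
have -> : (fun y => row_mx (f y) (g y)) = (L1 \o f) + (L2 \o g).
  by apply/funext => y; rewrite fctE /= add_row_mx addr0 add0r.
by apply: CkD => //; exact: Ck_linear_comp.
Qed.

End SmoothLemmas.

Record chart (R : realType) (n : nat) (M : topologicalType) := Chart {
  source : set M;
  coord : M -> 'rV[R]_n;
  param : 'rV[R]_n -> M;
  source_open : open source;
  target_open : open (coord @` source);
  coordK : forall p, source p -> param (coord p) = p;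
  coord_continuous : forall p, source p -> {for p, continuous coord};
  param_continuous :
    forall x, (coord @` source) x -> {for x, continuous param} }.

Definition target (R : realType) (n : nat) (M : topologicalType)
  (c : chart R n M) : set 'rV[R]_n := coord c @` source c.

(* A smooth manifold of dimension n without boundary. Its smooth structure is
   given by an atlas with one distinguished chart around each point p; the
   tangent space at p is 'rV_n, a vector v standing for the components of a
   tangent vector in the coordinate frame of the chart [chart_at p]. *)
Record manifold (R : realType) (n : nat) := Manifold {
  points :> topologicalType;
  chart_at : points -> chart R n points;
  source_chart_at : forall p, source (chart_at p) p;
  manifold_hausdorff : hausdorff_space points;
  manifold_second_countable : @second_countable points;
  chart_compatible : forall a b,
    Cinfty (coord (chart_at a) @` (source (chart_at a) `&` source (chart_at b)))
           (coord (chart_at b) \o param (chart_at a)) }.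

Lemma open_transition (R : realType) (n : nat) (M : topologicalType)
    (c d : chart R n M) : open (coord c @` (source c `&` source d)).
Proof.
have -> : coord c @` (source c `&` source d) =
          target c `&` param c @^-1` source d.
  apply/seteqP; split=> [_ [p [cp dp] <-]|_ [[p cp <-]]].
    by split; [exists p|rewrite /= coordK].
  by rewrite /= coordK// => dp; exists p.
rewrite openE => x [tx dx]; apply: filterI.
  by apply: open_nbhs_nbhs; split=> //; exact: target_open.
apply: (param_continuous tx); apply: open_nbhs_nbhs; split=> //.
exact: source_open.
Qed.

Section ProductManifold.
Variables (R : realType) (n1 n2 : nat).

Section ProductChart.
Variables (M1 M2 : topologicalType) (c1 : chart R n1 M1) (c2 : chart R n2 M2).

Let source12 : set (M1 * M2)%type := source c1 `*` source c2.
Let coord12 (p : M1 * M2) : 'rV[R]_(n1 + n2) :=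
  row_mx (coord c1 p.1) (coord c2 p.2).
Let param12 (x : 'rV[R]_(n1 + n2)) : M1 * M2 :=
  (param c1 (lsubmx x), param c2 (rsubmx x)).

Lemma coord_prodE (A : set M1) (B : set M2) :
  coord12 @` (A `*` B) =
  lsubmx @^-1` (coord c1 @` A) `&` rsubmx @^-1` (coord c2 @` B).
Proof.
apply/seteqP; split=> [_ [[p q] /= [Ap Bq] <-]|x [[p Ap px] [q Bq qx]]].
  by rewrite /coord12 /= row_mxKl row_mxKr; split; [exists p|exists q].
by exists (p, q) => //; rewrite /coord12 /= px qx hsubmxK.
Qed.

Lemma open_prod_preimage (A : set 'rV[R]_n1) (B : set 'rV[R]_n2) :
  open A -> open B ->
  open (lsubmx @^-1` A `&` rsubmx @^-1` B : set 'rV[R]_(n1 + n2)).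
Proof.
move=> oA oB; apply: openI; apply: open_comp => // x _;
  [exact: continuous_lsubmx|exact: continuous_rsubmx].
Qed.

Fact prod_source_open : open source12.
Proof.
rewrite openE => -[p q] [/= cp cq]; exists (source c1, source c2) => //=.
by split; apply: open_nbhs_nbhs; split=> //; exact: source_open.
Qed.

Fact prod_target_open : open (coord12 @` source12).
Proof.
by rewrite coord_prodE; apply: open_prod_preimage; exact: target_open.
Qed.

Fact prod_coordK p : source12 p -> param12 (coord12 p) = p.
Proof.
case: p => p q [/= cp cq]; rewrite /param12 /coord12 /= row_mxKl row_mxKr.
by rewrite !coordK.
Qed.

Fact prod_coord_continuous p : source12 p -> {for p, continuous coord12}.
Proof.
case: p => p q [/= cp cq]; apply: continuous_row_mx.
  apply: (@continuous_comp _ _ _ fst (coord c1)); first exact: cvg_fst.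
  exact: coord_continuous.
apply: (@continuous_comp _ _ _ snd (coord c2)); first exact: cvg_snd.
exact: coord_continuous.
Qed.

Fact prod_param_continuous x :
  (coord12 @` source12) x -> {for x, continuous param12}.
Proof.
rewrite coord_prodE => -[xl xr].
have cl : {for x, continuous (param c1 \o lsubmx)}.
  apply: continuous_comp; first exact: continuous_lsubmx.
  exact: param_continuous.
have cr : {for x, continuous (param c2 \o rsubmx)}.
  apply: continuous_comp; first exact: continuous_rsubmx.
  exact: param_continuous.
exact: (cvg_pair cl cr).
Qed.

Definition prod_chart : chart R (n1 + n2) (M1 * M2)%type :=
  Chart prod_source_open prod_target_open prod_coordK
        prod_coord_continuous prod_param_continuous.

End ProductChart.

Variables (M1 : manifold R n1) (M2 : manifold R n2).

Definition prod_chart_at (p : M1 * M2) :=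
  prod_chart (chart_at p.1) (chart_at p.2).

Fact source_prod_chart_at p : source (prod_chart_at p) p.
Proof. by split; exact: source_chart_at. Qed.

Fact prod_hausdorff : hausdorff_space (M1 * M2)%type.
Proof.
move=> [p1 p2] [q1 q2] cl; congr (_, _).
  apply: (@manifold_hausdorff _ _ M1) => A B nA nB.
  have [] := cl (A `*` setT) (B `*` setT).
  - by exists (A, setT) => //; split=> //; exact: filterT.
  - by exists (B, setT) => //; split=> //; exact: filterT.
  by move=> [r1 r2] [[/= Ar _] [/= Br _]]; exists r1.
apply: (@manifold_hausdorff _ _ M2) => A B nA nB.
have [] := cl (setT `*` A) (setT `*` B).
- by exists (setT, A) => //; split=> //; exact: filterT.
- by exists (setT, B) => //; split=> //; exact: filterT.
by move=> [r1 r2] [[/= _ Ar] [/= _ Br]]; exists r2.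
Qed.

Fact prod_second_countable : @second_countable (M1 * M2)%type.
Proof.
have [B1 cB1 [oB1 bB1]] := manifold_second_countable M1.
have [B2 cB2 [oB2 bB2]] := manifold_second_countable M2.
exists ((fun UV => UV.1 `*` UV.2) @` (B1 `*` B2)).
  by apply: sub_countable (card_image_le _ _) _; exact: countableX.
split=> [_ [[U V] /= [BU BV] <-]|[p q] A].
  rewrite openE => -[r s] [/= Ur Vs]; exists (U, V) => //=.
  by split; apply: open_nbhs_nbhs; split=> //; [exact: oB1|exact: oB2].
move=> [[A1 A2] /= [nA1 nA2] sA].
have [U [BU Up] UA] := bB1 p _ nA1; have [V [BV Vq] VA] := bB2 q _ nA2.
exists (U `*` V); first by split=> //; exists (U, V).
by move=> [r s] [/= Ur Vs]; apply: sA; split; [exact: UA|exact: VA].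
Qed.

Fact prod_chart_compatible a b :
  Cinfty (coord (prod_chart_at a) @`
            (source (prod_chart_at a) `&` source (prod_chart_at b)))
         (coord (prod_chart_at b) \o param (prod_chart_at a)).
Proof.
move=> k; set c1 := chart_at a.1; set d1 := chart_at b.1.
set c2 := chart_at a.2; set d2 := chart_at b.2.
pose A := source c1 `&` source d1; pose B := source c2 `&` source d2.
have -> : source (prod_chart_at a) `&` source (prod_chart_at b) = A `*` B.
  by apply/seteqP; split=> -[p q] /= [[? ?] [? ?]].
rewrite [X in Ck _ X _]coord_prodE.
have oA : open (coord c1 @` A) by exact: open_transition.
have oB : open (coord c2 @` B) by exact: open_transition.
have oAB := open_prod_preimage oA oB.
apply: Ck_row_mx => //.
  apply: (@Ck_sub _ _ _ _ (lsubmx @^-1` (coord c1 @` A))) => [x []//|].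
  apply: (@Ck_comp_linear _ _ _ _ _ _ lsubmx) (chart_compatible a.1 b.1 k).
  exact: continuous_lsubmx.
apply: (@Ck_sub _ _ _ _ (rsubmx @^-1` (coord c2 @` B))) => [x []//|].
apply: (@Ck_comp_linear _ _ _ _ _ _ rsubmx) (chart_compatible a.2 b.2 k).
exact: continuous_rsubmx.
Qed.

Definition prod_manifold : manifold R (n1 + n2) :=
  Manifold source_prod_chart_at prod_hausdorff prod_second_countable
           prod_chart_compatible.

End ProductManifold.

Section Calculus.
Variables (R : realType) (n : nat) (M : manifold R n).

(* A tangent vector field, not necessarily smooth; X p is the vector of
   components in the frame of [chart_at p], which depends on p, so smoothness
   is not smoothness of X itself: see [smooth_vfield]. *)
Definition vfield := M -> 'rV[R]_n.

(* X(F) *)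
Definition der (V : normedModType R) (X : vfield) (F : M -> V) : M -> V :=
  fun p => 'D_(X p) (F \o param (chart_at p)) (coord (chart_at p) p).

(* Jacobian at p of the transition from [chart_at a] to [chart_at b]. Hence
   v *m transition p a p are the components in [chart_at a] of v in T_p M, and
   the rows of transition a p p are the coordinate fields of [chart_at a]. *)
Definition transition (a b p : M) : 'M[R]_n :=
  jacobian (coord (chart_at b) \o param (chart_at a)) (coord (chart_at a) p).

Definition smooth_in_charts (V : normedModType R) (F : M -> M -> V) : Prop :=
  forall a, Cinfty (target (chart_at a)) (F a \o param (chart_at a)).

(* Smoothness of tensor fields: smoothness of their components in charts. *)
Definition smooth_fun (f : M -> R) : Prop := smooth_in_charts (fun _ => f).

Definition smooth_vfield (X : vfield) : Prop :=
  smooth_in_charts (fun a p => X p *m transition p a p).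

Definition smooth_1form (eta : M -> 'cV[R]_n) : Prop :=
  smooth_in_charts (fun a p => transition a p p *m eta p).

Definition smooth_endo (A : M -> 'M[R]_n) : Prop :=
  smooth_in_charts (fun a p => transition a p p *m A p *m transition p a p).

Definition smooth_bilinear (g : M -> 'M[R]_n) : Prop :=
  smooth_in_charts (fun a p => transition a p p *m g p *m (transition a p p)^T).

Definition ev (eta : M -> 'cV[R]_n) (X : vfield) : M -> R :=
  fun p => (X p *m eta p) 0 0.

Definition app (A : M -> 'M[R]_n) (X : vfield) : vfield := fun p => X p *m A p.

Definition ip (g : M -> 'M[R]_n) (X Y : vfield) : M -> R :=
  fun p => (X p *m g p *m (Y p)^T) 0 0.

(* [X, Y] at p, in the coordinates of [chart_at p] : X(Y^i) - Y(X^i). *)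
Definition lie (X Y : vfield) : vfield := fun p =>
  der X (fun q => Y q *m transition q p q) p -
  der Y (fun q => X q *m transition q p q) p.

Definition riemannian (g : M -> 'M[R]_n) : Prop :=
  [/\ smooth_bilinear g, forall p, (g p)^T = g p &
      forall p (v : 'rV[R]_n), v != 0 -> 0 < (v *m g p *m v^T) 0 0].

(* D X Y stands for nabla_X Y; D is the Levi-Civita connection of g, which is
   determined by these conditions on smooth vector fields. *)
Record levi_civita (g : M -> 'M[R]_n) (D : vfield -> vfield -> vfield) : Prop :=
  LeviCivita {
    lc_smooth : forall X Y, smooth_vfield X -> smooth_vfield Y ->
      smooth_vfield (D X Y);
    lc_addl : forall X X' Y,
      smooth_vfield X -> smooth_vfield X' -> smooth_vfield Y ->
      forall p, D (fun q => X q + X' q) Y p = D X Y p + D X' Y p;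
    lc_scalel : forall f X Y,
      smooth_fun f -> smooth_vfield X -> smooth_vfield Y ->
      forall p, D (fun q => f q *: X q) Y p = f p *: D X Y p;
    lc_addr : forall X Y Y',
      smooth_vfield X -> smooth_vfield Y -> smooth_vfield Y' ->
      forall p, D X (fun q => Y q + Y' q) p = D X Y p + D X Y' p;
    lc_leibniz : forall f X Y,
      smooth_fun f -> smooth_vfield X -> smooth_vfield Y ->
      forall p, D X (fun q => f q *: Y q) p = der X f p *: Y p + f p *: D X Y p;
    lc_torsion_free : forall X Y, smooth_vfield X -> smooth_vfield Y ->
      forall p, D X Y p - D Y X p = lie X Y p;
    lc_metric : forall X Y Z,
      smooth_vfield X -> smooth_vfield Y -> smooth_vfield Z ->
      forall p, der X (ip g Y Z) p = ip g (D X Y) Z p + ip g Y (D X Z) p }.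

(* An integrable almost complex structure (vanishing Nijenhuis tensor)
   together with a Hermitian metric. *)
Record hermitian (J g : M -> 'M[R]_n) : Prop := Hermitian {
  herm_smooth : smooth_endo J;
  herm_square : forall p, J p *m J p = - 1%:M;
  herm_integrable : forall X Y, smooth_vfield X -> smooth_vfield Y ->
    forall p, lie (app J X) (app J Y) p - app J (lie (app J X) Y) p
              - app J (lie X (app J Y)) p - lie X Y p = 0;
  herm_riemannian : riemannian g;
  herm_compatible : forall X Y p, ip g (app J X) (app J Y) p = ip g X Y p }.

(* Complex-valued k-forms, given by their values on real vector fields. *)
Definition form (k : nat) := ('I_k -> vfield) -> M -> R[i].

Definition cder (X : vfield) (f : M -> R[i]) : M -> R[i] := fun p =>
  Complex (der X (fun q => complex.Re (f q)) p)
          (der X (fun q => complex.Im (f q)) p).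

(* The invariant formula
     dw(X_0,...,X_k) = \sum_i (-1)^i X_i (w(..., ^X_i, ...))
       + \sum_(i < j) (-1)^(i + j) w([X_i, X_j], ..., ^X_i, ..., ^X_j, ...),
   where, w being alternating, the bracket is moved to the slot of X_j; this
   turns the sign (-1)^(i + j) into - (-1)^i. *)
Definition ext_d (k : nat) (w : form k) : form k.+1 := fun X p =>
  \sum_(i < k.+1) (-1) ^+ i *
    (cder (X i) (w (fun l => X (lift i l))) p
     - \sum_(j < k | (i <= j)%N)
         w (fun l => if l == j then lie (X i) (X (lift i j))
                     else X (lift i l)) p).

(* The component of type (q, k - q) of a k-form: the sum over the sets S of q
   slots of w(Y_0, ..., Y_(k-1)), extended complex-multilinearly, where
   Y_l = (X_l - i J X_l) / 2 for l in S and Y_l = (X_l + i J X_l) / 2 otherwise.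
   T is the set of slots where the term with J X_l is selected. *)
Definition type_part (J : M -> 'M[R]_n) (k q : nat) (w : form k) : form k :=
  fun X p =>
  \sum_(S : {set 'I_k} | #|S| == q) \sum_(T : {set 'I_k})
    (2%:R^-1) ^+ k *
    (\prod_(l in T) (if l \in S then Complex 0 (-1) else Complex 0 1)) *
    w (fun l => if l \in T then app J (X l) else X l) p.

Definition del (J : M -> 'M[R]_n) (k : nat) (w : form k) : form k.+1 :=
  fun X p => \sum_(q < k.+1) type_part J q.+1 (ext_d (type_part J q w)) X p.

Definition delbar (J : M -> 'M[R]_n) (k : nat) (w : form k) : form k.+1 :=
  fun X p => \sum_(q < k.+1) type_part J q (ext_d (type_part J q w)) X p.

(* Omega(X, Y) = g(J X, Y) *)
Definition kahler_form (J g : M -> 'M[R]_n) : form 2 := fun X p =>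
  Complex (ip g (app J (X 0)) (X 1) p) 0.

(* Almost contact metric structures; the axioms force n to be odd. *)
Record acm_structure := AcmStructure {
  phi : M -> 'M[R]_n;
  xi : vfield;
  eta : M -> 'cV[R]_n;
  met : M -> 'M[R]_n;
  phi_smooth : smooth_endo phi;
  xi_smooth : smooth_vfield xi;
  eta_smooth : smooth_1form eta;
  met_riemannian : riemannian met;
  eta_xi : forall p, ev eta xi p = 1;
  phi_square : forall X p, app phi (app phi X) p = - X p + ev eta X p *: xi p;
  met_phi : forall X Y p,
    ip met (app phi X) (app phi Y) p = ip met X Y p - ev eta X p * ev eta Y p }.

Definition trans_sasakian_type (S : acm_structure) (alpha beta : M -> R) :=
  exists2 D, levi_civita (met S) D &
  forall X Y, smooth_vfield X -> smooth_vfield Y -> forall p,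
    D X (app (phi S) Y) p - app (phi S) (D X Y) p =
    alpha p *: (ip (met S) X Y p *: xi S p - ev (eta S) Y p *: X p) +
    beta p *: (ip (met S) (app (phi S) X) Y p *: xi S p
               - ev (eta S) Y p *: app (phi S) X p).

Definition trans_sasakian (S : acm_structure) : Prop :=
  exists alpha beta, [/\ smooth_fun alpha, smooth_fun beta &
                         trans_sasakian_type S alpha beta].

Definition alpha_sasakian (S : acm_structure) (alpha : R) : Prop :=
  alpha != 0 /\ trans_sasakian_type S (fun=> alpha) (fun=> 0).

Definition cosymplectic (S : acm_structure) : Prop :=
  trans_sasakian_type S (fun=> 0) (fun=> 0).

End Calculus.

(* In complex dimension m = 3 the condition on Omega^(m - 2) is one on Omega. *)
Definition astheno_kahler3 (R : realType) (M : manifold R 6)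
    (J g : M -> 'M[R]_6) : Prop :=
  hermitian J g /\
  forall X : 'I_4 -> vfield M, (forall i, smooth_vfield (X i)) ->
  forall p, del J (delbar J (kahler_form J g)) X p = 0.

Section Product.
Variables (R : realType) (n1 n2 : nat) (M1 : manifold R n1) (M2 : manifold R n2).
Variables (S1 : acm_structure M1) (S2 : acm_structure M2).
Let M := prod_manifold M1 M2.

Definition prod_metric (p : M) : 'M[R]_(n1 + n2) :=
  block_mx (met S1 p.1) 0 0 (met S2 p.2).

(* Tangent vectors being rows, the second block of the first line sends X_1 to
   eta_1(X_1) xi_2. *)
Definition morimoto (p : M) : 'M[R]_(n1 + n2) :=
  block_mx (phi S1 p.1)                  (eta S1 p.1 *m xi S2 p.2)
           (- (eta S2 p.2 *m xi S1 p.1)) (phi S2 p.2).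

End Product.

(* Main.v *)
From HB Require Import structures.
From mathcomp Require Import all_boot all_order all_algebra.
From mathcomp Require Import all_classical all_reals all_analysis.
From mathcomp Require Import complex ring.
Require Import Defs.
Import Order.TTheory GRing.Theory Num.Theory.
Import numFieldNormedType.Exports.

Set Implicit Arguments.
Unset Strict Implicit.
Unset Printing Implicit Defensive.

Local Open Scope classical_set_scope.
Local Open Scope ring_scope.

(** On a three-dimensional manifold with an almost contact metric structure
    satisfying the trans-Sasakian equation with alpha constant and beta zero,
    write Phi(X, Y) = g(phi X, Y). The defining equation for nabla phi gives
    nabla_X xi = - alpha phi X, hence

      d eta = c Phi  with c = - 2 alpha,   d Phi = 0,

    and Phi /\ Phi = 0 because the dimension is three. The four cases are
    the ones where each of alpha_1, alpha_2 is either nonzero or zero, so they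
    are treated together.

    On the product the fundamental form is
      Omega = Phi_1 + Phi_2 + eta_1 /\ eta_2,
    so that
      T := d Omega = c_1 Phi_1 /\ eta_2 - c_2 Phi_2 /\ eta_1.
    Since Phi_i is J-invariant, eta_1 o J = - eta_2 and eta_2 o J = eta_1, the
    form T has no component of type (3, 0) or (0, 3), and
      T' := T(J., J., J.) = c_1 Phi_1 /\ eta_1 + c_2 Phi_2 /\ eta_2.
    Hence every type projection maps the complex span of T and T' to itself.
    Both forms are closed: d T = c_1 c_2 (Phi_1 /\ Phi_2 - Phi_2 /\ Phi_1) = 0
    and d T' = c_1^2 Phi_1 /\ Phi_1 + c_2^2 Phi_2 /\ Phi_2 = 0. As each type
    projection of Omega is a multiple of Omega, delbar Omega lies in that span
    and del delbar Omega = 0, without computing any coefficient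
    ([del_delbar_fform]).

    Integrability of J is read off from the torsion-free product connection:
    the Nijenhuis tensor is an algebraic expression in nabla J, which is
    computed from the same structure equations ([nabla_J]) and for which that
    expression vanishes ([dJ_nijenhuis], [morimoto_integrable]).

    The geometry of a factor is transported to the product without extending
    tangent vectors. A vector field of the product restricts on each slice
    N x {p_2} to a smooth vector field along the slice with components in T N,
    to which the equations on N apply. In the transversal direction the tensors
    pulled back from N are constant, so there the derivative of a vector
    field along the projection is an ordinary directional derivative. The sum of
    the two is the pullback connection [conn], and all the equations above are
    derived for it. Evaluating d Omega on brackets requires brackets of smooth
    fields to be smooth in the sense of charts ([smooth_lie]), that is, the
    symmetry of second derivatives of the transition maps ([schwarz]). *)

(** * Symmetry of second derivatives *)

Section DeriveLine.
Variable R : realType.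

(** Directional derivatives depend on a function through its restriction to a
    line; this transports them along affine maps without any chain rule. *)
Lemma derive_line_eq (V V' W : normedModType R) (f : V -> W) (g : V' -> W)
    (x v : V) (y w : V') :
  (forall h : R, f (h *: v + x) = g (h *: w + y)) ->
  ('D_v f x = 'D_w g y) * (derivable f x v = derivable g y w).
Proof.
move=> fg; have fgx : f x = g y by have := fg 0; rewrite !scale0r !add0r.
have E : (fun h : R => h^-1 *: ((f \o shift x) (h *: v) - f x)) =
         (fun h : R => h^-1 *: ((g \o shift y) (h *: w) - g y)).
  by apply/funext => h; rewrite /= fg fgx.
by rewrite /derive /derivable E.
Qed.

End DeriveLine.

#[local] Opaque derive.

Section Schwarz.
Variables (R : realType) (V : normedModType R).

Lemma derive_line (W : normedModType R) (f : V -> W) (x u : V) (s : R) :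
  derivable f (x + s *: u) u ->
  is_derive s 1 (fun t : R => f (x + t *: u)) ('D_u f (x + s *: u)).
Proof.
have E h : f (h *: u + (x + s *: u)) = (fun t : R => f (x + t *: u)) (h *: 1 + s).
  by rewrite [h *: 1]mulr1 scalerDl addrCA.
by move=> df; split; rewrite -?(derive_line_eq E).1 -?(derive_line_eq E).2.
Qed.

Lemma mean_value_line (U : set V) (f : V -> R) (x u : V) (h : R) :
  0 < h -> (forall y, U y -> differentiable f y) ->
  (forall s, 0 <= s <= h -> U (x + s *: u)) ->
  exists2 s, 0 <= s <= h & f (x + h *: u) - f x = 'D_u f (x + s *: u) * h.
Proof.
move=> h0 fd sU.
have dl s : 0 <= s <= h -> is_derive s (1 : R) (fun t : R => f (x + t *: u))
    ('D_u f (x + s *: u)).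
  by move=> /sU/fd df; apply: derive_line; exact: diff_derivable.
have inh s : s \in `]0, h[ -> 0 <= s <= h by rewrite in_itv /= => /andP[/ltW-> /ltW->].
have [|s sh] := MVT h0 (fun s sh => dl s (inh s sh)).
  apply: derivable_within_continuous => s; rewrite in_itv /= => /dl ds.
  exact: ex_derive.
by rewrite scale0r addr0 subr0 => E; exists s => //; exact: inh.
Qed.

(** Two mean values: the first for y |-> f (y + h v) - f y in the direction u,
    the second for 'D_u f in the direction v. *)
Lemma second_difference (U : set V) (f : V -> R) (x u v : V) (h : R) :
  0 < h -> (forall y, U y -> differentiable f y) ->
  (forall y, U y -> differentiable ('D_u f) y) ->
  (forall s t, 0 <= s <= h -> 0 <= t <= h -> U (x + s *: u + t *: v)) ->
  exists2 y, U y & f (x + h *: u + h *: v) - f (x + h *: u) -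
                   (f (x + h *: v) - f x) = 'D_v ('D_u f) y * h * h.
Proof.
move=> h0 fd ufd sU.
have hh : 0 <= h <= h by rewrite lexx ltW.
have zh : 0 <= (0 : R) <= h by rewrite lexx ltW.
have U0 s : 0 <= s <= h -> U (x + s *: u).
  by move=> sh; have := sU s 0 sh zh; rewrite scale0r addr0.
pose g (y : V) := f (y + h *: v) - f y.
pose U' := [set y | U y /\ U (y + h *: v)].
have shd y : U (y + h *: v) -> differentiable (f \o shift (h *: v)) y.
  move=> Uy; apply: differentiable_comp; last exact: fd.
  have dT : differentiable (id + cst (h *: v)) y.
    by apply: differentiableD => //; exact: differentiable_cst.
  exact: dT.
have Dsh y : 'D_u (f \o shift (h *: v)) y = 'D_u f (y + h *: v).
  by apply: (derive_line_eq _).1 => k /=; rewrite addrA.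
have gd y : U' y -> differentiable g y.
  by move=> [Uy Uyh]; exact: differentiableB (shd y Uyh) (fd y Uy).
have gD y : U' y -> 'D_u g y = 'D_u f (y + h *: v) - 'D_u f y.
  move=> [Uy Uyh]; rewrite -Dsh.
  exact: deriveB (diff_derivable (shd y Uyh)) (diff_derivable (fd y Uy)).
have [s sh E] : exists2 s, 0 <= s <= h &
    g (x + h *: u) - g x = 'D_u g (x + s *: u) * h.
  apply: (mean_value_line (U := U')) => // s sh; split; first exact: U0.
  exact: sU.
rewrite gD in E; last by split; [exact: U0|exact: sU].
have [t th E'] : exists2 t, 0 <= t <= h &
    'D_u f (x + s *: u + h *: v) - 'D_u f (x + s *: u) =
    'D_v ('D_u f) (x + s *: u + t *: v) * h.
  exact: (mean_value_line h0 ufd (fun t th => sU s t sh th)).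
exists (x + s *: u + t *: v); first exact: sU.
by rewrite -E' -E.
Qed.

Lemma dist_halves (a b c e : R) : `|a - c| < e / 2 -> `|b - c| < e / 2 -> `|a - b| <= e.
Proof.
move=> ac bc; rewrite (le_trans (ler_distD c a b))//.
by rewrite (splitr e) lerD// ltW// distrC.
Qed.

(** The second difference is symmetric in u and v, so near x the two mixed
    derivatives take a common value, at two possibly different points; both are
    continuous. *)
Lemma schwarz (U : set V) (f : V -> R) (x u v : V) :
  open U -> U x -> Ck 2 U f -> 'D_u ('D_v f) x = 'D_v ('D_u f) x.
Proof.
move=> oU Ux [fd fD].
have ufd w y : U y -> differentiable ('D_w f) y by case: (fD w) => + _; apply.
have c w1 w2 : {for x, continuous ('D_w1 ('D_w2 f))}.
  by case: (fD w2) => _ /(_ w1); exact.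
apply/eqP; rewrite -subr_eq0 -normr_le0; apply/ler_addgt0Pr => e e0; rewrite add0r.
have e20 : 0 < e / 2 by rewrite divr_gt0.
have near_dist (g : V -> R) : {for x, continuous g} ->
    nbhs x [set y | `|g x - g y| < e / 2].
  by move=> /cvgrPdist_lt /(_ _ e20).
pose A := [set y | [/\ U y, `|'D_u ('D_v f) x - 'D_u ('D_v f) y| < e / 2 &
    `|'D_v ('D_u f) x - 'D_v ('D_u f) y| < e / 2]].
have : nbhs x A.
  have nU : nbhs x U by apply: open_nbhs_nbhs.
  have c1 := near_dist _ (c u v); have c2 := near_dist _ (c v u).
  have sA : U `&` ([set y | `|'D_u ('D_v f) x - 'D_u ('D_v f) y| < e / 2] `&`
      [set y | `|'D_v ('D_u f) x - 'D_v ('D_u f) y| < e / 2]) `<=` A.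
    by move=> y [Uy [y1 y2]]; exact: And3 Uy y1 y2.
  exact: filterS sA (filterI nU (filterI c1 c2)).
rewrite -nbhs_ballE => -[r r0 rA].
have rP y : `|x - y| < r -> A y.
  by move=> xy; have /rA : ball x r y by rewrite -ball_normE.
(* Small enough for the parallelogram spanned by h u and h v to stay in the ball. *)
pose h := r / (`|u| + `|v| + 1).
have uv0 : 0 < `|u| + `|v| + 1 by rewrite ltr_wpDl// addr_ge0.
have h0 : 0 < h by rewrite divr_gt0.
pose B := [set y : V | `|x - y| < r].
have inB w1 w2 : `|w1| + `|w2| = `|u| + `|v| -> forall s t, 0 <= s <= h ->
    0 <= t <= h -> B (x + s *: w1 + t *: w2).
  move=> w12 s t /andP[s0 sh] /andP[t0 th]; rewrite /B /= -addrA opprD addNKr normrN.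
  apply: (le_lt_trans (ler_normD _ _)); rewrite !normrZ !ger0_norm//.
  apply: (@le_lt_trans _ _ (h * (`|w1| + `|w2|))).
    by rewrite mulrDr lerD// ler_wpM2r.
  by rewrite w12 /h mulrAC ltr_pdivrMr// ltr_pM2l// ltrDl.
have BU y : B y -> U y by move=> /rP[].
have [y By E1] := second_difference h0 (fun y By => fd y (BU y By))
  (fun y By => ufd u y (BU y By)) (inB u v erefl).
have [z Bz E2] := second_difference h0 (fun y By => fd y (BU y By))
  (fun y By => ufd v y (BU y By)) (inB v u (addrC _ _)).
have E : 'D_v ('D_u f) y = 'D_u ('D_v f) z.
  move: E1 E2; rewrite (addrAC x (h *: v)).
  generalize ('D_v ('D_u f) y) ('D_u ('D_v f) z) => a b E1 E2.
  have hN0 : h != 0 by rewrite gt_eqF.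
  apply: (mulIf hN0); apply: (mulIf hN0); rewrite -E1 -E2; ring.
have [_ d1 _] := rP z Bz; have [_ _ d2] := rP y By; rewrite E in d2.
exact: dist_halves d1 d2.
Qed.

End Schwarz.

(** * Operations on functions of class C^k *)

Section CkClosure.
Variable R : realType.

Lemma CkW k (V W : normedModType R) (U : set V) (f : V -> W) :
  Ck k.+1 U f -> Ck k U f.
Proof.
elim: k f => [|k IHk] f; last first.
  by move=> -[fd fD]; split => // v; apply: IHk; exact: fD.
by move=> -[fd _] x Ux; apply: differentiable_continuous; exact: fd.
Qed.

Lemma Ck_cst k (V W : normedModType R) (U : set V) (c : W) : Ck k U (cst c : V -> W).
Proof.
elim: k c => [|k IHk] c /=; first by move=> x _; exact: cst_continuous.
split=> [x _|v]; first exact: differentiable_cst.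
have -> : 'D_v (cst c : V -> W) = cst 0 by apply/funext => x; exact: derive_cst.
exact: IHk.
Qed.

Lemma Ck_sum k (V W : normedModType R) (U : set V) (I : Type) (r : seq I)
    (F : I -> V -> W) :
  open U -> (forall i, Ck k U (F i)) -> Ck k U (fun x => \sum_(i <- r) F i x).
Proof.
move=> oU FC; elim: r => [|i r IHr].
  have -> : (fun x => \sum_(i <- [::]) F i x) = cst 0.
    by apply/funext => x; rewrite big_nil.
  exact: Ck_cst.
have -> : (fun x => \sum_(j <- i :: r) F j x) =
          F i + (fun x => \sum_(j <- r) F j x).
  by apply/funext => x; rewrite big_cons.
exact: CkD.
Qed.

Lemma CkM k (V : normedModType R) (U : set V) (f g : V -> R) :
  open U -> Ck k U f -> Ck k U g -> Ck k U (f * g).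
Proof.
move=> oU; elim: k f g => [|k IHk] f g.
  by move=> fc gc x Ux; apply: continuousM; [exact: fc|exact: gc].
move=> fC gC; have [fd fD] := fC; have [gd gD] := gC.
split=> [x Ux|v].
  by apply: differentiableM; [exact: fd|exact: gd].
apply: (@Ck_eq _ _ _ _ _ (f * 'D_v g + g * 'D_v f)) => // [x Ux|].
  by rewrite deriveM//; apply: diff_derivable; [exact: fd|exact: gd].
have fg' := IHk _ _ (CkW fC) (gD v); have gf' := IHk _ _ (CkW gC) (fD v).
exact: CkD.
Qed.

Lemma Ck_comp_affine k (V V' W : normedModType R) (U : set V')
    (L : {linear V -> V'}) (c : V') (f : V' -> W) :
  continuous L -> Ck k U f ->
  Ck k [set x | U (L x + c)] (fun x => f (L x + c)).
Proof.
move=> cL; have dL x : differentiable (fun x => L x + c) x.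
  have : differentiable ((L : V -> V') + cst c) x.
    by apply: differentiableD; [exact: linear_differentiable|exact: differentiable_cst].
  by [].
elim: k f => [|k IHk] f /=.
  move=> fc x Ux; apply: (@continuous_comp _ _ _ (fun x => L x + c) f).
    exact: differentiable_continuous.
  exact: fc.
move=> [fd fD]; split=> [x Ux|v].
  by apply: (@differentiable_comp _ _ _ _ (fun x => L x + c) f) => //; exact: fd.
have -> : 'D_v (fun x => f (L x + c)) = (fun x => 'D_(L v) f (L x + c)).
  apply/funext => x; apply: (derive_line_eq _).1 => h.
  by rewrite linearD linearZ_LR addrA.
exact: IHk _ (fD (L v)).
Qed.

Section MatrixValued.
Variables (V : normedModType R) (m n : nat).

Fact entry_is_linear i j : linear (fun A : 'M[R]_(m, n) => A i j).
Proof. by move=> a A B; rewrite !mxE. Qed.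

Definition entry i j : {linear 'M[R]_(m, n) -> R} :=
  HB.pack (fun A : 'M[R]_(m, n) => A i j)
    (GRing.isLinear.Build _ _ _ _ _ (entry_is_linear i j)).

Fact scale_delta_is_linear i j : linear (fun a : R => a *: delta_mx i j : 'M[R]_(m, n)).
Proof. by move=> a b c; rewrite scalerDl scalerA. Qed.

Definition scale_delta i j : {linear R -> 'M[R]_(m, n)} :=
  HB.pack (fun a : R => a *: delta_mx i j : 'M[R]_(m, n))
    (GRing.isLinear.Build _ _ _ _ _ (scale_delta_is_linear i j)).

(** Reduces statements on matrix-valued functions to scalar functions. *)
Lemma Ck_mxP k (U : set V) (f : V -> 'M[R]_(m, n)) : open U ->
  Ck k U f <-> forall i j, Ck k U (fun x => f x i j).
Proof.
move=> oU; split=> [fC i j|fC].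
  apply: (@Ck_linear_comp _ _ _ _ _ _ (entry i j)) => //.
  exact: matrix_normedtype.coord_continuous.
have -> : f = fun x => \sum_(ij : 'I_m * 'I_n) f x ij.1 ij.2 *: delta_mx ij.1 ij.2.
  apply/funext => x; rewrite [LHS]matrix_sum_delta pair_bigA.
  by apply: eq_bigr => -[].
apply: Ck_sum => // -[i j].
apply: (@Ck_linear_comp _ _ _ _ _ _ (scale_delta i j) (fun x => f x i j)) => //.
exact: scalel_continuous.
Qed.

End MatrixValued.

Lemma Ck_mulmx k (V : normedModType R) m n p (U : set V) (f : V -> 'M[R]_(m, n))
    (g : V -> 'M[R]_(n, p)) :
  open U -> Ck k U f -> Ck k U g -> Ck k U (fun x => f x *m g x).
Proof.
move=> oU /Ck_mxP fC /Ck_mxP gC; apply/Ck_mxP => // i j.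
have -> : (fun x => (f x *m g x) i j) = (fun x => \sum_l f x i l * g x l j).
  by apply/funext => x; rewrite mxE.
by apply: Ck_sum => // l; apply: CkM => //; [exact: fC|exact: gC].
Qed.

Lemma Ck_trmx k (V : normedModType R) m n (U : set V) (f : V -> 'M[R]_(m, n)) :
  open U -> Ck k U f -> Ck k U (fun x => (f x)^T).
Proof.
move=> oU /Ck_mxP fC; apply/Ck_mxP => // i j.
have -> : (fun x => (f x)^T i j) = (fun x => f x j i).
  by apply/funext => x; rewrite mxE.
exact: fC.
Qed.

Lemma Ck_scale k (V : normedModType R) m n (U : set V) (f : V -> R)
    (g : V -> 'M[R]_(m, n)) :
  open U -> Ck k U f -> Ck k U g -> Ck k U (fun x => f x *: g x).
Proof.
move=> oU fC /Ck_mxP gC; apply/Ck_mxP => // i j.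
have -> : (fun x => (f x *: g x) i j) = f * (fun x => g x i j).
  by apply/funext => x; rewrite mxE.
by apply: CkM => //; exact: gC.
Qed.

(** The local expression of the derivative of one vector field along another. *)
Lemma Ck_directional k n m p (U : set 'rV[R]_n)
    (f : 'rV[R]_n -> 'M[R]_(m, p)) (g : 'rV[R]_n -> 'rV[R]_n) :
  open U -> Ck k.+1 U f -> Ck k U g -> Ck k U (fun x => 'D_(g x) f x).
Proof.
move=> oU [fd fD] /Ck_mxP gC.
apply: (@Ck_eq _ _ _ _ _ (fun x => \sum_i (g x 0 i *: 'D_(delta_mx 0 i) f x))) => // [x Ux|].
  rewrite [RHS]deriveE; last exact: fd.
  rewrite [X in _ = 'd _ _ X]row_sum_delta linear_sum; apply: eq_bigr => i _.
  by rewrite linearZ /= deriveE//; exact: fd.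
apply: Ck_sum => // i; apply: Ck_scale => //; [exact: gC|exact: fD].
Qed.

Lemma is_derive_diff (V W : normedModType R) (f : V -> W) (x v : V) :
  differentiable f x -> is_derive x v f ('D_v f x).
Proof. by move=> fd; apply: derivableP; exact: diff_derivable. Qed.

Lemma is_derive_entry (V : normedModType R) m n (f : V -> 'M[R]_(m, n)) (x v : V) df i j :
  is_derive x v f df -> is_derive x v (fun y => f y i j) (df i j).
Proof.
by move=> [fd <-]; split; [exact: (derivable_mxP _ _ _).1|rewrite derive_mx// mxE].
Qed.

Lemma is_derive_mxP (V : normedModType R) m n (f : V -> 'M[R]_(m, n)) (x v : V)
    (df : 'M[R]_(m, n)) :
  (forall i j, is_derive x v (fun y => f y i j) (df i j)) -> is_derive x v f df.
Proof.
move=> fd; have df_f : derivable f x v.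
  by apply/derivable_mxP => i j; case: (fd i j).
split=> //; rewrite derive_mx//; apply/matrixP => i j; rewrite mxE.
by case: (fd i j).
Qed.

Lemma is_derive_mulmx (V : normedModType R) m n p (f : V -> 'M[R]_(m, n))
    (g : V -> 'M[R]_(n, p)) (x v : V) df dg :
  is_derive x v f df -> is_derive x v g dg ->
  is_derive x v (fun y => f y *m g y) (df *m g x + f x *m dg).
Proof.
move=> fd gd; apply: is_derive_mxP => i j.
have -> : (fun y => (f y *m g y) i j) =
          \sum_l ((fun y => f y i l) * (fun y => g y l j)).
  by apply/funext => y; rewrite fct_sumE mxE.
rewrite !mxE -big_split /=.
have h l : is_derive x v ((fun y => f y i l) * (fun y => g y l j))
    (df i l * g x l j + f x i l * dg l j).
  have := is_deriveM (is_derive_entry i l fd) (is_derive_entry l j gd).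
  by move/is_derive_eq; apply; rewrite addrC [X in X + _]mulrC.
exact: is_derive_sum.
Qed.

Lemma is_derive_mulmxr (V : normedModType R) m n p (f : V -> 'M[R]_(m, n))
    (A : 'M[R]_(n, p)) (x v : V) df :
  is_derive x v f df -> is_derive x v (fun y => f y *m A) (df *m A).
Proof.
move=> fd; have := is_derive_mulmx fd (is_derive_cst A x v).
by move/is_derive_eq; apply; rewrite mulmx0 addr0.
Qed.

Lemma is_derive_mulmxl (V : normedModType R) m n p (f : V -> 'M[R]_(n, p))
    (A : 'M[R]_(m, n)) (x v : V) df :
  is_derive x v f df -> is_derive x v (fun y => A *m f y) (A *m df).
Proof.
move=> fd; have := is_derive_mulmx (is_derive_cst A x v) fd.
by move/is_derive_eq; apply; rewrite mul0mx add0r.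
Qed.

Lemma is_derive_trmx (V : normedModType R) m n (f : V -> 'M[R]_(m, n)) (x v : V) df :
  is_derive x v f df -> is_derive x v (fun y => (f y)^T) df^T.
Proof.
move=> fd; apply: is_derive_mxP => i j; rewrite mxE.
have -> : (fun y => (f y)^T i j) = (fun y => f y j i).
  by apply/funext => y; rewrite mxE.
exact: is_derive_entry.
Qed.

Lemma schwarz_rV (V : normedModType R) n (U : set V) (f : V -> 'rV[R]_n) (x u v : V) :
  open U -> U x -> Ck 2 U f -> 'D_u ('D_v f) x = 'D_v ('D_u f) x.
Proof.
move=> oU Ux fC; have fCj j : Ck 2 U (fun y => f y 0 j) by move/Ck_mxP: fC; apply.
have dd w y : U y -> derivable f y w.
  by move=> Uy; apply: diff_derivable; case: fC => + _; apply.
have ddd w1 w2 : derivable ('D_w1 f) x w2.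
  by apply: diff_derivable; case: fC => _ /(_ w1)[+ _]; apply.
have nU : \near x, U x by apply: open_nbhs_nbhs.
have E w1 w2 j : ('D_w1 ('D_w2 f) x) 0 j = 'D_w1 ('D_w2 (fun y => f y 0 j)) x.
  rewrite derive_mx// mxE; apply: near_eq_derive.
  apply: filterS nU => y Uy; rewrite derive_mx ?mxE//; exact: dd.
apply/rowP => j.
have S := schwarz u v oU Ux (fCj j).
exact: etrans (E u v j) (etrans S (esym (E v u j))).
Qed.

End CkClosure.

Arguments is_derive_diff {R V W f x} v _.

Lemma mulmx_row_ext (K : pzRingType) m n (A B : 'M[K]_(m, n)) :
  (forall v : 'rV[K]_m, v *m A = v *m B) -> A = B.
Proof. by move=> AB; apply/row_matrixP => i; rewrite !rowE. Qed.

(** * Transition matrices *)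

Section Charts.
Variables (R : realType) (n : nat) (M : manifold R n).
Implicit Types (a b c p q : M) (x y : 'rV[R]_n).

Definition transition_map a b := coord (chart_at b) \o param (chart_at a).

Lemma source_param a x : target (chart_at a) x -> source (chart_at a) (param (chart_at a) x).
Proof. by move=> [p ap <-]; rewrite coordK. Qed.

Lemma paramK a x : target (chart_at a) x -> coord (chart_at a) (param (chart_at a) x) = x.
Proof. by move=> [p ap <-]; rewrite coordK. Qed.

Definition overlap a b : set 'rV[R]_n :=
  coord (chart_at a) @` (source (chart_at a) `&` source (chart_at b)).

Lemma open_overlap a b : open (overlap a b).
Proof. exact: open_transition. Qed.
Arguments open_overlap : clear implicits.

Lemma overlapP a b x : overlap a b x ->
  [/\ source (chart_at a) (param (chart_at a) x),
      source (chart_at b) (param (chart_at a) x) & target (chart_at a) x].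
Proof. by move=> [p [ap bp] <-]; rewrite coordK//; split => //; exists p. Qed.

Lemma transition_map_smooth a b k : Ck k (overlap a b) (transition_map a b).
Proof. exact: chart_compatible. Qed.
Arguments transition_map_smooth : clear implicits.

Lemma transition_map_differentiable a b x : overlap a b x ->
  differentiable (transition_map a b) x.
Proof. by have [+ _] := transition_map_smooth a b 1; apply. Qed.

Lemma derive_transition_map a b x v : overlap a b x ->
  'D_v (transition_map a b) x = v *m transition a b (param (chart_at a) x).
Proof.
move=> abx; have [_ _ ax] := overlapP abx.
rewrite /transition paramK//; apply: deriveEjacobian.
exact: transition_map_differentiable.
Qed.

Lemma near_overlap a b x : overlap a b x -> nbhs x (overlap a b).
Proof. by move=> abx; apply: open_nbhs_nbhs; split => //; exact: open_overlap. Qed.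

Lemma transition_id a p : source (chart_at a) p -> transition a a p = 1%:M.
Proof.
move=> ap; have aap : overlap a a (coord (chart_at a) p) by exists p.
apply: mulmx_row_ext => v; rewrite mulmx1.
have E := derive_transition_map v aap; rewrite coordK// in E.
rewrite -E; apply: (etrans _ (@derive_id _ _ (coord (chart_at a) p) v)).
apply: near_eq_derive; apply: filterS (near_overlap aap) => x /overlapP[_ _ ax].
exact: paramK.
Qed.

(** The chain rule. *)
Lemma transition_comp a b c p : source (chart_at a) p -> source (chart_at b) p ->
  source (chart_at c) p -> transition a b p *m transition b c p = transition a c p.
Proof.
move=> ap bp cp; set x := coord (chart_at a) p.
have xp : param (chart_at a) x = p by exact: coordK.
have abx : overlap a b x by exists p.
have acx : overlap a c x by exists p.
have Tx : transition_map a b x = coord (chart_at b) p by rewrite /transition_map /= xp.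
have bcy : overlap b c (transition_map a b x) by rewrite Tx; exists p.
apply: mulmx_row_ext => v; rewrite mulmxA.
have Eab := derive_transition_map v abx; have Eac := derive_transition_map v acx.
have Ebc := derive_transition_map ('D_v (transition_map a b) x) bcy.
have Ep : param (chart_at b) (transition_map a b x) = p by rewrite Tx coordK.
rewrite xp in Eab Eac; rewrite Ep in Ebc.
have Dab := transition_map_differentiable abx.
have Dbc := transition_map_differentiable bcy.
have Dac := transition_map_differentiable acx.
have E : 'D_v (transition_map b c \o transition_map a b) x = 'D_v (transition_map a c) x.
  apply: near_eq_derive; apply: filterS (filterI (near_overlap abx) (near_overlap acx)).
  move=> y [/overlapP[ay by_ _] _].
  by rewrite /transition_map /= coordK.
have Dcomp := differentiable_comp Dab Dbc.
have chain : 'D_v (transition_map b c \o transition_map a b) x =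
    'D_('D_v (transition_map a b) x) (transition_map b c) (transition_map a b x).
  have H1 := deriveE v Dcomp; rewrite (diff_comp Dab Dbc) in H1.
  exact: etrans H1 (etrans (congr1 _ (esym (deriveE v Dab))) (esym (deriveE _ Dbc))).
exact: etrans (congr1 (mulmx^~ _) (esym Eab))
  (etrans (esym Ebc) (etrans (esym chain) (etrans E Eac))).
Qed.

Lemma transition_inv a b p : source (chart_at a) p -> source (chart_at b) p ->
  transition a b p *m transition b a p = 1%:M.
Proof. by move=> ap bp; rewrite transition_comp// transition_id. Qed.

End Charts.

Arguments open_overlap {R n M} a b.
Arguments transition_map_smooth {R n M} a b k.

(** * Smooth tensor fields and the Lie bracket *)

Section CancelFrames.
Variables (K : comPzRingType) (n : nat) (T T' : 'M[K]_n).
Hypothesis TT' : T *m T' = 1%:M.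

Lemma cancel_frame m p (x : 'M[K]_(m, n)) (A : 'M[K]_(n, p)) :
  x *m T *m (T' *m A) = x *m A.
Proof. by rewrite mulmxA -(mulmxA x) TT' mulmx1. Qed.

Lemma cancel_frame_endo m p (x : 'M[K]_(m, n)) (A : 'M[K]_(n, p))
    (B : 'M[K]_(p, n)) :
  x *m T *m (T' *m A *m B) = x *m A *m B :> 'M[K]_(m, n).
Proof. by rewrite mulmxA cancel_frame. Qed.

Lemma cancel_frame_bilinear (x y : 'rV[K]_n) (g : 'M[K]_n) :
  x *m T *m (T' *m g *m T'^T) *m (y *m T)^T = x *m g *m y^T.
Proof.
by rewrite cancel_frame_endo// trmx_mul -mulmxA (mulmxA _^T) -trmx_mul TT' trmx1 mul1mx.
Qed.

End CancelFrames.

Section SmoothTensors.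
Variables (R : realType) (n : nat) (M : manifold R n).
Implicit Types (a b c p q : M) (x y : 'rV[R]_n) (X Y Z : vfield M) (f g : M -> R).

(** The vector field written in the coordinates of the chart at a. *)
Definition local_field X a x : 'rV[R]_n :=
  X (param (chart_at a) x) *m
  transition (param (chart_at a) x) a (param (chart_at a) x).

Lemma transition_at_inv a p : source (chart_at a) p ->
  (transition p a p *m transition a p p = 1%:M) *
  (transition a p p *m transition p a p = 1%:M).
Proof. by move=> ap; split; apply: transition_inv => //; exact: source_chart_at. Qed.

Lemma transition_self p : transition p p p = 1%:M.
Proof. by apply: transition_id; exact: source_chart_at. Qed.

Lemma open_target a : open (target (chart_at a)).
Proof. exact: target_open. Qed.

Arguments open_target : clear implicits.

Lemma smooth_app (A : M -> 'M[R]_n) X :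
  smooth_endo A -> smooth_vfield X -> smooth_vfield (app A X).
Proof.
move=> sA sX a k; have C := Ck_mulmx (open_target a) (sX a k) (sA a k).
apply: (Ck_eq (open_target a) _ C) => x ax.
have [TT _] := transition_at_inv (source_param ax).
exact: cancel_frame_endo.
Qed.

Lemma smooth_ip (g : M -> 'M[R]_n) X Y :
  smooth_bilinear g -> smooth_vfield X -> smooth_vfield Y -> smooth_fun (ip g X Y).
Proof.
move=> sg sX sY a k.
have sYT := Ck_trmx (open_target a) (sY a k).
have /(Ck_mxP _ _ (open_target a))/(_ 0 0) :=
  Ck_mulmx (open_target a) (Ck_mulmx (open_target a) (sX a k) (sg a k)) sYT.
apply: (Ck_eq (open_target a)) => x ax; have [TT _] := transition_at_inv (source_param ax).
exact: (congr1 (fun A : 'M[R]_1 => A 0 0) (cancel_frame_bilinear TT _ _ _)).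
Qed.

Lemma smooth_vfieldD X Y : smooth_vfield X -> smooth_vfield Y ->
  smooth_vfield (fun p => X p + Y p).
Proof.
move=> sX sY a k; have C := CkD (open_target a) (sX a k) (sY a k).
apply: (Ck_eq (open_target a) _ C) => x ax.
by rewrite /= mulmxDl.
Qed.

Lemma smooth_vfieldZ f X : smooth_fun f -> smooth_vfield X ->
  smooth_vfield (fun p => f p *: X p).
Proof.
move=> sf sX a k; have C := Ck_scale (open_target a) (sf a k) (sX a k).
apply: (Ck_eq (open_target a) _ C) => x ax.
by rewrite /= scalemxAl.
Qed.

Lemma smooth_funD f g : smooth_fun f -> smooth_fun g -> smooth_fun (f + g).
Proof. by move=> sf sg a k; exact: CkD (open_target a) (sf a k) (sg a k). Qed.

Lemma smooth_funM f g : smooth_fun f -> smooth_fun g -> smooth_fun (f * g).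
Proof. by move=> sf sg a k; exact: CkM (open_target a) (sf a k) (sg a k). Qed.

Lemma smooth_cst (r : R) : smooth_fun (cst r : M -> R).
Proof. by move=> a k; exact: Ck_cst. Qed.

Lemma smooth_funN f : smooth_fun f -> smooth_fun (- f).
Proof.
move=> sf; have -> : - f = cst (-1) * f by apply/funext => p /=; rewrite !fctE mulN1r.
by apply: smooth_funM => //; exact: smooth_cst.
Qed.

Lemma smooth_funB f g : smooth_fun f -> smooth_fun g -> smooth_fun (f - g).
Proof. by move=> sf sg; apply: smooth_funD sf (smooth_funN sg). Qed.

(** A vector field transforms by the Jacobian of the coordinate change. *)
Lemma local_field_change X q a y : overlap q a y ->
  local_field X a (transition_map q a y) =
  local_field X q y *m jacobian (transition_map q a) y.
Proof.
move=> qay; have [sq sa ty] := overlapP qay.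
have E : param (chart_at a) (transition_map q a y) = param (chart_at q) y.
  exact: coordK.
have J : jacobian (transition_map q a) y = transition q a (param (chart_at q) y).
  by rewrite /transition paramK.
have TC := transition_comp (source_chart_at (param (chart_at q) y)) sq sa.
by rewrite /local_field E J -mulmxA TC.
Qed.

Lemma Ck_jacobian k (U : set 'rV[R]_n) (psi : 'rV[R]_n -> 'rV[R]_n) :
  open U -> Ck k.+1 U psi -> Ck k U (jacobian psi).
Proof.
move=> oU [dpsi Dpsi]; apply/Ck_mxP => // i j.
have /(Ck_mxP _ _ oU)/(_ 0 j) := Dpsi (delta_mx 0 i).
apply: (Ck_eq oU) => x Ux.
by rewrite deriveEjacobian; [rewrite -rowE mxE|exact: dpsi].
Qed.

Lemma smooth_local_differentiable X a x : smooth_vfield X ->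
  target (chart_at a) x -> differentiable (local_field X a) x.
Proof. by move=> sX; have [+ _] := sX a 1; apply. Qed.

(** Differentiating the transformation rule of Y produces, besides the
    transformed derivative, a second derivative of the coordinate change. *)
Lemma derive_change X Y q a (y0 := coord (chart_at q) q) :
  smooth_vfield X -> smooth_vfield Y -> source (chart_at a) q ->
  'D_(local_field X a (coord (chart_at a) q)) (local_field Y a) (coord (chart_at a) q) =
  'D_(X q) (local_field Y q) y0 *m transition q a q +
  'D_(X q) ('D_(Y q) (transition_map q a)) y0.
Proof.
move=> sX sY aq; have qq : source (chart_at q) q := source_chart_at q.
set psi := transition_map q a; set x := coord _ q.
have ov : overlap q a y0 by exists q.
have qE : param (chart_at q) y0 = q by exact: coordK.
have psiE : psi y0 = x by rewrite /psi /transition_map /= qE.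
have XE Z : local_field Z q y0 = Z q by rewrite /local_field qE transition_self mulmx1.
have jE : jacobian psi y0 = transition q a q by [].
have uE : local_field X a x = 'D_(X q) psi y0.
  have := derive_transition_map (X q) ov; rewrite qE => ->.
  by rewrite -psiE local_field_change// XE.
have Dpsi := transition_map_differentiable ov.
have Dpsi_v w : differentiable ('D_w psi) y0.
  by have [_ /(_ w)[+ _]] := transition_map_smooth q a 2; apply.
have DY : differentiable (local_field Y a) (psi y0).
  by apply: smooth_local_differentiable => //; rewrite psiE; exists q.
have DYq : differentiable (local_field Y q) y0.
  by apply: smooth_local_differentiable => //; exists q.
have Dj : differentiable (jacobian psi) y0.
  by have [+ _] := Ck_jacobian (open_overlap q a) (transition_map_smooth q a 2); apply.
have chain : 'D_(X q) (local_field Y a \o psi) y0 =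
    'D_('D_(X q) psi y0) (local_field Y a) (psi y0).
  have H1 := deriveE (X q) (differentiable_comp Dpsi DY).
  rewrite (diff_comp Dpsi DY) in H1.
  exact: etrans H1 (etrans (congr1 _ (esym (deriveE _ Dpsi))) (esym (deriveE _ DY))).
have E : 'D_(X q) (local_field Y a \o psi) y0 =
    'D_(X q) (fun y => local_field Y q y *m jacobian psi y) y0.
  apply: near_eq_derive; apply: filterS (near_overlap ov) => y ovy.
  exact: local_field_change.
have leib := is_derive_mulmx (is_derive_diff (X q) DYq)
                             (is_derive_diff (X q) Dj).
have leib' := @derive_val _ _ _ _ _ _ _ leib.
have E2 : 'D_(X q) ('D_(Y q) psi) y0 = Y q *m 'D_(X q) (jacobian psi) y0.
  have L := is_derive_mulmxl (Y q) (is_derive_diff (X q) Dj).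
  apply: etrans (@derive_val _ _ _ _ _ _ _ L).
  apply: near_eq_derive; apply: filterS (near_overlap ov) => y ovy.
  by apply: deriveEjacobian; exact: transition_map_differentiable.
rewrite XE jE -E2 in leib'.
rewrite uE -psiE; exact: etrans (esym chain) (etrans E leib').
Qed.

Lemma bracket_of_changes (T : 'M[R]_n) (u v A B s t : 'rV[R]_n) :
  u = A *m T + s -> v = B *m T + t -> s = t -> (A - B) *m T = u - v.
Proof. by move=> -> -> ->; rewrite mulmxBl opprD addrACA subrr addr0. Qed.

(** The second derivatives in [derive_change] are symmetric in X and Y, so they
    cancel in the bracket, which is therefore the same in all charts. *)
Lemma lie_local X Y q a : smooth_vfield X -> smooth_vfield Y -> source (chart_at a) q ->
  lie X Y q *m transition q a q =
  'D_(local_field X a (coord (chart_at a) q)) (local_field Y a) (coord (chart_at a) q) -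
  'D_(local_field Y a (coord (chart_at a) q)) (local_field X a) (coord (chart_at a) q).
Proof.
move=> sX sY aq.
have qq : source (chart_at q) q := source_chart_at q.
have ov : overlap q a (coord (chart_at q) q) by exists q.
have S := schwarz_rV (X q) (Y q) (open_overlap q a) ov (transition_map_smooth q a 2).
have B := bracket_of_changes (derive_change sX sY aq) (derive_change sY sX aq) S.
exact: B.
Qed.

Lemma smooth_lie X Y : smooth_vfield X -> smooth_vfield Y -> smooth_vfield (lie X Y).
Proof.
move=> sX sY a k.
have c1 := Ck_directional (open_target a) (sY a k.+1) (sX a k).
have c2 := Ck_directional (open_target a) (sX a k.+1) (sY a k).
have c3 := CkD (open_target a) c1 (Ck_scale (open_target a) (Ck_cst k _ (-1 : R)) c2).
apply: (Ck_eq (open_target a) _ c3) => x ax.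
have := lie_local sX sY (source_param ax); rewrite (paramK ax) => E.
exact: etrans (congr1 (+%R _) (scaleN1r _)) (esym E).
Qed.

End SmoothTensors.

Section DeriveNearLine.
Variable R : realType.

Lemma derive_near_line (V V' W : normedModType R) (f : V -> W) (g : V' -> W)
    (x v : V) (y w : V') :
  (\forall h \near (0 : R), f (h *: v + x) = g (h *: w + y)) ->
  'D_v f x = 'D_w g y.
Proof.
move=> fg; have fgx : f x = g y.
  by have := nbhs_singleton fg; rewrite !scale0r !add0r.
have E : 'D_v f x = 'D_1 (fun h : R => f (h *: v + x)) 0.
  by apply: (derive_line_eq _).1 => h; rewrite addr0 [h *: 1]mulr1.
have E' : 'D_w g y = 'D_1 (fun h : R => g (h *: w + y)) 0.
  by apply: (derive_line_eq _).1 => h; rewrite addr0 [h *: 1]mulr1.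
exact: etrans E (etrans (near_eq_derive _ fg) (esym E')).
Qed.

Lemma near_line (V : normedModType R) (U : set V) (x v : V) :
  open U -> U x -> \forall h \near (0 : R), U (h *: v + x).
Proof.
move=> oU Ux; have nU : nbhs (0 *: v + x) U.
  by rewrite scale0r add0r; apply: open_nbhs_nbhs.
have c : {for (0 : R), continuous (fun h : R => h *: v + x)}.
  apply: differentiable_continuous.
  have : differentiable ((fun h : R => h *: v) + cst x) (0 : R).
    by apply: differentiableD => //; exact: differentiable_cst.
  by [].
exact: c _ nU.
Qed.

End DeriveNearLine.

Section DerRules.
Variables (R : realType) (n : nat) (M : manifold R n).
Implicit Types (X Y : vfield M) (f g : M -> R) (p : M).

Lemma target_self p : target (chart_at p) (coord (chart_at p) p).
Proof. by exists p => //; exact: source_chart_at. Qed.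

Lemma param_self p : param (chart_at p) (coord (chart_at p) p) = p.
Proof. by apply: coordK; exact: source_chart_at. Qed.

Lemma smooth_fun_differentiable f p : smooth_fun f ->
  differentiable (f \o param (chart_at p)) (coord (chart_at p) p).
Proof. by move=> sf; have [+ _] := sf p 1; apply; exact: target_self. Qed.

Lemma is_der X f p : smooth_fun f ->
  is_derive (coord (chart_at p) p) (X p) (f \o param (chart_at p)) (der X f p).
Proof. by move=> sf; apply: is_derive_diff; exact: smooth_fun_differentiable. Qed.

Lemma derD X f g p : smooth_fun f -> smooth_fun g ->
  der X (f + g) p = der X f p + der X g p.
Proof.
move=> sf sg; have H := is_deriveD (is_der X p sf) (is_der X p sg).
exact: (@derive_val _ _ _ _ _ _ _ H).
Qed.

Lemma derM X f g p : smooth_fun f -> smooth_fun g ->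
  der X (f * g) p = f p * der X g p + g p * der X f p.
Proof.
move=> sf sg; have H := is_deriveM (is_der X p sf) (is_der X p sg).
have := @derive_val _ _ _ _ _ _ _ H.
by rewrite /= param_self.
Qed.

Lemma der_cst X (r : R) p : der X (cst r) p = 0.
Proof. exact: derive_cst. Qed.

Lemma derN X f p : smooth_fun f -> der X (- f) p = - der X f p.
Proof.
move=> sf; have H := is_deriveN (is_der X p sf).
exact: (@derive_val _ _ _ _ _ _ _ H).
Qed.

Lemma derB X f g p : smooth_fun f -> smooth_fun g ->
  der X (f - g) p = der X f p - der X g p.
Proof. by move=> sf sg; rewrite derD ?derN//; exact: smooth_funN. Qed.

End DerRules.

(** * Factors of a product manifold *)

(** A projection [pr] of M onto N that is linear in the charts of M, with the
    slices transversal to its fibers: [slice p q] is the point over q of the slice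
    through p. In the charts, which are fixed once and for all, [proj] is the
    differential of [pr] and [inc] that of the slices, and the slice through p is
    the affine subspace with offset [slice_offset p]. This record is instantiated
    by both factors of a product, which are then treated once. *)
Record factor (R : realType) (m n : nat) (N : manifold R m) (M : manifold R n) :=
  Factor {
  pr : M -> N;
  slice : M -> N -> M;
  inc : 'M[R]_(m, n);
  proj : 'M[R]_(n, m);
  inc_proj : inc *m proj = 1%:M;
  slice_pr : forall p : M, slice p (pr p) = p;
  pr_slice : forall (p : M) (q : N), pr (slice p q) = q;
  source_pr : forall a p : M, source (chart_at a) p -> source (chart_at (pr a)) (pr p);
  coord_pr : forall a p : M, coord (chart_at (pr a)) (pr p) = coord (chart_at a) p *m proj;
  pr_param : forall (a : M) x, pr (param (chart_at a) x) = param (chart_at (pr a)) (x *m proj);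
  slice_offset : M -> 'rV[R]_n;
  slice_offsetE : forall p,
    slice_offset p = coord (chart_at p) p *m (1%:M - proj *m inc);
  target_slice : forall (p : M) (a : N) y, target (chart_at a) y ->
    target (chart_at (slice p a)) (y *m inc + slice_offset p);
  slice_param : forall (p : M) (a : N) y, slice p (param (chart_at a) y) =
    param (chart_at (slice p a)) (y *m inc + slice_offset p);
  transition_pr : forall a b p : M, source (chart_at a) p -> source (chart_at b) p ->
    transition a b p *m proj = proj *m transition (pr a) (pr b) (pr p);
  transition_inc : forall a b p : M, source (chart_at a) p -> source (chart_at b) p ->
    inc *m transition a b p = transition (pr a) (pr b) (pr p) *m inc }.

Lemma continuous_mulmxr (R : realType) k l (A : 'M[R]_(k, l)) :
  continuous (mulmxr A : 'rV[R]_k -> 'rV[R]_l).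
Proof.
have idC : Ck 0 setT (idfun : 'rV[R]_k -> 'rV[R]_k) by move=> x _; exact: cvg_id.
move=> x; exact: (Ck_mulmx openT idC (Ck_cst 0 setT A) x I).
Qed.

Arguments open_target {R n M} a.

Section Factor.
Variables (R : realType) (m n : nat) (N : manifold R m) (M : manifold R n).
Variable F : factor N M.
Implicit Types (X Y Z : vfield M) (f : M -> R) (p q : M) (a : N).

Let P := proj F.
Let E := inc F.

(** The tangent component of X along the slice through p, as a vector field on N. *)
Definition on_slice X p : vfield N := fun q : N => X (slice F p q) *m P.

Definition pull_endo (A : N -> 'M[R]_m) q : 'M[R]_n := P *m A (pr F q) *m E.
Definition pull_vfield (X : vfield N) : vfield M := fun q => X (pr F q) *m E.
Definition pull_1form (eta : N -> 'cV[R]_m) q : 'cV[R]_n := P *m eta (pr F q).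
Definition pull_bilinear (g : N -> 'M[R]_m) q : 'M[R]_n := P *m g (pr F q) *m P^T.

Lemma target_pr (a : M) x : target (chart_at a) x -> target (chart_at (pr F a)) (x *m P).
Proof.
by move=> [p ap <-]; exists (pr F p); [exact: source_pr|exact: coord_pr].
Qed.

Lemma Ck_pull k (W : normedModType R) (p : M) (f : 'rV[R]_m -> W) :
  Ck k (target (chart_at (pr F p))) f ->
  Ck k (target (chart_at p)) (fun x => f (x *m P)).
Proof.
move=> fC; have C := Ck_comp_linear (@continuous_mulmxr _ _ _ P) fC.
by apply: Ck_sub C => x; exact: target_pr.
Qed.

Lemma Ck_on_slice k (W : normedModType R) p a (f : 'rV[R]_n -> W) :
  Ck k (target (chart_at (slice F p a))) f ->
  Ck k (target (chart_at a)) (fun y => f (y *m E + slice_offset F p)).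
Proof.
move=> fC; have C := Ck_comp_affine (slice_offset F p) (@continuous_mulmxr _ _ _ E) fC.
by apply: Ck_sub C => y; exact: target_slice.
Qed.

Lemma local_field_on_slice X p a y : target (chart_at a) y ->
  local_field (on_slice X p) a y =
  local_field X (slice F p a) (y *m E + slice_offset F p) *m P.
Proof.
move=> ay; rewrite /local_field /on_slice -slice_param.
set q := param (chart_at a) y; set s := slice F p q.
have ss : source (chart_at (slice F p a)) s.
  by rewrite /s slice_param; apply: source_param; exact: target_slice.
have T := transition_pr F (source_chart_at s) ss.
by rewrite /s !pr_slice -/s in T; rewrite -mulmxA -T mulmxA.
Qed.

Lemma smooth_on_slice X p : smooth_vfield X -> smooth_vfield (on_slice X p).
Proof.
move=> sX a k.
have C := Ck_on_slice (Ck_mulmx (open_target _) (sX (slice F p a) k) (Ck_cst k _ P)).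
apply: (Ck_eq (open_target a) _ C) => y ay; exact/esym/local_field_on_slice.
Qed.

Lemma smooth_fun_on_slice f p : smooth_fun f -> smooth_fun (f \o slice F p).
Proof.
move=> sf a k; apply: (Ck_eq (open_target a) _ (Ck_on_slice (sf (slice F p a) k))) => y ay.
exact: (congr1 f (esym (slice_param F p a y))).
Qed.

Section PullSmooth.
Variable a : M.
Variable x : 'rV[R]_n.
Hypothesis ax : target (chart_at a) x.
Let q := param (chart_at a) x.
Let y := x *m P.

Lemma transition_pull :
  let r := param (chart_at (pr F a)) y in
  (transition a q q *m P = P *m transition (pr F a) r r) *
  (E *m transition q a q = transition r (pr F a) r *m E).
Proof.
have aq := source_param ax; have qq := source_chart_at q.
by rewrite /= -pr_param; split; [exact: transition_pr|exact: transition_inc].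
Qed.

End PullSmooth.

Lemma smooth_pull_vfield (X : vfield N) : smooth_vfield X -> smooth_vfield (pull_vfield X).
Proof.
move=> sX a k.
have C := Ck_mulmx (open_target a) (Ck_pull (sX (pr F a) k)) (Ck_cst k _ E).
apply: (Ck_eq (open_target a) _ C) => x ax.
have [_ TE] := transition_pull ax.
by rewrite /= /pull_vfield -(mulmxA _ E) TE pr_param mulmxA.
Qed.

Lemma smooth_pull_1form (eta : N -> 'cV[R]_m) :
  smooth_1form eta -> smooth_1form (pull_1form eta).
Proof.
move=> sX a k.
have C := Ck_mulmx (open_target a) (Ck_cst k _ P) (Ck_pull (sX (pr F a) k)).
apply: (Ck_eq (open_target a) _ C) => x ax.
have [TP _] := transition_pull ax.
by rewrite /= /pull_1form [RHS]mulmxA TP pr_param -mulmxA.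
Qed.

Lemma smooth_pull_endo (A : N -> 'M[R]_m) : smooth_endo A -> smooth_endo (pull_endo A).
Proof.
move=> sX a k.
have C := Ck_mulmx (open_target a) (Ck_mulmx (open_target a) (Ck_cst k _ P)
  (Ck_pull (sX (pr F a) k))) (Ck_cst k _ E).
apply: (Ck_eq (open_target a) _ C) => x ax.
have [TP TE] := transition_pull ax.
by rewrite /= /pull_endo -!mulmxA TE !mulmxA TP pr_param.
Qed.

Lemma smooth_pull_bilinear (g : N -> 'M[R]_m) :
  smooth_bilinear g -> smooth_bilinear (pull_bilinear g).
Proof.
move=> sX a k.
have C := Ck_mulmx (open_target a) (Ck_mulmx (open_target a) (Ck_cst k _ P)
  (Ck_pull (sX (pr F a) k))) (Ck_cst k _ P^T).
apply: (Ck_eq (open_target a) _ C) => x ax.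
have [TP TE] := transition_pull ax.
by rewrite /= /pull_bilinear -!mulmxA -!trmx_mul TP !trmx_mul !mulmxA TP pr_param.
Qed.

End Factor.

(** * The pullback connection along a factor projection *)

Section PullbackConnection.
Variables (R : realType) (m n : nat) (N : manifold R m) (M : manifold R n).
Variable F : factor N M.
Implicit Types (X Y Z : vfield M) (f : M -> R) (p : M).

Let P := proj F.
Let E := inc F.
Let Q : 'M[R]_n := 1%:M - P *m E.

Lemma vertical_proj : Q *m P = 0.
Proof. by rewrite /Q mulmxBl mul1mx -mulmxA inc_proj mulmx1 subrr. Qed.

(** Derivative, in the direction of the part of X tangent to the fiber of [pr],
    of the N-component of Y; on the fiber that component lives in one fixed tangent
    space of N. *)
Definition vert X Y p : 'rV[R]_m :=
  'D_(X p *m Q) (local_field Y p) (coord (chart_at p) p) *m P.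

Definition vert_fun X f p : R :=
  'D_(X p *m Q) (f \o param (chart_at p)) (coord (chart_at p) p).

(** The connection induced by D on the pullback of T N along [pr], applied to
    the N-component of Y. *)
Definition conn (D : vfield N -> vfield N -> vfield N) X Y p : 'rV[R]_m :=
  D (on_slice F X p) (on_slice F Y p) (pr F p) + vert X Y p.

(** Splits a direction into its slice part and its fiber part. *)
Lemma derive_split (W : normedModType R) (G : 'rV[R]_n -> W) (u : 'rV[R]_n) p :
  differentiable G (coord (chart_at p) p) ->
  'D_u G (coord (chart_at p) p) =
  'D_(u *m P) (fun y => G (y *m E + slice_offset F p))
     (coord (chart_at (pr F p)) (pr F p)) +
  'D_(u *m Q) G (coord (chart_at p) p).
Proof.
move=> dG; set x := coord _ p.
(* The line in N lifts to the line through x in the slice. *)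
have S : 'D_(u *m P) (fun y => G (y *m E + slice_offset F p))
     (coord (chart_at (pr F p)) (pr F p)) = 'D_(u *m P *m E) G x.
  apply: (derive_line_eq _).1 => h; congr G.
  rewrite coord_pr slice_offsetE -/x mulmxDl -scalemxAl -addrA; congr (_ + _).
  by rewrite mulmxBr mulmx1 mulmxA addrC subrK.
have U : u = u *m P *m E + u *m Q by rewrite /Q mulmxBr mulmx1 mulmxA addrC subrK.
have L : 'd G x u = 'd G x (u *m P *m E) + 'd G x (u *m Q).
  by rewrite [in LHS]U linearD.
exact: etrans (deriveE u dG) (etrans L (congr2 +%R
  (etrans (esym (deriveE _ dG)) (esym S)) (esym (deriveE _ dG)))).
Qed.

Lemma der_split X f p : smooth_fun f ->
  der X f p = der (on_slice F X p) (f \o slice F p) (pr F p) + vert_fun X f p.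
Proof.
move=> sf; have H := derive_split (X p) (smooth_fun_differentiable p sf).
apply: etrans H _; congr (_ + _).
rewrite /der /on_slice slice_pr; congr ('D_(_) _ _).
by apply/funext => y /=; rewrite slice_param slice_pr.
Qed.

(** Along a fiber the projection to N is constant, hence so are the frame of
    T N and the tensors pulled back from N. *)
Lemma vertical_line (v : 'rV[R]_n) p (x := coord (chart_at p) p) :
  \forall h \near (0 : R), let y := h *: (v *m Q) + x in
  [/\ target (chart_at p) y, pr F (param (chart_at p) y) = pr F p &
      forall Y, local_field Y p y *m P = Y (param (chart_at p) y) *m P].
Proof.
have N0 := near_line (v *m Q) (open_target p) (target_self p).
apply: filterS N0 => h ty.
have prE : pr F (param (chart_at p) (h *: (v *m Q) + x)) = pr F p.
  rewrite pr_param mulmxDl -scalemxAl -mulmxA vertical_proj mulmx0 scaler0 add0r.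
  by rewrite -coord_pr param_self.
split=> // Y; rewrite /local_field -mulmxA.
set q := param _ _ in prE *.
rewrite (transition_pr F (source_chart_at q) (source_param ty)) prE.
by rewrite transition_self mulmx1.
Qed.

Lemma is_derive_vert X Y p : smooth_vfield Y ->
  is_derive (coord (chart_at p) p) (X p *m Q) (fun y => local_field Y p y *m P)
    (vert X Y p).
Proof.
move=> sY; apply: is_derive_mulmxr; apply: is_derive_diff.
exact: smooth_local_differentiable sY (target_self p).
Qed.

Lemma local_field_self Y p : local_field Y p (coord (chart_at p) p) = Y p.
Proof. by rewrite /local_field param_self transition_self mulmx1. Qed.

Lemma on_slice_self Y p : on_slice F Y p (pr F p) = Y p *m P.
Proof. by rewrite /on_slice slice_pr. Qed.

Lemma vert_eq X Y p (x := coord (chart_at p) p) (v := X p *m Q)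
    (G : 'rV[R]_n -> 'rV[R]_m) dG :
  smooth_vfield Y -> is_derive x v G dG ->
  (\forall h \near (0 : R), local_field Y p (h *: v + x) *m P = G (h *: v + x)) ->
  vert X Y p = dG.
Proof.
move=> sY dG_ YG; have H := is_derive_vert X p sY.
have L := @derive_near_line _ _ _ _ (fun y => local_field Y p y *m P) G x v x v YG.
exact: etrans (esym (@derive_val _ _ _ _ _ _ _ H))
  (etrans L (@derive_val _ _ _ _ _ _ _ dG_)).
Qed.

Lemma vertD X Y Z p : smooth_vfield Y -> smooth_vfield Z ->
  vert X (fun q => Y q + Z q) p = vert X Y p + vert X Z p.
Proof.
move=> sY sZ; have H := is_deriveD (is_derive_vert X p sY) (is_derive_vert X p sZ).
apply: (vert_eq (smooth_vfieldD sY sZ) H).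
apply: filterS (vertical_line (X p) p) => h [_ _ LE].
by rewrite fctE !LE mulmxDl.
Qed.

Lemma vert_proj_ext X Y Y' p : smooth_vfield Y -> smooth_vfield Y' ->
  (forall q, Y q *m P = Y' q *m P) -> vert X Y p = vert X Y' p.
Proof.
move=> sY sY' YY'; apply: (vert_eq sY (is_derive_vert X p sY')).
by apply: filterS (vertical_line (X p) p) => h [_ _ LE]; rewrite !LE YY'.
Qed.

Lemma vertZ X f Y p : smooth_fun f -> smooth_vfield Y ->
  vert X (fun q => f q *: Y q) p = vert_fun X f p *: (Y p *m P) + f p *: vert X Y p.
Proof.
move=> sf sY.
have df : is_derive (coord (chart_at p) p) (X p *m Q) (f \o param (chart_at p))
    (vert_fun X f p).
  by apply: is_derive_diff; exact: smooth_fun_differentiable.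
pose S (r : R) : 'M[R]_1 := r%:M.
have dS : is_derive (coord (chart_at p) p) (X p *m Q)
    (fun y => S (f (param (chart_at p) y))) (S (vert_fun X f p)).
  apply: is_derive_mxP => i j; rewrite !ord1 mxE eqxx mulr1n.
  by have -> : (fun y => S (f (param (chart_at p) y)) 0 0) = f \o param (chart_at p);
    [apply/funext => y; rewrite mxE eqxx mulr1n|].
have H := is_derive_mulmx dS (is_derive_vert X p sY).
have := vert_eq (smooth_vfieldZ sf sY) H; rewrite param_self local_field_self !mul_scalar_mx.
apply; apply: filterS (vertical_line (X p) p) => h [_ _ LE].
by rewrite !LE -scalemxAl; exact: esym (mul_scalar_mx _ _).
Qed.

Lemma vert_endo X Y (A : N -> 'M[R]_m) p : smooth_endo A -> smooth_vfield Y ->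
  vert X (app (pull_endo F A) Y) p = vert X Y p *m A (pr F p).
Proof.
move=> sA sY; have H := is_derive_mulmxr (A (pr F p)) (is_derive_vert X p sY).
apply: (vert_eq (smooth_app (smooth_pull_endo F sA) sY) H).
apply: filterS (vertical_line (X p) p) => h [_ prE LE].
by rewrite !LE /app /pull_endo prE -!mulmxA inc_proj mulmx1.
Qed.

Lemma vert_vfield X (V : vfield N) p : smooth_vfield V -> vert X (pull_vfield F V) p = 0.
Proof.
move=> sV.
have H := is_derive_cst (V (pr F p)) (coord (chart_at p) p) (X p *m Q).
apply: (vert_eq (smooth_pull_vfield F sV) H).
apply: filterS (vertical_line (X p) p) => h [_ prE LE].
by rewrite !LE /pull_vfield prE -!mulmxA inc_proj mulmx1.
Qed.

Lemma vert_ip X (g : N -> 'M[R]_m) Y Z p :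
  smooth_bilinear g -> smooth_vfield Y -> smooth_vfield Z ->
  vert_fun X (ip (pull_bilinear F g) Y Z) p =
  (vert X Y p *m g (pr F p) *m (Z p *m P)^T) 0 0 +
  (Y p *m P *m g (pr F p) *m (vert X Z p)^T) 0 0.
Proof.
move=> sg sY sZ.
have H := is_derive_entry 0 0 (is_derive_mulmx
  (is_derive_mulmxr (g (pr F p)) (is_derive_vert X p sY))
  (is_derive_trmx (is_derive_vert X p sZ))).
have := @derive_val _ _ _ _ _ _ _ H.
rewrite !local_field_self mxE => <-; apply: derive_near_line.
apply: filterS (vertical_line (X p) p) => h [_ prE LE].
by rewrite !LE /= /ip /pull_bilinear prE trmx_mul !mulmxA.
Qed.

(** Only the N-component of the differentiated field matters. *)
Lemma conn_proj_ext D X Y Y' p : smooth_vfield Y -> smooth_vfield Y' ->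
  (forall q, Y q *m P = Y' q *m P) -> conn D X Y p = conn D X Y' p.
Proof.
move=> sY sY' YY'; rewrite /conn (vert_proj_ext X p sY sY' YY'); congr (D _ _ _ + _).
by apply/funext => q; exact: YY'.
Qed.

Section Laws.
Variables (g : N -> 'M[R]_m) (D : vfield N -> vfield N -> vfield N).
Hypothesis lc : levi_civita g D.
Hypothesis sg : smooth_bilinear g.
Variables X Y Z : vfield M.
Hypotheses (sX : smooth_vfield X) (sY : smooth_vfield Y) (sZ : smooth_vfield Z).

Lemma connD p : conn D X (fun q => Y q + Z q) p = conn D X Y p + conn D X Z p.
Proof.
rewrite /conn vertD// addrACA; congr (_ + _).
have -> : on_slice F (fun q => Y q + Z q) p =
          (fun q => on_slice F Y p q + on_slice F Z p q).
  by apply/funext => q; rewrite /on_slice mulmxDl.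
by rewrite (lc_addr lc)//; exact: smooth_on_slice.
Qed.

Lemma connZ f p : smooth_fun f ->
  conn D X (fun q => f q *: Y q) p = der X f p *: (Y p *m P) + f p *: conn D X Y p.
Proof.
move=> sf; rewrite /conn vertZ// (der_split X p sf) scalerDl scalerDr addrACA.
congr (_ + _).
have -> : on_slice F (fun q => f q *: Y q) p =
          (fun q => (f \o slice F p) q *: on_slice F Y p q).
  by apply/funext => q; rewrite /on_slice scalemxAl.
rewrite (lc_leibniz lc); [|exact: smooth_fun_on_slice|exact: smooth_on_slice..].
by rewrite on_slice_self /= slice_pr.
Qed.

(** On the slice this is the torsion-freeness of D; the fiber derivatives of
    the two fields make up the rest of the bracket. *)
Lemma conn_torsion_free p : lie X Y p *m P = conn D X Y p - conn D Y X p.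
Proof.
have S U V : smooth_vfield U -> smooth_vfield V ->
    der U (fun q => V q *m transition q p q) p *m P =
    der (on_slice F U p) (fun q => on_slice F V p q *m transition q (pr F p) q) (pr F p) +
    vert U V p.
  move=> sU sV.
  have dV := smooth_local_differentiable sV (target_self p).
  have H := derive_split (U p) dV.
  rewrite /vert /der -/(local_field V p); rewrite -/(local_field V p) in H.
  rewrite H mulmxDl; congr (_ + _).
  have dVs : differentiable (fun y => local_field V p (y *m E + slice_offset F p))
      (coord (chart_at (pr F p)) (pr F p)).
    have := Ck_on_slice (F := F) (p := p) (a := pr F p) (k := 1) (f := local_field V p).
    rewrite slice_pr => /(_ (sV p 1))[+ _]; apply; exact: target_self.
  have H2 := is_derive_mulmxr P (is_derive_diff (U p *m P) dVs).
  rewrite -(@derive_val _ _ _ _ _ _ _ H2) on_slice_self.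
  apply: near_eq_derive.
  have nT : nbhs (coord (chart_at (pr F p)) (pr F p)) (target (chart_at (pr F p))).
    by apply: open_nbhs_nbhs; split; [exact: open_target|exact: target_self].
  apply: filterS nT => y ty.
  by apply/esym; have := local_field_on_slice F V p ty; rewrite slice_pr.
have T := lc_torsion_free lc (smooth_on_slice F p sX) (smooth_on_slice F p sY) (pr F p).
rewrite /conn opprD addrACA T /lie mulmxBl.
by rewrite (S _ _ sX sY) (S _ _ sY sX) opprD addrACA.
Qed.

Lemma conn_metric p :
  der X (ip (pull_bilinear F g) Y Z) p =
  (conn D X Y p *m g (pr F p) *m (Z p *m P)^T) 0 0 +
  (Y p *m P *m g (pr F p) *m (conn D X Z p)^T) 0 0.
Proof.
have sgYZ := smooth_ip (smooth_pull_bilinear F sg) sY sZ.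
rewrite (der_split X p sgYZ) vert_ip//.
have -> : ip (pull_bilinear F g) Y Z \o slice F p = ip g (on_slice F Y p) (on_slice F Z p).
  by apply/funext => q; rewrite /ip /= /pull_bilinear /on_slice pr_slice trmx_mul !mulmxA.
rewrite (lc_metric lc); [|exact: smooth_on_slice..].
rewrite /ip !on_slice_self addrACA /conn.
by rewrite linearD !mulmxDl mulmxDr !mxE.
Qed.

(** Pulled back endomorphisms are constant along the fibers, so their covariant
    derivative is the one on N, stated through its value T. *)
Lemma conn_endo (A : N -> 'M[R]_m) (T : vfield N -> vfield N -> vfield N) p :
  smooth_endo A ->
  (forall U V, smooth_vfield U -> smooth_vfield V -> forall q,
     D U (app A V) q - app A (D U V) q = T U V q) ->
  conn D X (app (pull_endo F A) Y) p =
  conn D X Y p *m A (pr F p) + T (on_slice F X p) (on_slice F Y p) (pr F p).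
Proof.
move=> sA DA; rewrite /conn vert_endo// mulmxDl addrAC; congr (_ + _).
have -> : on_slice F (app (pull_endo F A) Y) p = app A (on_slice F Y p).
  apply/funext => q; rewrite /on_slice /app /pull_endo pr_slice.
  by rewrite -!mulmxA inc_proj mulmx1.
rewrite -DA; [|exact: smooth_on_slice..].
by rewrite addrC subrK.
Qed.

Lemma conn_vfield (V : vfield N) p : smooth_vfield V ->
  conn D X (pull_vfield F V) p = D (on_slice F X p) V (pr F p).
Proof.
move=> sV; rewrite /conn vert_vfield// addr0; congr (D _ _ _).
by apply/funext => q; rewrite /on_slice /pull_vfield pr_slice -mulmxA inc_proj mulmx1.
Qed.

End Laws.

End PullbackConnection.

(** * The two factors of a product *)

Section ProductFactors.
Variables (R : realType) (n1 n2 : nat) (M1 : manifold R n1) (M2 : manifold R n2).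
Let M := prod_manifold M1 M2.
Implicit Types (a b p q : M).

Lemma transition_prod a b p : source (chart_at a) p -> source (chart_at b) p ->
  transition a b p = block_mx (transition a.1 b.1 p.1) 0 0 (transition a.2 b.2 p.2).
Proof.
move=> ap bp; have [/= a1 a2] := ap; have [/= b1 b2] := bp.
set x := coord (chart_at a) p.
have ov : overlap a b x by exists p.
have ov1 : overlap a.1 b.1 (coord (chart_at a.1) p.1) by exists p.1.
have ov2 : overlap a.2 b.2 (coord (chart_at a.2) p.2) by exists p.2.
have D := is_derive_diff _ (transition_map_differentiable ov).
have D1 := is_derive_diff _ (transition_map_differentiable ov1).
have D2 := is_derive_diff _ (transition_map_differentiable ov2).
apply: mulmx_row_ext => v.
have px : param (chart_at a) x = p := coordK ap.
have T := derive_transition_map v ov; rewrite px in T.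
have T1 := derive_transition_map (lsubmx v) ov1; rewrite (coordK a1) in T1.
have T2 := derive_transition_map (rsubmx v) ov2; rewrite (coordK a2) in T2.
have ER : v *m block_mx (transition a.1 b.1 p.1) 0 0 (transition a.2 b.2 p.2) =
    row_mx (lsubmx v *m transition a.1 b.1 p.1) (rsubmx v *m transition a.2 b.2 p.2).
  by rewrite -[v in LHS]hsubmxK mul_row_block !mulmx0 addr0 add0r.
rewrite ER -T1 -T2; apply: etrans (esym T) _.
rewrite -[LHS]hsubmxK.
have sub k (A : 'M[R]_(n1 + n2, k)) : 'D_v (transition_map a b) x *m A =
    'D_v (fun y => transition_map a b y *m A) x.
  by rewrite (@derive_val _ _ _ _ _ _ _ (is_derive_mulmxr A (D v))).
have lE k (w : 'M[R]_(k, n1 + n2)) : lsubmx w = w *m col_mx 1%:M 0.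
  by rewrite -[w in RHS]hsubmxK mul_row_col mulmx1 mulmx0 addr0.
have rE k (w : 'M[R]_(k, n1 + n2)) : rsubmx w = w *m col_mx 0 1%:M.
  by rewrite -[w in RHS]hsubmxK mul_row_col mulmx1 mulmx0 add0r.
congr row_mx.
  rewrite (lE _ ('D_v _ _)) sub; apply: (derive_line_eq _).1 => h.
  rewrite -lE /transition_map /= row_mxKl; congr (coord _ (param _ _)).
  by rewrite linearD linearZ /= row_mxKl.
rewrite (rE _ ('D_v _ _)) sub; apply: (derive_line_eq _).1 => h.
rewrite -rE /transition_map /= row_mxKr; congr (coord _ (param _ _)).
by rewrite linearD linearZ /= row_mxKr.
Qed.

Let P1 : 'M[R]_(n1 + n2, n1) := col_mx 1%:M 0.
Let E1 : 'M[R]_(n1, n1 + n2) := row_mx 1%:M 0.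
Let P2 : 'M[R]_(n1 + n2, n2) := col_mx 0 1%:M.
Let E2 : 'M[R]_(n2, n1 + n2) := row_mx 0 1%:M.

Lemma mul_proj1 k (x : 'M[R]_(k, n1 + n2)) : x *m P1 = lsubmx x.
Proof. by rewrite -[x in LHS]hsubmxK mul_row_col mulmx1 mulmx0 addr0. Qed.

Lemma mul_proj2 k (x : 'M[R]_(k, n1 + n2)) : x *m P2 = rsubmx x.
Proof. by rewrite -[x in LHS]hsubmxK mul_row_col mulmx1 mulmx0 add0r. Qed.

Lemma mul_inc1 k (y : 'M[R]_(k, n1)) : y *m E1 = row_mx y 0.
Proof. by rewrite mul_mx_row mulmx1 mulmx0. Qed.

Lemma mul_inc2 k (y : 'M[R]_(k, n2)) : y *m E2 = row_mx 0 y.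
Proof. by rewrite mul_mx_row mulmx1 mulmx0. Qed.

Definition fst_factor : factor M1 M.
Proof.
refine (@Factor R n1 (n1 + n2) M1 M (fun p : M => p.1) (fun (p : M) (q : M1) => (q, p.2)) E1 P1
  _ _ _ _ _ _ (fun p : M => row_mx 0 (coord (chart_at p.2) p.2)) _ _ _ _ _).
- by rewrite mul_proj1 row_mxKl.
- by case.
- by [].
- by move=> a p [].
- by move=> a p; rewrite mul_proj1 row_mxKl.
- by move=> a x; rewrite mul_proj1.
- by move=> p; rewrite mulmxBr mulmx1 mulmxA mul_proj1 mul_inc1 /= row_mxKl
    opp_row_mx add_row_mx subrr subr0.
- move=> p a y [q aq <-]; exists (q, p.2) => /=; first by split => //; exact: source_chart_at.
  by rewrite mul_inc1 add_row_mx addr0 add0r.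
- move=> p a y /=; rewrite mul_inc1 add_row_mx addr0 add0r row_mxKl row_mxKr.
  by rewrite param_self.
- move=> a b p ap bp; rewrite mul_proj1 transition_prod// block_mxEv.
  by rewrite -[LHS]mul_proj1 mul_col_mx !mul_proj1 !row_mxKl mul_col_mx mul1mx mul0mx.
- move=> a b p ap bp; rewrite mul_inc1 transition_prod// mul_row_block.
  by rewrite !mul1mx !mul0mx !addr0.
Defined.

Definition snd_factor : factor M2 M.
Proof.
refine (@Factor R n2 (n1 + n2) M2 M (fun p : M => p.2) (fun (p : M) (q : M2) => (p.1, q)) E2 P2
  _ _ _ _ _ _ (fun p : M => row_mx (coord (chart_at p.1) p.1) 0) _ _ _ _ _).
- by rewrite mul_proj2 row_mxKr.
- by case.
- by [].
- by move=> a p [].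
- by move=> a p; rewrite mul_proj2 row_mxKr.
- by move=> a x; rewrite mul_proj2.
- by move=> p; rewrite mulmxBr mulmx1 mulmxA mul_proj2 mul_inc2 /= row_mxKr
    opp_row_mx add_row_mx subrr subr0.
- move=> p a y [q aq <-]; exists (p.1, q) => /=; first by split => //; exact: source_chart_at.
  by rewrite mul_inc2 add_row_mx addr0 add0r.
- move=> p a y /=; rewrite mul_inc2 add_row_mx addr0 add0r row_mxKl row_mxKr.
  by rewrite param_self.
- move=> a b p ap bp; rewrite mul_proj2 transition_prod// block_mxEv.
  by rewrite -[LHS]mul_proj2 mul_col_mx !mul_proj2 !row_mxKr mul_col_mx mul1mx mul0mx.
- move=> a b p ap bp; rewrite mul_inc2 transition_prod// mul_row_block.
  by rewrite !mul1mx !mul0mx !add0r.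
Defined.

End ProductFactors.

(** * Almost contact metric algebra at a point *)

Section AlmostContact.
Variables (R : realType) (n : nat) (N : manifold R n) (S : acm_structure N) (p : N).
Implicit Types (x y z : 'rV[R]_n) (r : R).

Definition eta_at x : R := (x *m eta S p) 0 0.
Definition met_at x y : R := (x *m met S p *m y^T) 0 0.
Definition Phi_at x y : R := met_at (x *m phi S p) y.

Lemma eta_atD x y : eta_at (x + y) = eta_at x + eta_at y.
Proof. by rewrite /eta_at mulmxDl mxE. Qed.

Lemma eta_atZ r x : eta_at (r *: x) = r * eta_at x.
Proof. by rewrite /eta_at -scalemxAl mxE. Qed.

Lemma eta_atN x : eta_at (- x) = - eta_at x.
Proof. by rewrite /eta_at mulNmx mxE. Qed.

Lemma met_atDl x y z : met_at (x + y) z = met_at x z + met_at y z.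
Proof. by rewrite /met_at !mulmxDl mxE. Qed.

Lemma met_atZl r x z : met_at (r *: x) z = r * met_at x z.
Proof. by rewrite /met_at -!scalemxAl mxE. Qed.

Lemma met_atNl x z : met_at (- x) z = - met_at x z.
Proof. by rewrite /met_at !mulNmx mxE. Qed.

Lemma met_atC x y : met_at x y = met_at y x.
Proof.
have [_ sym _] := met_riemannian S.
have -> : met_at x y = (x *m met S p *m y^T)^T 0 0 by rewrite mxE.
by rewrite !trmx_mul trmxK sym mulmxA.
Qed.

Lemma met_atDr x y z : met_at z (x + y) = met_at z x + met_at z y.
Proof. by rewrite !(met_atC z) met_atDl. Qed.

Lemma met_atZr r x z : met_at z (r *: x) = r * met_at z x.
Proof. by rewrite !(met_atC z) met_atZl. Qed.

Lemma met_atNr x z : met_at z (- x) = - met_at z x.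
Proof. by rewrite !(met_atC z) met_atNl. Qed.

Lemma phi_at_square x : x *m phi S p *m phi S p = - x + eta_at x *: xi S p.
Proof. exact: (phi_square S (fun=> x) p). Qed.

Lemma eta_at_xi : eta_at (xi S p) = 1.
Proof. exact: (eta_xi S p). Qed.

Lemma met_at_phi x y :
  met_at (x *m phi S p) (y *m phi S p) = met_at x y - eta_at x * eta_at y.
Proof. exact: (met_phi S (fun=> x) (fun=> y) p). Qed.

Lemma xi_neq0 : xi S p != 0.
Proof.
apply/eqP => xi0; have := eta_at_xi; rewrite xi0 /eta_at mul0mx mxE.
by move/esym/eqP; rewrite oner_eq0.
Qed.

(** Compute phi^3 x in two ways to get eta(phi x) xi = eta(x) phi xi, and use
    that phi xi is a multiple of xi with phi^2 xi = 0. *)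
Lemma eta_at_phi x : eta_at (x *m phi S p) = 0.
Proof.
have := phi_at_square (x *m phi S p).
rewrite (phi_at_square x) mulmxDl mulNmx -scalemxAl => /addrI E.
suff phixi : xi S p *m phi S p = 0.
  move: E; rewrite phixi scaler0 => /esym/eqP; rewrite scaler_eq0.
  by rewrite (negPf xi_neq0) orbF => /eqP.
have sq0 : xi S p *m phi S p *m phi S p = 0.
  by rewrite phi_at_square eta_at_xi scale1r addNr.
have := phi_at_square (xi S p *m phi S p); rewrite sq0 mul0mx.
move/esym/eqP; rewrite addrC subr_eq0 => /eqP.
move: (eta_at _) => e phixiE; move: sq0; rewrite -phixiE -scalemxAl -phixiE scalerA => /eqP.
by rewrite scaler_eq0 (negPf xi_neq0) orbF mulf_eq0 orbb => /eqP->; rewrite scale0r.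
Qed.

Lemma phi_at_xi : xi S p *m phi S p = 0.
Proof.
have := phi_at_square (xi S p *m phi S p).
rewrite eta_at_phi scale0r addr0 (phi_at_square (xi S p)) eta_at_xi scale1r addNr mul0mx.
by move/esym/eqP; rewrite oppr_eq0 => /eqP.
Qed.

Lemma met_at_xi x : met_at x (xi S p) = eta_at x.
Proof.
have := met_at_phi x (xi S p); rewrite phi_at_xi eta_at_xi mulr1.
rewrite {1}/met_at trmx0 mulmx0 mxE => /esym/eqP.
by rewrite subr_eq0 => /eqP.
Qed.

Lemma Phi_atC x y : Phi_at x y = - Phi_at y x.
Proof.
rewrite /Phi_at; have := met_at_phi (x *m phi S p) y.
rewrite eta_at_phi mul0r subr0 phi_at_square met_atDl met_atNl met_atZl.
by rewrite (met_atC (xi S p)) met_at_xi eta_at_phi mulr0 addr0 (met_atC _ x) => <-;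
   rewrite met_atC.
Qed.

Lemma Phi_at_xi x : (Phi_at (xi S p) x = 0) * (Phi_at x (xi S p) = 0).
Proof.
have H : Phi_at (xi S p) x = 0 by rewrite /Phi_at phi_at_xi /met_at !mul0mx mxE.
by split=> //; rewrite Phi_atC H oppr0.
Qed.

Lemma Phi_atD x y z : (Phi_at (x + y) z = Phi_at x z + Phi_at y z) *
  (Phi_at z (x + y) = Phi_at z x + Phi_at z y).
Proof. by rewrite /Phi_at mulmxDl met_atDl met_atDr. Qed.

Lemma Phi_atZ r x z : (Phi_at (r *: x) z = r * Phi_at x z) *
  (Phi_at z (r *: x) = r * Phi_at z x).
Proof. by rewrite /Phi_at -scalemxAl met_atZl met_atZr. Qed.

Lemma Phi_atN x z : (Phi_at (- x) z = - Phi_at x z) * (Phi_at z (- x) = - Phi_at z x).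
Proof. by rewrite /Phi_at mulNmx met_atNl met_atNr. Qed.

Lemma Phi_at_phil x y : Phi_at (x *m phi S p) y = - met_at x y + eta_at x * eta_at y.
Proof.
by rewrite /Phi_at phi_at_square met_atDl met_atNl met_atZl (met_atC (xi S p)) met_at_xi.
Qed.

Lemma Phi_at_phi x y : Phi_at (x *m phi S p) (y *m phi S p) = Phi_at x y.
Proof. by rewrite /Phi_at met_at_phi eta_at_phi mul0r subr0. Qed.

End AlmostContact.

(** * The structure equations of a factor *)

Section AlphaSasakianXi.
Variables (R : realType) (n : nat) (N : manifold R n) (S : acm_structure N).
Variables (D : vfield N -> vfield N -> vfield N) (alpha : R).
Hypothesis lc : levi_civita (met S) D.
Hypothesis D_phi : forall X Y, smooth_vfield X -> smooth_vfield Y -> forall p,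
  D X (app (phi S) Y) p - app (phi S) (D X Y) p =
  alpha *: (met_at S p (X p) (Y p) *: xi S p - eta_at S p (Y p) *: X p).

Lemma lc_zero X p : smooth_vfield X -> D X (fun=> 0) p = 0.
Proof.
move=> sX; have s0 : smooth_vfield ((fun=> 0) : vfield N).
  have -> : (fun=> 0) = (fun p => cst 0 p *: X p) :> vfield N.
    by apply/funext => q; rewrite scale0r.
  by apply: smooth_vfieldZ => //; exact: smooth_cst.
have := lc_addr lc sX s0 s0 p.
have -> : (fun q : N => 0 + 0) = (fun=> 0) :> vfield N by apply/funext => q; rewrite addr0.
by move/eqP; rewrite -subr_eq subrr => /eqP.
Qed.

(** Since g(xi, xi) = 1 is constant. *)
Lemma eta_D_xi X p : smooth_vfield X -> eta_at S p (D X (xi S) p) = 0.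
Proof.
move=> sX; have sxi := xi_smooth S.
have := lc_metric lc sX sxi sxi p.
have -> : ip (met S) (xi S) (xi S) = cst 1.
  by apply/funext => q; rewrite -[LHS]/(met_at S q _ _) met_at_xi eta_at_xi.
rewrite der_cst -[ip _ _ _ p]/(met_at S p _ _) -[ip _ (xi S) _ p]/(met_at S p _ _).
rewrite (met_atC _ _ (xi S p)) met_at_xi -mulr2n => /esym/eqP.
by rewrite mulrn_eq0 => /eqP.
Qed.

(** Put Y = xi in the equation for nabla phi, where phi xi = 0, and apply phi. *)
Lemma D_xi X p : smooth_vfield X -> D X (xi S) p = - alpha *: (X p *m phi S p).
Proof.
move=> sX; have := D_phi sX (xi_smooth S) p.
have -> : app (phi S) (xi S) = (fun=> 0) by apply/funext => q; exact: phi_at_xi.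
rewrite lc_zero// sub0r met_at_xi eta_at_xi scale1r => /(congr1 (mulmx^~ (phi S p))).
rewrite mulNmx phi_at_square eta_D_xi// scale0r addr0 opprK => ->.
by rewrite -scalemxAl mulmxBl -scalemxAl phi_at_xi scaler0 sub0r scalerN scaleNr.
Qed.

End AlphaSasakianXi.

(** The cyclic sum of the terms in alpha of the covariant derivative of Phi is
    zero. Here [xy] stands for nabla_X Y and [dx] for X(Phi(Y, Z)). *)
Lemma Phi_closed_algebra (R : realType) (n : nat) (N : manifold R n)
    (S : acm_structure N) (q : N) (alpha : R) (x y z xy yx xz zx yz zy lxy lxz lyz : 'rV[R]_n)
    (dx dy dz : R) (g := met_at S q) (e := eta_at S q) (w := Phi_at S q) :
  dx = w xy z + w y xz + alpha * (g x y * e z - e y * g x z) ->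
  dy = w yx z + w x yz + alpha * (g y x * e z - e x * g y z) ->
  dz = w zx y + w x zy + alpha * (g z x * e y - e x * g z y) ->
  lxy = xy - yx -> lxz = xz - zx -> lyz = yz - zy ->
  dx - dy + dz - w lxy z + w lxz y - w lyz x = 0.
Proof.
move=> -> -> -> -> -> ->; rewrite /w /g !Phi_atD !Phi_atN.
rewrite (Phi_atC S q y xz) (Phi_atC S q x yz) (Phi_atC S q x zy).
rewrite (met_atC S q y x) (met_atC S q z x) (met_atC S q z y); ring.
Qed.

Section PulledStructure.
Variables (R : realType) (m n : nat) (N : manifold R m) (M : manifold R n).
Variables (F : factor N M) (S : acm_structure N).
Variables (D : vfield N -> vfield N -> vfield N) (alpha : R).
Hypothesis lc : levi_civita (met S) D.
Hypothesis D_phi : forall X Y, smooth_vfield X -> smooth_vfield Y -> forall p,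
  D X (app (phi S) Y) p - app (phi S) (D X Y) p =
  alpha *: (met_at S p (X p) (Y p) *: xi S p - eta_at S p (Y p) *: X p).
Implicit Types (X Y Z : vfield M) (p : M).

Definition eta_form X p : R := eta_at S (pr F p) (X p *m proj F).
Definition Phi_form X Y p : R := Phi_at S (pr F p) (X p *m proj F) (Y p *m proj F).

Let phiF := pull_endo F (phi S).
Let metF := pull_bilinear F (met S).
Let xiF := pull_vfield F (xi S).

Let smet : smooth_bilinear (met S). Proof. by case: (met_riemannian S). Qed.
Let sphiF : smooth_endo phiF. Proof. exact: smooth_pull_endo (phi_smooth S). Qed.
Let smetF : smooth_bilinear metF. Proof. exact: smooth_pull_bilinear smet. Qed.
Let sxiF : smooth_vfield xiF. Proof. exact: smooth_pull_vfield (xi_smooth S). Qed.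

Lemma xiF_proj p : xiF p *m proj F = xi S (pr F p).
Proof. by rewrite /xiF /pull_vfield -mulmxA inc_proj mulmx1. Qed.

Lemma phiF_proj X p : app phiF X p *m proj F = X p *m proj F *m phi S (pr F p).
Proof. by rewrite /app /phiF /pull_endo -!mulmxA inc_proj mulmx1. Qed.

Lemma ip_metF X Y p :
  ip metF X Y p = met_at S (pr F p) (X p *m proj F) (Y p *m proj F).
Proof. by rewrite /ip /metF /pull_bilinear /met_at trmx_mul !mulmxA. Qed.

Lemma eta_formE X : eta_form X = ip metF X xiF.
Proof. by apply/funext => p; rewrite ip_metF xiF_proj met_at_xi. Qed.

Lemma Phi_formE X Y : Phi_form X Y = ip metF (app phiF X) Y.
Proof. by apply/funext => p; rewrite ip_metF phiF_proj. Qed.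

Lemma smooth_eta_form X : smooth_vfield X -> smooth_fun (eta_form X).
Proof. by move=> sX; rewrite eta_formE; exact: smooth_ip. Qed.

Lemma smooth_Phi_form X Y : smooth_vfield X -> smooth_vfield Y ->
  smooth_fun (Phi_form X Y).
Proof. by move=> sX sY; rewrite Phi_formE; apply: smooth_ip => //; exact: smooth_app. Qed.

Section Derivatives.
Variables (X Y : vfield M) (p : M).
Hypotheses (sX : smooth_vfield X) (sY : smooth_vfield Y).
Let x := X p *m proj F.
Let y := Y p *m proj F.

Lemma conn_phi : conn F D X (app phiF Y) p =
  conn F D X Y p *m phi S (pr F p) +
  alpha *: (met_at S (pr F p) x y *: xi S (pr F p) - eta_at S (pr F p) y *: x).
Proof.
rewrite (conn_endo F (T := fun U V q =>
  alpha *: (met_at S q (U q) (V q) *: xi S q - eta_at S q (V q) *: U q)) sX sY p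
  (phi_smooth S))//.
by rewrite !on_slice_self.
Qed.

Lemma conn_xi : conn F D X xiF p = - alpha *: (x *m phi S (pr F p)).
Proof.
rewrite (conn_vfield F _ _ _ (xi_smooth S)) (D_xi lc D_phi _ (smooth_on_slice F p sX)).
by rewrite on_slice_self.
Qed.

Lemma der_eta_form : der X (eta_form Y) p =
  eta_at S (pr F p) (conn F D X Y p) - alpha * Phi_at S (pr F p) x y.
Proof.
rewrite eta_formE (conn_metric F lc smet sX sY sxiF) conn_xi xiF_proj.
rewrite -[X in X + _ = _]/(met_at S (pr F p) _ _) -[X in _ + X = _]/(met_at S (pr F p) _ _).
by rewrite met_at_xi met_atZr mulNr met_atC.
Qed.

End Derivatives.

(** By torsion-freeness the left-hand side is the alternation of the covariant
    derivative of eta, which is - alpha Phi. *)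
Lemma d_eta_form X Y p : smooth_vfield X -> smooth_vfield Y ->
  der X (eta_form Y) p - der Y (eta_form X) p - eta_form (lie X Y) p
  = - (alpha *+ 2) * Phi_form X Y p.
Proof.
move=> sX sY; rewrite !der_eta_form// /eta_form (conn_torsion_free F lc sX sY).
rewrite /Phi_form; move: (conn _ _ _ _ _) (conn _ _ _ _ _) => u v.
rewrite eta_atD eta_atN (Phi_atC _ _ (Y p *m _)).
by move: (eta_at _ _ _) (eta_at _ _ _) (Phi_at _ _ _ _) => a b c; ring.
Qed.

Lemma der_Phi_form X Y Z p :
  smooth_vfield X -> smooth_vfield Y -> smooth_vfield Z ->
  let x := X p *m proj F in let y := Y p *m proj F in let z := Z p *m proj F in
  der X (Phi_form Y Z) p =
  Phi_at S (pr F p) (conn F D X Y p) z + Phi_at S (pr F p) y (conn F D X Z p) +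
  alpha * (met_at S (pr F p) x y * eta_at S (pr F p) z -
           eta_at S (pr F p) y * met_at S (pr F p) x z).
Proof.
move=> sX sY sZ x y z; have sphiY := smooth_app sphiF sY.
rewrite Phi_formE (conn_metric F lc smet sX sphiY sZ) conn_phi// phiF_proj.
rewrite -[X in X + _ = _]/(met_at S (pr F p) _ _) -[X in _ + X = _]/(met_at S (pr F p) _ _).
rewrite -/x -/y -/z met_atDl met_atZl met_atDl met_atNl !met_atZl.
rewrite (met_atC _ _ (xi _ _)) met_at_xi; exact: addrAC.
Qed.

Lemma d_Phi_form X Y Z p :
  smooth_vfield X -> smooth_vfield Y -> smooth_vfield Z ->
  der X (Phi_form Y Z) p - der Y (Phi_form X Z) p + der Z (Phi_form X Y) p
  - Phi_form (lie X Y) Z p + Phi_form (lie X Z) Y p - Phi_form (lie Y Z) X p = 0.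
Proof.
move=> sX sY sZ; exact: Phi_closed_algebra
  (der_Phi_form p sX sY sZ) (der_Phi_form p sY sX sZ) (der_Phi_form p sZ sX sY)
  (conn_torsion_free F lc sX sY p) (conn_torsion_free F lc sX sZ p)
  (conn_torsion_free F lc sY sZ p).
Qed.

End PulledStructure.

(** * The Morimoto structure and the product metric *)

Section SmoothEndo.
Variables (R : realType) (n : nat) (M : manifold R n).

Lemma smooth_endoD (A B : M -> 'M[R]_n) : smooth_endo A -> smooth_endo B ->
  smooth_endo (fun p => A p + B p).
Proof.
move=> sA sB a k; have C := CkD (open_target a) (sA a k) (sB a k).
apply: (Ck_eq (open_target a) _ C) => x ax.
exact: etrans (esym (mulmxDl _ _ _)) (congr1 (mulmx^~ _) (esym (mulmxDr _ _ _))).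
Qed.

Lemma smooth_endoZ (r : R) (A : M -> 'M[R]_n) : smooth_endo A ->
  smooth_endo (fun p => r *: A p).
Proof.
move=> sA a k; have C := Ck_scale (open_target a) (Ck_cst k _ r) (sA a k).
apply: (Ck_eq (open_target a) _ C) => x ax.
exact: etrans (scalemxAl _ _ _) (congr1 (mulmx^~ _) (scalemxAr _ _ _)).
Qed.

Lemma smooth_endo_outer (eta : M -> 'cV[R]_n) (X : vfield M) :
  smooth_1form eta -> smooth_vfield X -> smooth_endo (fun p => eta p *m X p).
Proof.
move=> se sX a k; have C := Ck_mulmx (open_target a) (se a k) (sX a k).
by apply: (Ck_eq (open_target a) _ C) => x ax; rewrite /= !mulmxA.
Qed.

Lemma smooth_bilinearD (A B : M -> 'M[R]_n) : smooth_bilinear A -> smooth_bilinear B ->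
  smooth_bilinear (fun p => A p + B p).
Proof.
move=> sA sB a k; have C := CkD (open_target a) (sA a k) (sB a k).
apply: (Ck_eq (open_target a) _ C) => x ax.
exact: etrans (esym (mulmxDl _ _ _)) (congr1 (mulmx^~ _) (esym (mulmxDr _ _ _))).
Qed.

End SmoothEndo.

Section Morimoto.
Variables (R : realType) (n1 n2 : nat) (M1 : manifold R n1) (M2 : manifold R n2).
Variables (S1 : acm_structure M1) (S2 : acm_structure M2).
Local Notation M := (prod_manifold M1 M2).
Local Notation F1 := (fst_factor M1 M2).
Local Notation F2 := (snd_factor M1 M2).
Local Notation J := (morimoto S1 S2).
Local Notation g := (prod_metric S1 S2).

Lemma proj_ext k (u v : 'M[R]_(k, n1 + n2)) :
  u *m proj F1 = v *m proj F1 -> u *m proj F2 = v *m proj F2 -> u = v.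
Proof.
rewrite !mul_proj1 !mul_proj2 => l r.
by rewrite -(hsubmxK u) -(hsubmxK v) l r.
Qed.

Lemma inc_proj_cross :
  (inc F1 *m proj F2 = 0) * (inc F2 *m proj F1 = 0).
Proof. by rewrite mul_proj1 mul_proj2 /= row_mxKl row_mxKr. Qed.

Lemma scalar_outer n (r : 'M[R]_1) (x : 'rV[R]_n) : r *m x = r 0 0 *: x.
Proof. by rewrite [r in LHS]mx11_scalar mul_scalar_mx. Qed.

Lemma morimoto_proj1 p (v : 'rV[R]_(n1 + n2)) : v *m J p *m proj F1 =
  v *m proj F1 *m phi S1 p.1 - eta_at S2 p.2 (v *m proj F2) *: xi S1 p.1.
Proof.
rewrite !mul_proj1 mul_proj2 -[v in LHS]hsubmxK mul_row_block row_mxKl.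
by rewrite mulmxN mulmxA scalar_outer.
Qed.

Lemma morimoto_proj2 p (v : 'rV[R]_(n1 + n2)) : v *m J p *m proj F2 =
  v *m proj F2 *m phi S2 p.2 + eta_at S1 p.1 (v *m proj F1) *: xi S2 p.2.
Proof.
rewrite mul_proj1 !mul_proj2 -[v in LHS]hsubmxK mul_row_block row_mxKr addrC.
by rewrite mulmxA scalar_outer.
Qed.

(** Writes J in terms of pulled back tensors, which gives its smoothness. *)
Lemma morimotoE p : J p =
  pull_endo F1 (phi S1) p + pull_endo F2 (phi S2) p +
  (pull_1form F1 (eta S1) p *m pull_vfield F2 (xi S2) p +
   (-1) *: (pull_1form F2 (eta S2) p *m pull_vfield F1 (xi S1) p)).
Proof.
rewrite scaleN1r; have [E12 E21] := inc_proj_cross.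
apply: mulmx_row_ext => v; apply: proj_ext.
  rewrite morimoto_proj1 /pull_endo /pull_1form /pull_vfield.
  rewrite !mulmxDr mulmxN !mulmxDl mulNmx !mulmxA -!(mulmxA _ (inc _)) E21 inc_proj.
  by rewrite !mulmx0 addr0 add0r !mulmx1 scalar_outer.
rewrite morimoto_proj2 /pull_endo /pull_1form /pull_vfield.
rewrite !mulmxDr mulmxN !mulmxDl mulNmx !mulmxA -!(mulmxA _ (inc _)) E12 inc_proj.
by rewrite !mulmx0 subr0 add0r !mulmx1 scalar_outer.
Qed.

Lemma morimoto_smooth : smooth_endo J.
Proof.
have s1 := smooth_pull_endo F1 (phi_smooth S1).
have s2 := smooth_pull_endo F2 (phi_smooth S2).
have s12 := smooth_endo_outer (smooth_pull_1form F1 (eta_smooth S1))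
                              (smooth_pull_vfield F2 (xi_smooth S2)).
have s21 := smooth_endo_outer (smooth_pull_1form F2 (eta_smooth S2))
                              (smooth_pull_vfield F1 (xi_smooth S1)).
have H := smooth_endoD (smooth_endoD s1 s2) (smooth_endoD s12 (smooth_endoZ (-1) s21)).
have -> // : J = _ := funext morimotoE.
Qed.

Lemma morimoto_square p : J p *m J p = - 1%:M.
Proof.
apply: mulmx_row_ext => v; rewrite mulmxA mulmxN mulmx1.
apply: proj_ext; rewrite mulNmx.
  rewrite !(morimoto_proj1, morimoto_proj2) mulmxBl -scalemxAl phi_at_xi scaler0 subr0.
  rewrite phi_at_square eta_atD eta_at_phi add0r eta_atZ eta_at_xi mulr1.
  by rewrite addrK.
rewrite !(morimoto_proj1, morimoto_proj2) mulmxDl -scalemxAl phi_at_xi scaler0 addr0.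
rewrite phi_at_square eta_atD eta_at_phi add0r eta_atN eta_atZ eta_at_xi mulr1.
by rewrite scaleNr addrK.
Qed.

Lemma prod_metricE p : g p =
  pull_bilinear F1 (met S1) p + pull_bilinear F2 (met S2) p.
Proof.
rewrite /pull_bilinear /= !tr_col_mx !trmx0 !trmx1 !mul_col_mx !mul1mx !mul0mx.
rewrite !mul_mx_row !mulmx1 !mulmx0.
by rewrite add_col_mx addr0 add0r -block_mxEv.
Qed.

Lemma ip_prod_metric (u v : 'rV[R]_(n1 + n2)) p : (u *m g p *m v^T) 0 0 =
  met_at S1 p.1 (u *m proj F1) (v *m proj F1) +
  met_at S2 p.2 (u *m proj F2) (v *m proj F2).
Proof.
rewrite prod_metricE mulmxDr mulmxDl mxE /met_at.
by rewrite /pull_bilinear /= !trmx_mul !mulmxA.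
Qed.

Lemma prod_metric_riemannian : riemannian g.
Proof.
have [sm1 sy1 po1] := met_riemannian S1; have [sm2 sy2 po2] := met_riemannian S2.
split.
- have H := smooth_bilinearD (smooth_pull_bilinear F1 sm1) (smooth_pull_bilinear F2 sm2).
  by have -> : g = _ := funext prod_metricE.
- by move=> p; rewrite /g /prod_metric tr_block_mx !trmx0 sy1 sy2.
move=> p v v0; rewrite ip_prod_metric.
have pos k (N : manifold R k) (S : acm_structure N) q w : w != 0 -> 0 < met_at S q w w.
  by move=> w0; have [_ _] := met_riemannian S; apply.
have nneg k (N : manifold R k) (S : acm_structure N) q w : 0 <= met_at S q w w.
  have [->|/pos/ltW//] := eqVneq w 0; by rewrite /met_at !mul0mx mxE.
have [v1|v1] := eqVneq (v *m proj F1) 0; last by rewrite ltr_wpDr// pos.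
rewrite ltr_wpDl// pos//; apply: contraNneq v0 => v2; apply/eqP.
by apply: proj_ext; rewrite mul0mx.
Qed.

Lemma morimoto_compatible X Y (p : M) : ip g (app J X) (app J Y) p = ip g X Y p.
Proof.
rewrite /ip !ip_prod_metric /app !(morimoto_proj1, morimoto_proj2).
rewrite !met_atDl !met_atDr !met_atNl !met_atNr !met_atZl !met_atZr !met_at_phi.
rewrite !(met_atC _ _ (xi _ _)) !met_at_xi !eta_at_phi !eta_at_xi.
by ring.
Qed.

End Morimoto.

#[local] Opaque derive conn.

(** * Integrability of the Morimoto structure *)

Lemma conn_J_algebra1 (R : realType) n (f : 'M[R]_n) (x c A B C xi xi' : 'rV[R]_n)
    (a1 a2 g e1 e2 ey d w : R) :
  A = c *m f + a1 *: (g *: xi - e1 *: x) -> B = d *: xi' + (- ey) *: C ->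
  C = - a1 *: (x *m f) -> d = - (e2 - a2 * w) -> xi' = xi ->
  A + B = c *m f - e2 *: xi +
    (a1 *: (g *: xi - e1 *: x + ey *: (x *m f)) + (a2 * w) *: xi).
Proof.
move=> -> -> -> -> ->; move: (c *m f) (x *m f) => cf xf.
by apply/rowP => j; rewrite !mxE; ring.
Qed.

Lemma conn_J_algebra2 (R : realType) n (f : 'M[R]_n) (x c A B C xi xi' : 'rV[R]_n)
    (a1 a2 g e1 e2 ey d w : R) :
  A = c *m f + a2 *: (g *: xi - e2 *: x) -> B = d *: xi' + ey *: C ->
  C = - a2 *: (x *m f) -> d = e1 - a1 * w -> xi' = xi ->
  A + B = c *m f + e1 *: xi +
    (a2 *: (g *: xi - e2 *: x - ey *: (x *m f)) - (a1 * w) *: xi).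
Proof.
move=> -> -> -> -> ->; move: (c *m f) (x *m f) => cf xf.
by apply/rowP => j; rewrite !mxE; ring.
Qed.

(** With A, B, C, C' the covariant derivatives of Y along J X, X along J Y,
    Y along X, X along Y, and t1, t2, t3, t4 the values of nabla J that appear
    when the derivative of J X or J Y is expanded, the terms other than the t_i
    cancel because J^2 = -1. *)
Lemma nijenhuis_algebra (R : realType) n (J : 'M[R]_n)
    (A B C C' t1 t2 t3 t4 l1 l2 l3 l4 : 'rV[R]_n) :
  J *m J = - 1%:M -> l1 = A *m J + t1 - (B *m J + t2) -> l2 = A - (C' *m J + t3) ->
  l3 = C *m J + t4 - B -> l4 = C - C' -> t1 - t2 = (t4 - t3) *m J ->
  l1 - l2 *m J - l3 *m J - l4 = 0.
Proof.
move=> JJ -> -> -> -> /eqP; rewrite subr_eq => /eqP ->.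
rewrite !(mulmxDl, mulNmx) -!(mulmxA _ J) JJ !mulmxN !mulmx1.
move: (A *m J) (B *m J) (t3 *m J) (t4 *m J) => AJ BJ t3J t4J.
by apply/rowP => j; rewrite !mxE; ring.
Qed.

(** The identity (nabla_(J X) J) Y - (nabla_(J Y) J) X = J ((nabla_X J) Y -
    (nabla_Y J) X), one lemma for each factor, where T1 and T2 are the two
    components of (nabla_X J) Y. *)
Section TwoStructures.
Variables (R : realType) (n1 n2 : nat) (M1 : manifold R n1) (M2 : manifold R n2).
Variables (S1 : acm_structure M1) (S2 : acm_structure M2) (alpha1 alpha2 : R).
Variables (p1 : M1) (p2 : M2) (u1 v1 : 'rV[R]_n1) (u2 v2 : 'rV[R]_n2).
Local Notation f1 := (phi S1 p1).
Local Notation f2 := (phi S2 p2).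
Local Notation x1 := (xi S1 p1).
Local Notation x2 := (xi S2 p2).
Local Notation e1 := (eta_at S1 p1).
Local Notation e2 := (eta_at S2 p2).
Local Notation g1 := (met_at S1 p1).
Local Notation g2 := (met_at S2 p2).
Local Notation w1 := (Phi_at S1 p1).
Local Notation w2 := (Phi_at S2 p2).

Let T1 (u1 v1 : 'rV[R]_n1) (u2 v2 : 'rV[R]_n2) : 'rV[R]_n1 :=
  alpha1 *: (g1 u1 v1 *: x1 - e1 v1 *: u1 + e2 v2 *: (u1 *m f1)) + (alpha2 * w2 u2 v2) *: x1.
Let T2 (u1 v1 : 'rV[R]_n1) (u2 v2 : 'rV[R]_n2) : 'rV[R]_n2 :=
  alpha2 *: (g2 u2 v2 *: x2 - e2 v2 *: u2 - e1 v1 *: (u2 *m f2)) - (alpha1 * w1 u1 v1) *: x2.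

Lemma dJ_algebra1 :
  T1 (u1 *m f1 - e2 u2 *: x1) v1 (u2 *m f2 + e1 u1 *: x2) v2
  - T1 (v1 *m f1 - e2 v2 *: x1) u1 (v2 *m f2 + e1 v1 *: x2) u2
  = (T1 u1 v1 u2 v2 - T1 v1 u1 v2 u2) *m f1 -
    e2 (T2 u1 v1 u2 v2 - T2 v1 u1 v2 u2) *: x1.
Proof.
have metphi k (N : manifold R k) (S : acm_structure N) q (x y : 'rV[R]_k) :
  met_at S q (x *m phi S q) y = Phi_at S q x y by [].
rewrite /T1 /T2 !(mulmxDl, mulNmx) -!scalemxAl !(mulmxDl, mulNmx) -!scalemxAl.
rewrite !phi_at_square !phi_at_xi.
rewrite !(met_atDl, met_atNl, met_atZl, Phi_atD, Phi_atN, Phi_atZ, Phi_at_phil, Phi_at_xi).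
rewrite !metphi !(met_atC _ _ (xi _ _)) !met_at_xi.
rewrite !(eta_atD, eta_atN, eta_atZ) !eta_at_xi !eta_at_phi.
rewrite (Phi_atC _ _ v1) (Phi_atC _ _ v2) (met_atC _ _ v1) (met_atC _ _ v2).
move: (u1 *m f1) (v1 *m f1) => U1 V1.
by apply/rowP => j; rewrite !mxE; ring.
Qed.

Lemma dJ_algebra2 :
  T2 (u1 *m f1 - e2 u2 *: x1) v1 (u2 *m f2 + e1 u1 *: x2) v2
  - T2 (v1 *m f1 - e2 v2 *: x1) u1 (v2 *m f2 + e1 v1 *: x2) u2
  = (T2 u1 v1 u2 v2 - T2 v1 u1 v2 u2) *m f2 +
    e1 (T1 u1 v1 u2 v2 - T1 v1 u1 v2 u2) *: x2.
Proof.
have metphi k (N : manifold R k) (S : acm_structure N) q (x y : 'rV[R]_k) :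
  met_at S q (x *m phi S q) y = Phi_at S q x y by [].
rewrite /T1 /T2 !(mulmxDl, mulNmx) -!scalemxAl !(mulmxDl, mulNmx) -!scalemxAl.
rewrite !phi_at_square !phi_at_xi.
rewrite !(met_atDl, met_atNl, met_atZl, Phi_atD, Phi_atN, Phi_atZ, Phi_at_phil, Phi_at_xi).
rewrite !metphi !(met_atC _ _ (xi _ _)) !met_at_xi.
rewrite !(eta_atD, eta_atN, eta_atZ) !eta_at_xi !eta_at_phi.
rewrite (Phi_atC _ _ v1) (Phi_atC _ _ v2) (met_atC _ _ v1) (met_atC _ _ v2).
move: (u2 *m f2) (v2 *m f2) => U2 V2.
by apply/rowP => j; rewrite !mxE; ring.
Qed.

End TwoStructures.

Section Integrability.
Variables (R : realType) (n1 n2 : nat) (M1 : manifold R n1) (M2 : manifold R n2).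
Variables (S1 : acm_structure M1) (S2 : acm_structure M2) (alpha1 alpha2 : R).
Variables (D1 : vfield M1 -> vfield M1 -> vfield M1).
Variables (D2 : vfield M2 -> vfield M2 -> vfield M2).
Hypothesis lc1 : levi_civita (met S1) D1.
Hypothesis lc2 : levi_civita (met S2) D2.
Hypothesis D1_phi : forall X Y, smooth_vfield X -> smooth_vfield Y -> forall p,
  D1 X (app (phi S1) Y) p - app (phi S1) (D1 X Y) p =
  alpha1 *: (met_at S1 p (X p) (Y p) *: xi S1 p - eta_at S1 p (Y p) *: X p).
Hypothesis D2_phi : forall X Y, smooth_vfield X -> smooth_vfield Y -> forall p,
  D2 X (app (phi S2) Y) p - app (phi S2) (D2 X Y) p =
  alpha2 *: (met_at S2 p (X p) (Y p) *: xi S2 p - eta_at S2 p (Y p) *: X p).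
Local Notation M := (prod_manifold M1 M2).
Local Notation F1 := (fst_factor M1 M2).
Local Notation F2 := (snd_factor M1 M2).
Local Notation J := (morimoto S1 S2).
Implicit Types (X Y : vfield M) (p : M) (u v : 'rV[R]_(n1 + n2)).

Definition nabla X Y p : 'rV[R]_(n1 + n2) :=
  row_mx (conn F1 D1 X Y p) (conn F2 D2 X Y p).

Lemma nabla_proj1 X Y p : nabla X Y p *m proj F1 = conn F1 D1 X Y p.
Proof. by rewrite mul_proj1 row_mxKl. Qed.

Lemma nabla_proj2 X Y p : nabla X Y p *m proj F2 = conn F2 D2 X Y p.
Proof. by rewrite mul_proj2 row_mxKr. Qed.

Lemma lie_nabla X Y p : smooth_vfield X -> smooth_vfield Y ->
  lie X Y p = nabla X Y p - nabla Y X p.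
Proof.
move=> sX sY; apply: (proj_ext (M1 := M1) (M2 := M2)).
  apply: etrans (conn_torsion_free F1 lc1 sX sY p) _.
  exact: etrans (congr2 (fun a b => a - b) (esym (nabla_proj1 X Y p))
    (esym (nabla_proj1 Y X p))) (esym (mulmxBl _ _ _)).
apply: etrans (conn_torsion_free F2 lc2 sX sY p) _.
exact: etrans (congr2 (fun a b => a - b) (esym (nabla_proj2 X Y p))
  (esym (nabla_proj2 Y X p))) (esym (mulmxBl _ _ _)).
Qed.

(** [dJ1] and [dJ2] are the two components of (nabla_u J) v. The terms in
    Phi come from the derivatives of eta_2 and eta_1, which multiply xi_1 and
    xi_2 in J. *)
Definition dJ1 p u v : 'rV[R]_n1 :=
  let u1 := u *m proj F1 in let v1 := v *m proj F1 in
  let u2 := u *m proj F2 in let v2 := v *m proj F2 in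
  alpha1 *: (met_at S1 p.1 u1 v1 *: xi S1 p.1 - eta_at S1 p.1 v1 *: u1
             + eta_at S2 p.2 v2 *: (u1 *m phi S1 p.1))
  + (alpha2 * Phi_at S2 p.2 u2 v2) *: xi S1 p.1.

Definition dJ2 p u v : 'rV[R]_n2 :=
  let u1 := u *m proj F1 in let v1 := v *m proj F1 in
  let u2 := u *m proj F2 in let v2 := v *m proj F2 in
  alpha2 *: (met_at S2 p.2 u2 v2 *: xi S2 p.2 - eta_at S2 p.2 v2 *: u2
             - eta_at S1 p.1 v1 *: (u2 *m phi S2 p.2))
  - (alpha1 * Phi_at S1 p.1 u1 v1) *: xi S2 p.2.

Definition dJ p u v : 'rV[R]_(n1 + n2) := row_mx (dJ1 p u v) (dJ2 p u v).

Let sphi1 : smooth_endo (pull_endo F1 (phi S1)).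
Proof. exact: smooth_pull_endo (phi_smooth S1). Qed.
Let sphi2 : smooth_endo (pull_endo F2 (phi S2)).
Proof. exact: smooth_pull_endo (phi_smooth S2). Qed.
Let sxi1 : smooth_vfield (pull_vfield F1 (xi S1)).
Proof. exact: smooth_pull_vfield (xi_smooth S1). Qed.
Let sxi2 : smooth_vfield (pull_vfield F2 (xi S2)).
Proof. exact: smooth_pull_vfield (xi_smooth S2). Qed.

Lemma smooth_app_J X : smooth_vfield X -> smooth_vfield (app J X).
Proof. exact: smooth_app (morimoto_smooth S1 S2). Qed.

Lemma conn1_J X Y p : smooth_vfield X -> smooth_vfield Y ->
  conn F1 D1 X (app J Y) p = conn F1 D1 X Y p *m phi S1 p.1
    - eta_at S2 p.2 (conn F2 D2 X Y p) *: xi S1 p.1 + dJ1 p (X p) (Y p).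
Proof.
move=> sX sY; have se := smooth_eta_form F2 S2 sY.
have sf := smooth_funN se.
have sphiY := smooth_app sphi1 sY.
have sxiY := smooth_vfieldZ sf sxi1.
have JY (q : M) : app J Y q *m proj F1 = (app (pull_endo F1 (phi S1)) Y q +
    (- eta_form F2 S2 Y) q *: pull_vfield F1 (xi S1) q) *m proj F1.
  by rewrite /app morimoto_proj1 mulmxDl -scalemxAl phiF_proj xiF_proj scaleNr.
have E0 := conn_proj_ext D1 X p (smooth_app_J sY) (smooth_vfieldD sphiY sxiY) JY.
have E1 := connD F1 lc1 sX sphiY sxiY p.
have E2 := conn_phi F1 D1_phi p sX sY.
have E3 := connZ F1 lc1 sX sxi1 p sf.
have E4 := conn_xi F1 lc1 D1_phi p sX.
have E5 := derN X p se.
have E6 := der_eta_form F2 lc2 D2_phi p sX sY.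
have xiP := xiF_proj F1 S1 p.
have E01 := etrans E0 E1.
apply: etrans E01 _; exact: conn_J_algebra1 E2 E3 E4 (etrans E5 (congr1 -%R E6)) xiP.
Qed.

Lemma conn2_J X Y p : smooth_vfield X -> smooth_vfield Y ->
  conn F2 D2 X (app J Y) p = conn F2 D2 X Y p *m phi S2 p.2
    + eta_at S1 p.1 (conn F1 D1 X Y p) *: xi S2 p.2 + dJ2 p (X p) (Y p).
Proof.
move=> sX sY; have se := smooth_eta_form F1 S1 sY.
have sphiY := smooth_app sphi2 sY.
have sxiY := smooth_vfieldZ se sxi2.
have JY (q : M) : app J Y q *m proj F2 = (app (pull_endo F2 (phi S2)) Y q +
    eta_form F1 S1 Y q *: pull_vfield F2 (xi S2) q) *m proj F2.
  by rewrite /app morimoto_proj2 mulmxDl -scalemxAl phiF_proj xiF_proj.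
have E0 := conn_proj_ext D2 X p (smooth_app_J sY) (smooth_vfieldD sphiY sxiY) JY.
have E1 := connD F2 lc2 sX sphiY sxiY p.
have E2 := conn_phi F2 D2_phi p sX sY.
have E3 := connZ F2 lc2 sX sxi2 p se.
have E4 := conn_xi F2 lc2 D2_phi p sX.
have E6 := der_eta_form F1 lc1 D1_phi p sX sY.
have xiP := xiF_proj F2 S2 p.
have E01 := etrans E0 E1.
apply: etrans E01 _; exact: conn_J_algebra2 E2 E3 E4 E6 xiP.
Qed.

Lemma nabla_J X Y p : smooth_vfield X -> smooth_vfield Y ->
  nabla X (app J Y) p = nabla X Y p *m J p + dJ p (X p) (Y p).
Proof.
move=> sX sY; apply: (proj_ext (M1 := M1) (M2 := M2)); rewrite [RHS]mulmxDl.
  apply: etrans (nabla_proj1 _ _ _) (etrans (conn1_J p sX sY) _); congr (_ + _).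
    by rewrite morimoto_proj1 nabla_proj1 nabla_proj2.
  by rewrite mul_proj1 row_mxKl.
apply: etrans (nabla_proj2 _ _ _) (etrans (conn2_J p sX sY) _); congr (_ + _).
  by rewrite morimoto_proj2 nabla_proj1 nabla_proj2.
by rewrite mul_proj2 row_mxKr.
Qed.

Lemma dJ_nijenhuis p u v :
  dJ p (u *m J p) v - dJ p (v *m J p) u = (dJ p u v - dJ p v u) *m J p.
Proof.
have proj1 w w' : dJ p w w' *m proj F1 = dJ1 p w w' by rewrite mul_proj1 row_mxKl.
have proj2 w w' : dJ p w w' *m proj F2 = dJ2 p w w' by rewrite mul_proj2 row_mxKr.
have proj1B w w' z z' : (dJ p w w' - dJ p z z') *m proj F1 = dJ1 p w w' - dJ1 p z z'.
  by rewrite mulmxBl; congr (_ - _); apply: proj1.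
have proj2B w w' z z' : (dJ p w w' - dJ p z z') *m proj F2 = dJ2 p w w' - dJ2 p z z'.
  by rewrite mulmxBl; congr (_ - _); apply: proj2.
apply: (proj_ext (M1 := M1) (M2 := M2)).
  rewrite morimoto_proj1 !proj1B proj2B /dJ1 /dJ2 !(morimoto_proj1, morimoto_proj2).
  exact: dJ_algebra1.
rewrite morimoto_proj2 proj1B !proj2B /dJ1 /dJ2 !(morimoto_proj1, morimoto_proj2).
exact: dJ_algebra2.
Qed.

Lemma morimoto_integrable X Y p : smooth_vfield X -> smooth_vfield Y ->
  lie (app J X) (app J Y) p - app J (lie (app J X) Y) p
  - app J (lie X (app J Y)) p - lie X Y p = 0.
Proof.
move=> sX sY; have sJX := smooth_app_J sX; have sJY := smooth_app_J sY.
have lieE U V A B : smooth_vfield U -> smooth_vfield V ->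
    nabla U V p = A -> nabla V U p = B -> lie U V p = A - B.
  by move=> sU sV <- <-; exact: lie_nabla.
have NJ := nabla_J p.
exact: (nijenhuis_algebra (morimoto_square S1 S2 p)
  (lieE _ _ _ _ sJX sJY (NJ _ _ sJX sY) (NJ _ _ sJY sX))
  (lieE _ _ _ _ sJX sY erefl (NJ _ _ sY sX))
  (lieE _ _ _ _ sX sJY (NJ _ _ sX sY) erefl)
  (lieE _ _ _ _ sX sY erefl erefl)
  (dJ_nijenhuis p (X p) (Y p))).
Qed.

End Integrability.

(** * Type projections and exterior derivatives in low degree *)

Section TypeCoefficients.
Variable R : realType.
Local Notation C := R[i].
Local Notation ii := (Complex 0 1 : C).

(** The generating polynomial, in the number q of slots of type (1, 0), of the
    coefficients of type projections of a k-form: a slot where J X is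
    selected contributes i or - i X, any other slot 1 or X. *)
Definition type_poly (k t : nat) : {poly C} :=
  (ii%:P + (- ii) *: 'X) ^+ t * (1 + 'X) ^+ (k - t).

(** Expands the product of the slot contributions over the sets S. In
    particular the sum depends on T only through its cardinal. *)
Lemma type_coefE k q (T : {set 'I_k}) :
  \sum_(S : {set 'I_k} | #|S| == q)
    \prod_(l in T) (if l \in S then Complex 0 (-1) else Complex 0 1) =
  (type_poly k #|T|)`_q :> C.
Proof.
pose F (l : 'I_k) : {poly C} := if l \in T then (- ii) *: 'X else 'X.
pose G (l : 'I_k) : {poly C} := if l \in T then ii%:P else 1.
have E : type_poly k #|T| = \prod_l (F l + G l).
  rewrite /F /G (bigID (mem T)) /= /type_poly; congr (_ * _).
    rewrite (eq_bigr (fun=> ii%:P + (- ii) *: 'X)); last by move=> l ->; rewrite addrC.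
    by rewrite prodr_const.
  rewrite (eq_bigr (fun=> 1 + 'X)); last by move=> l /negPf ->; rewrite addrC.
  rewrite prodr_const; congr (_ ^+ _).
  by have := cardC T; rewrite card_ord => kE; rewrite -[X in (X - _)%N]kE addKn.
rewrite E bigA_distr coef_sum [in LHS]big_mkcond /=; apply: eq_bigr => S _.
have split i : (if i \in S then F i else G i) =
    (if i \in T then (if i \in S then Complex 0 (-1) else ii) else 1)%:P *
    (if i \in S then 'X else 1) :> {poly C}.
  rewrite /F /G; have -> : Complex 0 (-1) = - ii :> C by rewrite /GRing.opp /= oppr0.
  case: (i \in T); case: (i \in S); rewrite ?mulr1 ?mul1r ?polyC1 ?mul1r//.
  by rewrite mul_polyC.
rewrite (eq_bigr _ (fun i _ => split i)) big_split /= -rmorph_prod -!big_mkcond /=.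
by rewrite prodr_const coefCM coefXn eq_sym; case: eqP => _; rewrite ?mulr1 ?mulr0.
Qed.

Lemma type_partE n (M : manifold R n) (J : M -> 'M[R]_n) k q (w : form M k) X p :
  type_part J q w X p = \sum_(T : {set 'I_k})
    2%:R^-1 ^+ k * (type_poly k #|T|)`_q *
    w (fun l => if l \in T then app J (X l) else X l) p.
Proof.
rewrite /type_part exchange_big /=; apply: eq_bigr => T _.
by rewrite -big_distrl -big_distrr type_coefE.
Qed.

Lemma sum_set2 (V : nmodType) (f : nat -> bool -> bool -> V) :
  \sum_(T : {set 'I_2}) f #|T| (0 \in T) (1 \in T) =
  f 2 true true + f 1 true false + (f 1 false true + f 0 false false).
Proof.
pose mk (b : bool * bool) := [set l : 'I_2 | nth false [:: b.1; b.2] l]%SET.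
pose un (T : {set 'I_2}) := (0 \in T, 1 \in T).
have mkK : cancel mk un by case=> b1 b2; rewrite /un !inE.
have unK : cancel un mk.
  by move=> T; apply/setP => -[[|[|l]] lP]; rewrite // inE /=;
    congr (_ \in T); exact: val_inj.
rewrite (reindex mk); last by exists un => x _; [exact: mkK|exact: unK].
have E b : f #|mk b| (0 \in mk b) (1 \in mk b) = f (b.1 + b.2)%N b.1 b.2.
  congr f; rewrite ?inE// -sum1_card big_mkcond !big_ord_recl big_ord0 /= !inE /= addn0.
  by case: b => -[] [].
rewrite (eq_bigr _ (fun b _ => E b)).
by rewrite -(pair_bigA _ (fun a b : bool => f (a + b)%N a b)) /= !big_bool.
Qed.

Lemma sum_set3 (V : nmodType) (f : nat -> bool -> bool -> bool -> V) :
  \sum_(T : {set 'I_3}) f #|T| (0 \in T) (1 \in T) (2%:R \in T) =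
  f 3 true true true + f 2 true true false +
  (f 2 true false true + f 1 true false false) +
  (f 2 false true true + f 1 false true false +
   (f 1 false false true + f 0 false false false)).
Proof.
pose mk (b : bool * (bool * bool)) := [set l : 'I_3 | nth false [:: b.1; b.2.1; b.2.2] l]%SET.
pose un (T : {set 'I_3}) := (0 \in T, (1 \in T, 2%:R \in T)).
have mkK : cancel mk un by case=> b1 [b2 b3]; rewrite /un !inE.
have unK : cancel un mk.
  by move=> T; apply/setP => -[[|[|[|l]]] lP]; rewrite // inE /=;
    congr (_ \in T); exact: val_inj.
rewrite (reindex mk); last by exists un => x _; [exact: mkK|exact: unK].
have E b : f #|mk b| (0 \in mk b) (1 \in mk b) (2%:R \in mk b) =
    f (b.1 + (b.2.1 + b.2.2))%N b.1 b.2.1 b.2.2.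
  congr f; rewrite ?inE// -sum1_card big_mkcond !big_ord_recl big_ord0 /= !inE /= addn0.
  by case: b => -[] [[] []].
rewrite (eq_bigr _ (fun b _ => E b)).
rewrite -(pair_bigA _ (fun (a : bool) (b : bool * bool) =>
  f (a + (b.1 + b.2))%N a b.1 b.2)) /= big_bool.
rewrite -(pair_bigA _ (fun a b : bool => f (true + (a + b))%N true a b)).
rewrite -(pair_bigA _ (fun a b : bool => f (false + (a + b))%N false a b)).
by rewrite !big_bool.
Qed.

End TypeCoefficients.

Section ExplicitForms.
Variables (R : realType) (n : nat) (M : manifold R n).
Implicit Types (x y z t : vfield M) (p : M).
Local Notation C := R[i].

Definition form2 (G : vfield M -> vfield M -> M -> C) : form M 2 :=
  fun X => G (X 0) (X 1).
Definition form3 (G : vfield M -> vfield M -> vfield M -> M -> C) : form M 3 :=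
  fun X => G (X 0) (X 1) (X 2%:R).

Lemma ext_d_form2 G (X : 'I_3 -> vfield M) p
    (x := X 0) (y := X 1) (z := X 2%:R) :
  ext_d (form2 G) X p =
  cder x (G y z) p - cder y (G x z) p + cder z (G x y) p
  - G (lie x y) z p - G y (lie x z) p + G x (lie y z) p.
Proof.
(* Evaluation of X at lifted ordinals then computes. *)
have XE : X = fun i : 'I_3 => nth 0 [:: x; y; z] i.
  apply/funext => -[[|[|[|i]]] iP] //=; congr X; exact: val_inj.
rewrite /ext_d /form2 !big_ord_recl !big_ord0 /=.
do 4 rewrite ?[\sum_(i | _) _]big_mkcond ?big_ord_recl ?big_ord0 /=.
rewrite XE /= /bump /=.
move: (cder x _ p) (cder y _ p) (cder z _ p) => dx dy dz.
move: (G _ _ p) (G _ _ p) (G _ _ p) => a b c; ring.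
Qed.

Lemma ext_d_form3 G (X : 'I_4 -> vfield M) p
    (x := X 0) (y := X 1) (z := X 2%:R) (t := X 3%:R) :
  ext_d (form3 G) X p =
  cder x (G y z t) p - cder y (G x z t) p + cder z (G x y t) p - cder t (G x y z) p
  - G (lie x y) z t p - G y (lie x z) t p - G y z (lie x t) p
  + G x (lie y z) t p + G x z (lie y t) p - G x y (lie z t) p.
Proof.
have XE : X = fun i : 'I_4 => nth 0 [:: x; y; z; t] i.
  apply/funext => -[[|[|[|[|i]]]] iP] //=; congr X; exact: val_inj.
rewrite /ext_d /form3 !big_ord_recl !big_ord0 /=.
do 5 rewrite ?[\sum_(i | _) _]big_mkcond ?big_ord_recl ?big_ord0 /=.
rewrite XE /= /bump /=.
move: (cder x _ p) (cder y _ p) (cder z _ p) (cder t _ p) => dx dy dz dt.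
move: (G _ _ _ p) (G _ _ _ p) (G _ _ _ p) (G _ _ _ p) (G _ _ _ p) (G _ _ _ p).
move=> a b c d e f; ring.
Qed.

Variable J : M -> 'M[R]_n.

Lemma type_part_form2 q G (X : 'I_2 -> vfield M) p (x := X 0) (y := X 1)
    (k := fun m : nat => (2%:R^-1) ^+ 2 * (type_poly R 2 m)`_q) :
  type_part J q (form2 G) X p =
  k 2 * G (app J x) (app J y) p +
  k 1 * (G (app J x) y p + G x (app J y) p) +
  k 0 * G x y p.
Proof.
rewrite type_partE /form2.
rewrite (sum_set2 (fun m b0 b1 => k m * G (if b0 then app J x else x)
                                         (if b1 then app J y else y) p)) /=.
move: (k 2) (k 1) (k 0) (G _ _ p) (G _ _ p) (G _ _ p) (G _ _ p) => ? ? ? ? ? ? ?.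
ring.
Qed.

Lemma type_part_form3 q G (X : 'I_3 -> vfield M) p
    (x := X 0) (y := X 1) (z := X 2%:R)
    (k := fun m : nat => (2%:R^-1) ^+ 3 * (type_poly R 3 m)`_q) :
  type_part J q (form3 G) X p =
  k 3 * G (app J x) (app J y) (app J z) p +
  k 2 * (G (app J x) (app J y) z p + G (app J x) y (app J z) p
         + G x (app J y) (app J z) p) +
  k 1 * (G (app J x) y z p + G x (app J y) z p + G x y (app J z) p) +
  k 0 * G x y z p.
Proof.
rewrite type_partE /form3.
rewrite (sum_set3 (fun m b0 b1 b2 => k m * G (if b0 then app J x else x)
   (if b1 then app J y else y) (if b2 then app J z else z) p)) /=.
move: (k 3) (k 2) (k 1) (k 0) => k3 k2 k1 k0.
move: (G _ _ _ p) (G _ _ _ p) (G _ _ _ p) (G _ _ _ p) (G _ _ _ p) (G _ _ _ p)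
  (G _ _ _ p) (G _ _ _ p) => ? ? ? ? ? ? ? ?.
ring.
Qed.

End ExplicitForms.

#[local] Opaque derive der lie.

(** * Exterior derivatives of wedge products *)

Section ContactForms.
Variables (R : realType) (n : nat) (M : manifold R n).
Implicit Types (x y z t : vfield M) (p : M).

(** The relations d e = c w, d w = 0 and w /\ w = 0 between a 1-form and a
    2-form, given by their values on vector fields. *)
Record contact_forms (e : vfield M -> M -> R) (w : vfield M -> vfield M -> M -> R)
    (c : R) := ContactForms {
  cf_smooth1 : forall x, smooth_vfield x -> smooth_fun (e x);
  cf_smooth2 : forall x y, smooth_vfield x -> smooth_vfield y -> smooth_fun (w x y);
  cf_skew : forall x y p, w x y p = - w y x p;
  cf_d1 : forall x y p, smooth_vfield x -> smooth_vfield y ->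
    der x (e y) p - der y (e x) p - e (lie x y) p = c * w x y p;
  cf_d2 : forall x y z p, smooth_vfield x -> smooth_vfield y -> smooth_vfield z ->
    der x (w y z) p - der y (w x z) p + der z (w x y) p
    - w (lie x y) z p + w (lie x z) y p - w (lie y z) x p = 0;
  cf_rank2 : forall x y z t p,
    w x y p * w z t p - w x z p * w y t p + w x t p * w y z p = 0 }.

Definition wedge21 (w : vfield M -> vfield M -> M -> R) (e : vfield M -> M -> R)
  x y z : M -> R := w x y * e z - w x z * e y + w y z * e x.

Definition wedge22 (w w' : vfield M -> vfield M -> M -> R) x y z t p : R :=
  w x y p * w' z t p - w x z p * w' y t p + w x t p * w' y z p +
  (w y z p * w' x t p - w y t p * w' x z p + w z t p * w' x y p).

Definition wedge11 (e e' : vfield M -> M -> R) x y : M -> R := e x * e' y - e y * e' x.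

Definition real_d3 (G : vfield M -> vfield M -> vfield M -> M -> R) x y z t p : R :=
  der x (G y z t) p - der y (G x z t) p + der z (G x y t) p - der t (G x y z) p
  - G (lie x y) z t p - G y (lie x z) t p - G y z (lie x t) p
  + G x (lie y z) t p + G x z (lie y t) p - G x y (lie z t) p.

Definition real_d2 (G : vfield M -> vfield M -> M -> R) x y z p : R :=
  der x (G y z) p - der y (G x z) p + der z (G x y) p
  - G (lie x y) z p - G y (lie x z) p + G x (lie y z) p.

Section Wedge.
Variables (e e' : vfield M -> M -> R) (w w' : vfield M -> vfield M -> M -> R) (c c' : R).
Hypotheses (ew : contact_forms e w c) (ew' : contact_forms e' w' c').

Lemma smooth_wedge21 x y z : smooth_vfield x -> smooth_vfield y -> smooth_vfield z ->
  smooth_fun (wedge21 w e' x y z).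
Proof.
move=> sx sy sz.
have S a b k : smooth_vfield a -> smooth_vfield b -> smooth_vfield k ->
    smooth_fun (w a b * e' k).
  by move=> sa sb sk; exact: smooth_funM (cf_smooth2 ew sa sb) (cf_smooth1 ew' sk).
exact: smooth_funD (smooth_funB (S _ _ _ sx sy sz) (S _ _ _ sx sz sy)) (S _ _ _ sy sz sx).
Qed.

Lemma der_wedge21 u x y z p : smooth_vfield x -> smooth_vfield y -> smooth_vfield z ->
  der u (wedge21 w e' x y z) p =
  (w x y p * der u (e' z) p + e' z p * der u (w x y) p)
  - (w x z p * der u (e' y) p + e' y p * der u (w x z) p)
  + (w y z p * der u (e' x) p + e' x p * der u (w y z) p).
Proof.
move=> sx sy sz.
have S a b k : smooth_vfield a -> smooth_vfield b -> smooth_vfield k ->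
    smooth_fun (w a b * e' k).
  by move=> sa sb sk; exact: smooth_funM (cf_smooth2 ew sa sb) (cf_smooth1 ew' sk).
have D a b k : smooth_vfield a -> smooth_vfield b -> smooth_vfield k ->
    der u (w a b * e' k) p = w a b p * der u (e' k) p + e' k p * der u (w a b) p.
  by move=> sa sb sk; exact: derM (cf_smooth2 ew sa sb) (cf_smooth1 ew' sk).
have E1 := derB u p (S _ _ _ sx sy sz) (S _ _ _ sx sz sy).
have E2 := derD u p (smooth_funB (S _ _ _ sx sy sz) (S _ _ _ sx sz sy)) (S _ _ _ sy sz sx).
apply: etrans E2 (congr2 +%R (etrans E1 (congr2 (fun a b => a - b) _ _)) _); exact: D.
Qed.

(** d (w /\ e) = d w /\ e + w /\ d e, where f_ij, g_ijk stand for X_i(e(X_j))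
    and X_i(w(X_j, X_k)), and l_ij and l_ij_k, l_k_ij for the values of e and w on
    the bracket of X_i and X_j. *)
Lemma d_wedge21_algebra (k a12 a13 a23 a14 a24 a34 b1 b2 b3 b4 : R)
  (b12 b13 b14 b23 b24 b34 : R) (f12 f13 f14 f21 f23 f24 f31 f32 f34 f41 f42 f43 : R)
  (g123 g124 g134 g213 g214 g234 g312 g314 g324 g412 g413 g423 : R)
  (l12 l13 l14 l23 l24 l34 : R)
  (l12_3 l12_4 l13_2 l13_4 l14_2 l14_3 l23_1 l23_4 l24_1 l24_3 l34_1 l34_2 : R)
  (l2_13 l2_14 l3_14 l1_23 l1_24 l3_24 l1_34 l2_34 : R) :
  f12 - f21 - l12 = k * b12 -> f13 - f31 - l13 = k * b13 -> f14 - f41 - l14 = k * b14 ->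
  f23 - f32 - l23 = k * b23 -> f24 - f42 - l24 = k * b24 -> f34 - f43 - l34 = k * b34 ->
  g123 - g213 + g312 - l12_3 + l13_2 - l23_1 = 0 ->
  g124 - g214 + g412 - l12_4 + l14_2 - l24_1 = 0 ->
  g134 - g314 + g413 - l13_4 + l14_3 - l34_1 = 0 ->
  g234 - g324 + g423 - l23_4 + l24_3 - l34_2 = 0 ->
  l2_13 = - l13_2 -> l2_14 = - l14_2 -> l3_14 = - l14_3 ->
  l1_23 = - l23_1 -> l1_24 = - l24_1 -> l3_24 = - l24_3 -> l1_34 = - l34_1 ->
  l2_34 = - l34_2 ->
  (a23 * f14 + b4 * g123 - (a24 * f13 + b3 * g124) + (a34 * f12 + b2 * g134))
  - (a13 * f24 + b4 * g213 - (a14 * f23 + b3 * g214) + (a34 * f21 + b1 * g234))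
  + (a12 * f34 + b4 * g312 - (a14 * f32 + b2 * g314) + (a24 * f31 + b1 * g324))
  - (a12 * f43 + b3 * g412 - (a13 * f42 + b2 * g413) + (a23 * f41 + b1 * g423))
  - (l12_3 * b4 - l12_4 * b3 + a34 * l12)
  - (l2_13 * b4 - a24 * l13 + l13_4 * b2)
  - (a23 * l14 - l2_14 * b3 + l3_14 * b2)
  + (l1_23 * b4 - a14 * l23 + l23_4 * b1)
  + (a13 * l24 - l1_24 * b3 + l3_24 * b1)
  - (a12 * l34 - l1_34 * b2 + l2_34 * b1)
  = k * (a12 * b34 - a13 * b24 + a14 * b23 + (a23 * b14 - a24 * b13 + a34 * b12)).
Proof.
have solve_l (a l r : R) : a - l = r -> l = a - r.
  by move=> <-; rewrite opprB addrC subrK.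
do 6 (move=> /solve_l ->).
do 4 (move=> /eqP; rewrite subr_eq0 => /eqP <-).
by do 8 (move=> ->); ring.
Qed.

Lemma d_wedge21 x y z t p : smooth_vfield x -> smooth_vfield y ->
  smooth_vfield z -> smooth_vfield t ->
  real_d3 (wedge21 w e') x y z t p = c' * wedge22 w w' x y z t p.
Proof.
move=> sx sy sz st; rewrite /real_d3.
rewrite (der_wedge21 x p sy sz st) (der_wedge21 y p sx sz st).
rewrite (der_wedge21 z p sx sy st) (der_wedge21 t p sx sy sz).
exact: (d_wedge21_algebra (w x y p) (w x z p) (w y z p) (w x t p) (w y t p) (w z t p)
 (e' x p) (e' y p) (e' z p) (e' t p)
 (cf_d1 ew' p sx sy) (cf_d1 ew' p sx sz) (cf_d1 ew' p sx st) (cf_d1 ew' p sy sz)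
 (cf_d1 ew' p sy st) (cf_d1 ew' p sz st)
 (cf_d2 ew p sx sy sz) (cf_d2 ew p sx sy st) (cf_d2 ew p sx sz st) (cf_d2 ew p sy sz st)
 (cf_skew ew y (lie x z) p) (cf_skew ew y (lie x t) p) (cf_skew ew z (lie x t) p)
 (cf_skew ew x (lie y z) p) (cf_skew ew x (lie y t) p) (cf_skew ew z (lie y t) p)
 (cf_skew ew x (lie z t) p) (cf_skew ew y (lie z t) p)).
Qed.

End Wedge.

End ContactForms.

Section ComplexLinear.
Variables (R : realType) (n : nat) (M : manifold R n).
Implicit Types (x y z t : vfield M) (p : M) (f g : M -> R).
Local Notation C := R[i].
Local Notation "r %:C" := (real_complex R r).

Lemma der_lin x (a b : R) f g p : smooth_fun f -> smooth_fun g ->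
  der x (cst a * f + cst b * g) p = a * der x f p + b * der x g p.
Proof.
move=> sf sg; have sa k : smooth_fun (cst k : M -> R) by exact: smooth_cst.
have E k h : smooth_fun h -> der x (cst k * h) p = k * der x h p.
  move=> sh; have D := derM x p (sa k) sh; rewrite der_cst mulr0 addr0 in D.
  exact: D.
apply: etrans (derD x p (smooth_funM (sa a) sf) (smooth_funM (sa b) sg)) _.
by rewrite !E.
Qed.

Lemma cder_lin x (a b : C) f g p : smooth_fun f -> smooth_fun g ->
  cder x (fun q => a * (f q)%:C + b * (g q)%:C) p =
  a * (der x f p)%:C + b * (der x g p)%:C.
Proof.
move=> sf sg; rewrite /cder.
have -> : (fun q => complex.Re (a * (f q)%:C + b * (g q)%:C)) =
    cst (complex.Re a) * f + cst (complex.Re b) * g.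
  by apply/funext => q; case: a b => [a1 a2] [b1 b2]; rewrite /= !mulr0 !subr0.
have -> : (fun q => complex.Im (a * (f q)%:C + b * (g q)%:C)) =
    cst (complex.Im a) * f + cst (complex.Im b) * g.
  by apply/funext => q; case: a b => [a1 a2] [b1 b2]; rewrite /= !mulr0 !add0r.
rewrite !der_lin//; move: (der x f p) (der x g p) => u v.
by case: a b => [a1 a2] [b1 b2]; apply/eqP; rewrite eq_complex /= !mulr0 !subr0 !add0r !eqxx.
Qed.

Definition smooth3 (G : vfield M -> vfield M -> vfield M -> M -> R) :=
  forall x y z, smooth_vfield x -> smooth_vfield y -> smooth_vfield z ->
  smooth_fun (G x y z).

Definition lin3 (a b : R) (G H : vfield M -> vfield M -> vfield M -> M -> R) x y z : M -> R :=
  cst a * G x y z + cst b * H x y z.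

Lemma lin3E a b G H x y z p :
  lin3 a b G H x y z p = a * G x y z p + b * H x y z p.
Proof. by []. Qed.

Definition lform3 (a b : C) (G H : vfield M -> vfield M -> vfield M -> M -> R) : form M 3 :=
  form3 (fun x y z p => a * (G x y z p)%:C + b * (H x y z p)%:C).

Lemma smooth_lin3 a b G H : smooth3 G -> smooth3 H -> smooth3 (lin3 a b G H).
Proof.
move=> sG sH x y z sx sy sz.
have sa k : smooth_fun (cst k : M -> R) by exact: smooth_cst.
exact: smooth_funD (smooth_funM (sa a) (sG _ _ _ sx sy sz))
  (smooth_funM (sa b) (sH _ _ _ sx sy sz)).
Qed.

Lemma real_d3_lin a b G H x y z t p : smooth3 G -> smooth3 H ->
  smooth_vfield x -> smooth_vfield y -> smooth_vfield z -> smooth_vfield t ->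
  real_d3 (lin3 a b G H) x y z t p = a * real_d3 G x y z t p + b * real_d3 H x y z t p.
Proof.
move=> sG sH sx sy sz st; rewrite /real_d3.
rewrite (der_lin x a b p (sG y z t sy sz st) (sH y z t sy sz st)).
rewrite (der_lin y a b p (sG x z t sx sz st) (sH x z t sx sz st)).
rewrite (der_lin z a b p (sG x y t sx sy st) (sH x y t sx sy st)).
rewrite (der_lin t a b p (sG x y z sx sy sz) (sH x y z sx sy sz)).
rewrite !lin3E.
move: (der x (G _ _ _) p) (der y (G _ _ _) p) (der z (G _ _ _) p) (der t (G _ _ _) p).
move: (der x (H _ _ _) p) (der y (H _ _ _) p) (der z (H _ _ _) p) (der t (H _ _ _) p).
move: (G (lie _ _) z t p) (G _ (lie _ _) t p) (G _ _ (lie _ _) p) (G _ (lie _ _) t p)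
 (G _ _ (lie _ _) p) (G _ _ (lie _ _) p).
move: (H (lie _ _) z t p) (H _ (lie _ _) t p) (H _ _ (lie _ _) p) (H _ (lie _ _) t p)
 (H _ _ (lie _ _) p) (H _ _ (lie _ _) p).
move=> *; ring.
Qed.

Lemma ext_d_lform3 a b G H (X : 'I_4 -> vfield M) p : smooth3 G -> smooth3 H ->
  (forall i, smooth_vfield (X i)) ->
  ext_d (lform3 a b G H) X p =
  a * (real_d3 G (X 0) (X 1) (X 2%:R) (X 3%:R) p)%:C +
  b * (real_d3 H (X 0) (X 1) (X 2%:R) (X 3%:R) p)%:C.
Proof.
move=> sG sH sX; rewrite /lform3 ext_d_form3 /real_d3.
move: (X 0) (X 1) (X 2%:R) (X 3%:R) (sX 0) (sX 1) (sX 2%:R) (sX 3%:R).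
move=> x y z t sx sy sz st.
rewrite (cder_lin x a b p (sG y z t sy sz st) (sH y z t sy sz st)).
rewrite (cder_lin y a b p (sG x z t sx sz st) (sH x z t sx sz st)).
rewrite (cder_lin z a b p (sG x y t sx sy st) (sH x y t sx sy st)).
rewrite (cder_lin t a b p (sG x y z sx sy sz) (sH x y z sx sy sz)).
move: (der x (G _ _ _) p) (der y (G _ _ _) p) (der z (G _ _ _) p) (der t (G _ _ _) p).
move: (der x (H _ _ _) p) (der y (H _ _ _) p) (der z (H _ _ _) p) (der t (H _ _ _) p).
move: (G (lie _ _) z t p) (G _ (lie _ _) t p) (G _ _ (lie _ _) p) (G _ (lie _ _) t p)
 (G _ _ (lie _ _) p) (G _ _ (lie _ _) p).
move: (H (lie _ _) z t p) (H _ (lie _ _) t p) (H _ _ (lie _ _) p) (H _ (lie _ _) t p)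
 (H _ _ (lie _ _) p) (H _ _ (lie _ _) p).
move=> *; rewrite !(rmorphD, rmorphN) /=; ring.
Qed.

End ComplexLinear.

(** * The form del delbar Omega *)

Section SmoothEquality.
Variables (R : realType) (n : nat) (M : manifold R n) (J : M -> 'M[R]_n).
Hypothesis sJ : smooth_endo J.

(** Exterior derivatives are only computed on smooth fields, so identities
    between forms hold in this sense. *)
Definition smooth_eq k (w w' : form M k) : Prop :=
  forall X, (forall i, smooth_vfield (X i)) -> forall p, w X p = w' X p.

Lemma smooth_eq_ext_d k (w w' : form M k) :
  smooth_eq w w' -> smooth_eq (ext_d w) (ext_d w').
Proof.
move=> ww' X sX p; apply: eq_bigr => i _; congr (_ * (_ - _)).
  have -> // : w (fun l => X (lift i l)) = w' (fun l => X (lift i l)).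
  by apply/funext => q; exact: ww'.
apply: eq_bigr => j _; apply: ww' => l; case: eqP => _ //.
exact: smooth_lie.
Qed.

Lemma smooth_eq_type_part k q (w w' : form M k) :
  smooth_eq w w' -> smooth_eq (type_part J q w) (type_part J q w').
Proof.
move=> ww' X sX p; apply: eq_bigr => S _; apply: eq_bigr => T _; congr (_ * _).
by apply: ww' => l; case: ifP => _ //; exact: smooth_app.
Qed.

Lemma type_part0 k q (w : form M k) :
  smooth_eq w (fun _ _ => 0) -> smooth_eq (type_part J q w) (fun _ _ => 0).
Proof.
move=> w0 X sX p; rewrite (smooth_eq_type_part q w0)// /type_part.
by rewrite big1// => S _; rewrite big1// => T _; rewrite mulr0.
Qed.

End SmoothEquality.

Section DelDelbar.
Variables (R : realType) (n : nat) (M : manifold R n) (J : M -> 'M[R]_n).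
Variables (e1 e2 : vfield M -> M -> R) (w1 w2 : vfield M -> vfield M -> M -> R).
Variables (c1 c2 : R).
Hypothesis sJ : smooth_endo J.
Hypothesis ew1 : contact_forms e1 w1 c1.
Hypothesis ew2 : contact_forms e2 w2 c2.
Hypothesis e1J : forall x p, e1 (app J x) p = - e2 x p.
Hypothesis e2J : forall x p, e2 (app J x) p = e1 x p.
Hypothesis w1J : forall x y p, w1 (app J x) (app J y) p = w1 x y p.
Hypothesis w2J : forall x y p, w2 (app J x) (app J y) p = w2 x y p.
Hypothesis w1JJ : forall x y p, w1 x (app J y) p = - w1 (app J x) y p.
Hypothesis w2JJ : forall x y p, w2 x (app J y) p = - w2 (app J x) y p.
Implicit Types (x y z t : vfield M) (p : M).
Local Notation C := R[i].
Local Notation "r %:C" := (real_complex R r).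

Definition fundamental x y : M -> R := w1 x y + w2 x y + wedge11 e1 e2 x y.
(** The exterior derivative of [fundamental], and its value on J X, J Y, J Z. *)
Definition torsion := lin3 c1 (- c2) (wedge21 w1 e2) (wedge21 w2 e1).
Definition torsionJ := lin3 c1 c2 (wedge21 w1 e1) (wedge21 w2 e2).

Let s12 : smooth3 (wedge21 w1 e2).
Proof. by move=> x y z; exact: (smooth_wedge21 ew1 ew2). Qed.
Let s21 : smooth3 (wedge21 w2 e1).
Proof. by move=> x y z; exact: (smooth_wedge21 ew2 ew1). Qed.
Let s11 : smooth3 (wedge21 w1 e1).
Proof. by move=> x y z; exact: (smooth_wedge21 ew1 ew1). Qed.
Let s22 : smooth3 (wedge21 w2 e2).
Proof. by move=> x y z; exact: (smooth_wedge21 ew2 ew2). Qed.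
Let sT : smooth3 torsion. Proof. exact: smooth_lin3. Qed.
Let sTJ : smooth3 torsionJ. Proof. exact: smooth_lin3. Qed.

Lemma wedge22C w w' x y z t p :
  wedge22 w w' x y z t p = wedge22 w' w x y z t p :> R.
Proof. by rewrite /wedge22; ring. Qed.

Lemma wedge22_self e w c x y z t p : contact_forms e w c -> wedge22 w w x y z t p = 0.
Proof.
move=> ew; have H := cf_rank2 ew x y z t p; rewrite /wedge22.
rewrite -[RHS](addr0 0) -{1}H -H; ring.
Qed.

Lemma d_torsion x y z t p : smooth_vfield x -> smooth_vfield y ->
  smooth_vfield z -> smooth_vfield t -> real_d3 torsion x y z t p = 0.
Proof.
move=> sx sy sz st; apply: etrans (real_d3_lin _ _ p s12 s21 sx sy sz st) _.
rewrite (d_wedge21 ew1 ew2)// (d_wedge21 ew2 ew1)// (wedge22C w2 w1); ring.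
Qed.

Lemma d_torsionJ x y z t p : smooth_vfield x -> smooth_vfield y ->
  smooth_vfield z -> smooth_vfield t -> real_d3 torsionJ x y z t p = 0.
Proof.
move=> sx sy sz st; apply: etrans (real_d3_lin _ _ p s11 s22 sx sy sz st) _.
rewrite (d_wedge21 ew1 ew1)// (d_wedge21 ew2 ew2)//.
by rewrite (wedge22_self _ _ _ _ _ ew1) (wedge22_self _ _ _ _ _ ew2) !mulr0 addr0.
Qed.

(** d (Phi_1 + Phi_2 + e_1 /\ e_2) = d e_1 /\ e_2 - e_1 /\ d e_2, in the
    notation of [d_wedge21_algebra]: f and l, g and p are the derivatives and
    bracket terms of e_1 and w_1, and h and m, k and q those of e_2 and w_2. *)
Lemma d_fundamental_algebra
  (f12 f13 f21 f23 f31 f32 h12 h13 h21 h23 h31 h32 a1 a2 a3 b1 b2 b3 : R)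
  (v12 v13 v23 u12 u13 u23 l12 l13 l23 m12 m13 m23 : R)
  (g1 g2 g3 k1 k2 k3 p12 p13 p23 q12 q13 q23 p2_13 p1_23 q2_13 q1_23 : R) :
  f12 - f21 - l12 = c1 * v12 -> f13 - f31 - l13 = c1 * v13 -> f23 - f32 - l23 = c1 * v23 ->
  h12 - h21 - m12 = c2 * u12 -> h13 - h31 - m13 = c2 * u13 -> h23 - h32 - m23 = c2 * u23 ->
  g1 - g2 + g3 - p12 + p13 - p23 = 0 -> k1 - k2 + k3 - q12 + q13 - q23 = 0 ->
  p2_13 = - p13 -> p1_23 = - p23 -> q2_13 = - q13 -> q1_23 = - q23 ->
  (g1 + k1 + ((a2 * h13 + b3 * f12) - (a3 * h12 + b2 * f13)))
  - (g2 + k2 + ((a1 * h23 + b3 * f21) - (a3 * h21 + b1 * f23)))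
  + (g3 + k3 + ((a1 * h32 + b2 * f31) - (a2 * h31 + b1 * f32)))
  - (p12 + q12 + (l12 * b3 - a3 * m12)) - (p2_13 + q2_13 + (a2 * m13 - l13 * b2))
  + (p1_23 + q1_23 + (a1 * m23 - l23 * b1)) =
  c1 * (v12 * b3 - v13 * b2 + v23 * b1) + (- c2) * (u12 * a3 - u13 * a2 + u23 * a1).
Proof.
have solve_l (a l r : R) : a - l = r -> l = a - r.
  by move=> <-; rewrite opprB addrC subrK.
do 6 (move=> /solve_l ->).
do 2 (move=> /eqP; rewrite subr_eq0 => /eqP <-).
by do 4 (move=> ->); ring.
Qed.

Lemma der_fundamental u x y p : smooth_vfield x -> smooth_vfield y ->
  der u (fundamental x y) p = der u (w1 x y) p + der u (w2 x y) p +
  ((e1 x p * der u (e2 y) p + e2 y p * der u (e1 x) p)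
   - (e1 y p * der u (e2 x) p + e2 x p * der u (e1 y) p)).
Proof.
move=> sx sy.
have S a b : smooth_vfield a -> smooth_vfield b -> smooth_fun (e1 a * e2 b).
  by move=> sa sb; exact: smooth_funM (cf_smooth1 ew1 sa) (cf_smooth1 ew2 sb).
have D a b : smooth_vfield a -> smooth_vfield b ->
    der u (e1 a * e2 b) p = e1 a p * der u (e2 b) p + e2 b p * der u (e1 a) p.
  by move=> sa sb; exact: derM (cf_smooth1 ew1 sa) (cf_smooth1 ew2 sb).
have sw := smooth_funD (cf_smooth2 ew1 sx sy) (cf_smooth2 ew2 sx sy).
have se := smooth_funB (S _ _ sx sy) (S _ _ sy sx).
have E1 := derD u p sw se.
have E2 := derD u p (cf_smooth2 ew1 sx sy) (cf_smooth2 ew2 sx sy).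
have E3 := derB u p (S _ _ sx sy) (S _ _ sy sx).
exact: etrans E1 (congr2 +%R E2 (etrans E3
  (congr2 (fun a b => a - b) (D _ _ sx sy) (D _ _ sy sx)))).
Qed.

Lemma smooth_fundamental x y : smooth_vfield x -> smooth_vfield y ->
  smooth_fun (fundamental x y).
Proof.
move=> sx sy.
have S a b : smooth_vfield a -> smooth_vfield b -> smooth_fun (e1 a * e2 b).
  by move=> sa sb; exact: smooth_funM (cf_smooth1 ew1 sa) (cf_smooth1 ew2 sb).
exact: smooth_funD (smooth_funD (cf_smooth2 ew1 sx sy) (cf_smooth2 ew2 sx sy))
  (smooth_funB (S _ _ sx sy) (S _ _ sy sx)).
Qed.

Lemma d_fundamental x y z p : smooth_vfield x -> smooth_vfield y -> smooth_vfield z ->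
  real_d2 fundamental x y z p = torsion x y z p.
Proof.
move=> sx sy sz; rewrite /real_d2.
rewrite (der_fundamental x p sy sz) (der_fundamental y p sx sz) (der_fundamental z p sx sy).
exact: (d_fundamental_algebra
 (e1 x p) (e1 y p) (e1 z p) (e2 x p) (e2 y p) (e2 z p)
 (cf_d1 ew1 p sx sy) (cf_d1 ew1 p sx sz) (cf_d1 ew1 p sy sz)
 (cf_d1 ew2 p sx sy) (cf_d1 ew2 p sx sz) (cf_d1 ew2 p sy sz)
 (cf_d2 ew1 p sx sy sz) (cf_d2 ew2 p sx sy sz)
 (cf_skew ew1 y (lie x z) p) (cf_skew ew1 x (lie y z) p)
 (cf_skew ew2 y (lie x z) p) (cf_skew ew2 x (lie y z) p)).
Qed.

Lemma fundamental_J x y p : fundamental (app J x) (app J y) p = fundamental x y p.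
Proof. by rewrite /fundamental /wedge11 !fctE w1J w2J !e1J !e2J; ring. Qed.

Lemma fundamental_J1 x y p :
  fundamental (app J x) y p + fundamental x (app J y) p = 0.
Proof. by rewrite /fundamental /wedge11 !fctE w1JJ w2JJ !e1J !e2J; ring. Qed.

Lemma torsionE x y z p : torsion x y z p =
  c1 * (w1 x y p * e2 z p - w1 x z p * e2 y p + w1 y z p * e2 x p)
  - c2 * (w2 x y p * e1 z p - w2 x z p * e1 y p + w2 y z p * e1 x p).
Proof. by rewrite [LHS]lin3E [(- c2) * _]mulNr. Qed.

Lemma torsionJE x y z p : torsionJ x y z p =
  c1 * (w1 x y p * e1 z p - w1 x z p * e1 y p + w1 y z p * e1 x p)
  + c2 * (w2 x y p * e2 z p - w2 x z p * e2 y p + w2 y z p * e2 x p).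
Proof. by []. Qed.

Lemma torsion_J3 x y z p :
  (torsion (app J x) (app J y) (app J z) p = torsionJ x y z p) *
  (torsionJ (app J x) (app J y) (app J z) p = - torsion x y z p).
Proof. by split; rewrite torsionE torsionJE !w1J !w2J !e1J !e2J; ring. Qed.

(** In terms of types: a form of type (2, 1) + (1, 2) is fixed by the sum of
    the three ways of applying J to two arguments. *)
Lemma torsion_J2 x y z p :
  (torsion (app J x) (app J y) z p + torsion (app J x) y (app J z) p
   + torsion x (app J y) (app J z) p = torsion x y z p) *
  (torsionJ (app J x) (app J y) z p + torsionJ (app J x) y (app J z) p
   + torsionJ x (app J y) (app J z) p = torsionJ x y z p).
Proof.
by split; rewrite ?torsionE ?torsionJE !w1J !w2J !e1J !e2J !w1JJ !w2JJ; ring.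
Qed.

Lemma torsion_J1 x y z p :
  (torsion (app J x) y z p + torsion x (app J y) z p + torsion x y (app J z) p
   = torsionJ x y z p) *
  (torsionJ (app J x) y z p + torsionJ x (app J y) z p + torsionJ x y (app J z) p
   = - torsion x y z p).
Proof.
by split; rewrite ?torsionE ?torsionJE !e1J !e2J !w1JJ !w2JJ; ring.
Qed.

Definition fform (a : C) : form M 2 := form2 (fun x y p => a * (fundamental x y p)%:C).
Definition tform (a b : C) : form M 3 := lform3 a b torsion torsionJ.

Lemma type_algebra3 (k0 k1 k2 k3 a b : C) (t u t1 t2 t3 u1 u2 u3 s1 s2 s3 v1 v2 v3 : R) :
  t1 + t2 + t3 = t -> u1 + u2 + u3 = u -> s1 + s2 + s3 = u -> v1 + v2 + v3 = - t ->
  k3 * (a * u%:C + b * (- t)%:C) +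
  k2 * (a * t1%:C + b * u1%:C + (a * t2%:C + b * u2%:C) + (a * t3%:C + b * u3%:C)) +
  k1 * (a * s1%:C + b * v1%:C + (a * s2%:C + b * v2%:C) + (a * s3%:C + b * v3%:C)) +
  k0 * (a * t%:C + b * u%:C) =
  ((k0 + k2) * a - (k1 + k3) * b) * t%:C + ((k0 + k2) * b + (k1 + k3) * a) * u%:C.
Proof.
move=> Et Eu Es Ev.
have sumC (x1 x2 x3 y1 y2 y3 : R) :
    a * x1%:C + b * y1%:C + (a * x2%:C + b * y2%:C) + (a * x3%:C + b * y3%:C) =
    a * (x1 + x2 + x3)%:C + b * (y1 + y2 + y3)%:C by rewrite !rmorphD /=; ring.
by rewrite !sumC Et Eu Es Ev rmorphN /=; ring.
Qed.

Definition coeff k q m : C := (2%:R^-1) ^+ k * (type_poly R k m)`_q.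

Lemma type_part_fform q a :
  type_part J q (fform a) = fform ((coeff 2 q 2 + coeff 2 q 0) * a).
Proof.
apply/funext => X; apply/funext => p; apply: etrans (type_part_form2 _ _ _ _ _) _.
have H := fundamental_J1 (X 0) (X 1) p.
rewrite fundamental_J /fform /form2 /= -/(coeff 2 q 2) -/(coeff 2 q 1) -/(coeff 2 q 0).
rewrite -mulrDr -rmorphD H rmorph0 /=.
move: (coeff _ _ _) (coeff _ _ _) (coeff _ _ _) (_%:C) => k2 k1 k0 f; ring.
Qed.

(** Type projections combine the values on 0, 1, 2 or 3 arguments multiplied by
    J with coefficients depending on that number only, and each of the four sums
    is plus or minus one of the two forms. *)
Lemma type_part_tform q a b :
  let k := coeff 3 q in
  type_part J q (tform a b) = tform ((k 0%N + k 2) * a - (k 1%N + k 3) * b)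
                                    ((k 0%N + k 2) * b + (k 1%N + k 3) * a).
Proof.
move=> k; apply/funext => X; apply/funext => p; apply: etrans (type_part_form3 _ _ _ _ _) _.
rewrite -/(coeff 3 q 3) -/(coeff 3 q 2) -/(coeff 3 q 1) -/(coeff 3 q 0) -/k.
rewrite /tform /lform3 /form3; move: (X 0) (X 1) (X 2%:R) => x y z.
have [T3 TJ3] := torsion_J3 x y z p.
have [T2 TJ2] := torsion_J2 x y z p.
have [T1 TJ1] := torsion_J1 x y z p.
rewrite T3 TJ3; exact: (type_algebra3 _ _ _ _ _ _ T2 TJ2 T1 TJ1).
Qed.

Lemma ext_d_fform a : smooth_eq (ext_d (fform a)) (tform a 0).
Proof.
move=> X sX p; rewrite /fform ext_d_form2 /tform /lform3 /form3 mul0r addr0.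
move: (X 0) (X 1) (X 2%:R) (sX 0) (sX 1) (sX 2%:R) => x y z sx sy sz.
rewrite -(d_fundamental p sx sy sz) /real_d2.
have D u v v' : smooth_vfield v -> smooth_vfield v' ->
    cder u (fun q => a * (fundamental v v' q)%:C) p = a * (der u (fundamental v v') p)%:C.
  move=> sv sv'; have sf := smooth_fundamental sv sv'.
  have H := cder_lin u a 0 p sf sf; rewrite mul0r addr0 in H; rewrite -H.
  by congr (cder u _ p); apply/funext => q; rewrite mul0r addr0.
rewrite (D x _ _ sy sz) (D y _ _ sx sz) (D z _ _ sx sy).
move: (der x _ p) (der y _ p) (der z _ p).
move: (fundamental (lie _ _) _ p) (fundamental _ (lie _ _) p) (fundamental _ (lie _ _) p).
by move=> *; rewrite !(rmorphD, rmorphN) /=; ring.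
Qed.

Lemma ext_d_tform a b : smooth_eq (ext_d (tform a b)) (fun _ _ => 0).
Proof.
move=> X sX p; rewrite /tform ext_d_lform3// d_torsion// d_torsionJ//.
by rewrite rmorph0 !mulr0 addr0.
Qed.

Lemma tformD a b a' b' X p : tform a b X p + tform a' b' X p = tform (a + a') (b + b') X p.
Proof.
rewrite /tform /lform3 /form3.
by move: (_%:C) (_%:C) => u v; ring.
Qed.

Lemma delbar_fform : exists a b, smooth_eq (delbar J (fform 1)) (tform a b).
Proof.
have T q : exists a b, smooth_eq (type_part J q (ext_d (type_part J q (fform 1)))) (tform a b).
  rewrite type_part_fform; move: (_ * _) => c.
  have H := smooth_eq_type_part sJ q (ext_d_fform c).
  by rewrite type_part_tform in H; do 2 eexists; exact: H.
have [a0 [b0 H0]] := T 0; have [a1 [b1 H1]] := T 1; have [a2 [b2 H2]] := T 2.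
exists (a0 + a1 + a2), (b0 + b1 + b2) => X sX p.
rewrite /delbar !big_ord_recl big_ord0 addr0 H0// H1// H2// !tformD.
by rewrite !addrA.
Qed.

(** [delbar_fform] puts delbar Omega in the span of T and T', which is stable
    under type projections and consists of closed forms. *)
Theorem del_delbar_fform : smooth_eq (del J (delbar J (fform 1))) (fun _ _ => 0).
Proof.
have [a [b H]] := delbar_fform.
move=> X sX p; rewrite /del big1// => q _.
apply: (type_part0 sJ) => // Y sY r.
rewrite (smooth_eq_ext_d (smooth_eq_type_part sJ q H))// type_part_tform.
exact: ext_d_tform.
Qed.

End DelDelbar.

(** * Products of Sasakian and cosymplectic manifolds *)

Section Rank.
Variables (R : realType) (N : manifold R 3) (S : acm_structure N) (p : N).

(** The Pfaffian of a 4 x 4 Gram matrix of a skew form on a space of dimension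
    three; in coordinates it is a polynomial identity. *)
Lemma Phi_at_rank2 x y z t :
  Phi_at S p x y * Phi_at S p z t - Phi_at S p x z * Phi_at S p y t +
  Phi_at S p x t * Phi_at S p y z = 0.
Proof.
pose d (i : 'I_3) : 'rV[R]_3 := delta_mx 0 i.
pose a := Phi_at S p (d 0) (d 1); pose b := Phi_at S p (d 0) (d 2%:R).
pose c := Phi_at S p (d 1) (d 2%:R).
have diag v : Phi_at S p v v = 0.
  have /eqP := Phi_atC S p v v.
  by rewrite -subr_eq0 opprK -mulr2n mulrn_eq0 => /eqP.
have E u v : Phi_at S p u v = a * (u 0 0 * v 0 1 - u 0 1 * v 0 0) +
    b * (u 0 0 * v 0 2%:R - u 0 2%:R * v 0 0) + c * (u 0 1 * v 0 2%:R - u 0 2%:R * v 0 1).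
  have dec (w : 'rV[R]_3) : w = w 0 0 *: d 0 + w 0 1 *: d 1 + w 0 2%:R *: d 2%:R.
    rewrite [LHS]row_sum_delta !big_ord_recl big_ord0 addr0 addrA.
    by congr (w 0 _ *: d _ + w 0 _ *: d _ + w 0 _ *: d _); exact: val_inj.
  rewrite (dec u) (dec v) !Phi_atD !Phi_atZ !diag (Phi_atC _ _ (d 1) (d 0)).
  rewrite (Phi_atC _ _ (d 2%:R) (d 0)) (Phi_atC _ _ (d 2%:R) (d 1)) -/a -/b -/c -!dec.
  ring.
rewrite !E; ring.
Qed.

End Rank.

Section SasakianFactor.
Variables (R : realType) (n : nat) (N : manifold R 3) (M : manifold R n) (F : factor N M).
Variables (S : acm_structure N) (alpha : R).

Lemma trans_sasakian_contact_forms : trans_sasakian_type S (fun=> alpha) (fun=> 0) ->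
  contact_forms (eta_form F S) (Phi_form F S) (- (alpha *+ 2)).
Proof.
move=> [D lc D_phi0].
have D_phi X Y : smooth_vfield X -> smooth_vfield Y -> forall p,
  D X (app (phi S) Y) p - app (phi S) (D X Y) p =
  alpha *: (met_at S p (X p) (Y p) *: xi S p - eta_at S p (Y p) *: X p).
  by move=> sX sY p; rewrite D_phi0// scale0r addr0.
split.
- by move=> x sx; exact: smooth_eta_form.
- by move=> x y sx sy; exact: smooth_Phi_form.
- by move=> x y p; exact: Phi_atC.
- by move=> x y p sx sy; exact: (d_eta_form F lc D_phi).
- by move=> x y z p sx sy sz; exact: (d_Phi_form F lc D_phi).
- by move=> x y z t p; exact: Phi_at_rank2.
Qed.

End SasakianFactor.

Section KahlerForm.
Variables (R : realType) (n1 n2 : nat) (M1 : manifold R n1) (M2 : manifold R n2).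
Variables (S1 : acm_structure M1) (S2 : acm_structure M2).
Local Notation M := (prod_manifold M1 M2).
Local Notation F1 := (fst_factor M1 M2).
Local Notation F2 := (snd_factor M1 M2).
Local Notation J := (morimoto S1 S2).
Local Notation g := (prod_metric S1 S2).

Lemma eta1_J (x : vfield M) (p : M) : eta_form F1 S1 (app J x) p = - eta_form F2 S2 x p.
Proof.
rewrite /eta_form /app morimoto_proj1.
by rewrite eta_atD eta_at_phi eta_atN eta_atZ eta_at_xi mulr1 add0r.
Qed.

Lemma eta2_J (x : vfield M) (p : M) : eta_form F2 S2 (app J x) p = eta_form F1 S1 x p.
Proof.
by rewrite /eta_form /app morimoto_proj2 eta_atD eta_at_phi eta_atZ eta_at_xi mulr1 add0r.
Qed.

Lemma Phi1_J (x y : vfield M) (p : M) :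
  Phi_form F1 S1 (app J x) (app J y) p = Phi_form F1 S1 x y p.
Proof.
rewrite /Phi_form /app !morimoto_proj1 !(Phi_atD, Phi_atN, Phi_atZ, Phi_at_xi).
by rewrite !(mulr0, oppr0, addr0) [LHS]Phi_at_phi.
Qed.

Lemma Phi2_J (x y : vfield M) (p : M) :
  Phi_form F2 S2 (app J x) (app J y) p = Phi_form F2 S2 x y p.
Proof.
rewrite /Phi_form /app !morimoto_proj2 !(Phi_atD, Phi_atN, Phi_atZ, Phi_at_xi).
by rewrite !(mulr0, addr0) [LHS]Phi_at_phi.
Qed.

Lemma app_JJ (x : vfield M) (p : M) : app J (app J x) p = - x p.
Proof. by rewrite /app -mulmxA morimoto_square mulmxN mulmx1. Qed.

Lemma Phi1_JJ (x y : vfield M) (p : M) :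
  Phi_form F1 S1 x (app J y) p = - Phi_form F1 S1 (app J x) y p.
Proof. by rewrite -Phi1_J {1}/Phi_form app_JJ mulNmx Phi_atN. Qed.

Lemma Phi2_JJ (x y : vfield M) (p : M) :
  Phi_form F2 S2 x (app J y) p = - Phi_form F2 S2 (app J x) y p.
Proof. by rewrite -Phi2_J {1}/Phi_form app_JJ mulNmx Phi_atN. Qed.

Lemma kahler_formE : kahler_form J g =
  fform (eta_form F1 S1) (eta_form F2 S2) (Phi_form F1 S1) (Phi_form F2 S2) 1.
Proof.
apply/funext => X; apply/funext => p; rewrite /fform /form2 mul1r.
congr Complex; rewrite /fundamental /wedge11 !fctE /ip ip_prod_metric.
rewrite /app morimoto_proj1 morimoto_proj2 /Phi_form /eta_form /Phi_at.
rewrite !(met_atDl, met_atNl, met_atZl) !(met_atC _ _ (xi _ _)) !met_at_xi.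
by ring.
Qed.

Lemma del_delbar_kahler c1 c2 :
  contact_forms (eta_form F1 S1) (Phi_form F1 S1) c1 ->
  contact_forms (eta_form F2 S2) (Phi_form F2 S2) c2 ->
  smooth_eq (del J (delbar J (kahler_form J g))) (fun _ _ => 0).
Proof.
move=> cf1 cf2; rewrite kahler_formE.
exact: (del_delbar_fform (morimoto_smooth S1 S2) cf1 cf2 eta1_J eta2_J
    Phi1_J Phi2_J Phi1_JJ Phi2_JJ).
Qed.

End KahlerForm.

Lemma product_astheno_kahler (R : realType) (M1 M2 : manifold R 3)
    (S1 : acm_structure M1) (S2 : acm_structure M2) (alpha1 alpha2 : R) :
  trans_sasakian_type S1 (fun=> alpha1) (fun=> 0) ->
  trans_sasakian_type S2 (fun=> alpha2) (fun=> 0) ->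
  @astheno_kahler3 R (prod_manifold M1 M2) (morimoto S1 S2) (prod_metric S1 S2).
Proof.
move=> ts1 ts2; split; last first.
  have cf1 := trans_sasakian_contact_forms (fst_factor M1 M2) ts1.
  have cf2 := trans_sasakian_contact_forms (snd_factor M1 M2) ts2.
  move=> X sX p; exact: (del_delbar_kahler cf1 cf2 sX).
have [D1 lc1 D1_phi0] := ts1; have [D2 lc2 D2_phi0] := ts2.
have D1_phi X Y : smooth_vfield X -> smooth_vfield Y -> forall p,
  D1 X (app (phi S1) Y) p - app (phi S1) (D1 X Y) p =
  alpha1 *: (met_at S1 p (X p) (Y p) *: xi S1 p - eta_at S1 p (Y p) *: X p).
  by move=> sX sY p; rewrite D1_phi0// scale0r addr0.
have D2_phi X Y : smooth_vfield X -> smooth_vfield Y -> forall p,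
  D2 X (app (phi S2) Y) p - app (phi S2) (D2 X Y) p =
  alpha2 *: (met_at S2 p (X p) (Y p) *: xi S2 p - eta_at S2 p (Y p) *: X p).
  by move=> sX sY p; rewrite D2_phi0// scale0r addr0.
split.
- exact: morimoto_smooth.
- exact: morimoto_square.
- by move=> X Y sX sY p; exact: (morimoto_integrable lc1 lc2 D1_phi D2_phi).
- exact: prod_metric_riemannian.
- exact: morimoto_compatible.
Qed.

Theorem mainTheorem2 (R : realType) (M1 M2 : manifold R 3)
    (S1 : acm_structure M1) (S2 : acm_structure M2)
    (compact1 : compact [set: M1]) (compact2 : compact [set: M2])
    (ts1 : trans_sasakian S1) (ts2 : trans_sasakian S2) :
  let astheno := @astheno_kahler3 R (prod_manifold M1 M2)
                   (morimoto S1 S2) (prod_metric S1 S2) in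
  [/\ forall alpha1 alpha2 : R,
        alpha_sasakian S1 alpha1 -> alpha_sasakian S2 alpha2 -> astheno,
      forall alpha1 : R,
        alpha_sasakian S1 alpha1 -> cosymplectic S2 -> astheno,
      forall alpha2 : R,
        cosymplectic S1 -> alpha_sasakian S2 alpha2 -> astheno &
      cosymplectic S1 -> cosymplectic S2 -> astheno].
Proof.
split.
- by move=> alpha1 alpha2 [_ s1] [_ s2]; exact: product_astheno_kahler s1 s2.
- by move=> alpha1 [_ s1] s2; exact: product_astheno_kahler s1 s2.
- by move=> alpha2 s1 [_ s2]; exact: product_astheno_kahler s1 s2.
- by move=> s1 s2; exact: product_astheno_kahler s1 s2.
Qed.
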